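(* Let $X$ be a crowded feebly compact $\pi$-regular space. If $c(X)<\mathfrak{c}^{+\omega}$, then $X$ is $\mathfrak{c}$-resolvable. Moreover, if the Continuum Hypothesis fails and $c(X)<\mathfrak{c}^{+\omega_1}$, then $X$ is $\mathfrak{c}$-resolvable.
   Context: A topological space is crowded if it has no isolated points. A space $X$ is $\pi$-regular if it is Hausdorff and for every non-empty open set $U$ in $X$ there is a non-empty open set $V$ with $\overline{V}\subset U$. A space $X$ is feebly compact if every locally finite collection of open sets in $X$ is finite. For a cardinal $\mu$, $X$ is $\mu$-resolvable if it contains $\mu$ pairwise disjoint dense subsets. $c(X)$ is the cellularity of $X$, i.e. the supremum of the cardinalities of families of pairwise disjoint non-empty open subsets of $X$ (taken to be at least $\omega$). $\mathfrak{c}=2^{\omega}$, and for an ordinal $\varrho$, $\mathfrak{c}^{+\varrho}$ denotes the $\varrho$th cardinal successor of $\mathfrak{c}$, i.e. if $\mathfrak{c}=\aleph_\xi$ then $\mathfrak{c}^{+\varrho}=\aleph_{\xi+\varrho}$. *)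

(* Defs.v *)
From mathcomp Require Import all_boot all_order.
From mathcomp Require Import boolp classical_sets functions cardinality wochoice.
From mathcomp Require Import topology.

Set Implicit Arguments.
Unset Strict Implicit.
Unset Printing Implicit Defensive.

Local Open Scope classical_set_scope.
Local Open Scope card_scope.

(** * Cardinals *)

(* A cardinal is represented by any type of that cardinality, all taken in one
   fixed universe; cardinals are compared through [card_le] and [card_eq], never
   through Leibniz equality. *)
Definition cardinal := Type.

Definition card_leq (A B : cardinal) : Prop := [set: A] #<= [set: B].

Definition card_equal (A B : cardinal) : Prop := [set: A] #= [set: B].

Definition card_lt (A B : cardinal) : Prop := card_leq A B /\ ~ card_equal A B.

Definition least_cardinal (P : cardinal -> Prop) (K : cardinal) : Prop :=
  P K /\ forall L : cardinal, P L -> card_leq K L.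

Definition is_card_succ (A K : cardinal) : Prop :=
  least_cardinal (fun L => card_lt A L) K.

Definition is_card_sup (I : Type) (D : set I) (F : I -> cardinal)
    (K : cardinal) : Prop :=
  least_cardinal (fun L => forall i, D i -> card_leq (F i) L) K.

Definition continuum : cardinal := nat -> bool.

Definition continuum_hypothesis : Prop := is_card_succ nat continuum.

(** * Ordinals and alephs *)

(* An ordinal is represented by a well-order [R : rel W] of that order type; as
   with [well_order], [R] is the non-strict order. *)
Definition strictly_below (W : Type) (R : rel W) (v w : W) : Prop :=
  R v w /\ ~~ R w v.

Definition is_first (W : Type) (R : rel W) (w : W) : Prop :=
  forall v, ~ strictly_below R v w.

Definition is_next (W : Type) (R : rel W) (v w : W) : Prop :=
  strictly_below R v w /\ forall u, strictly_below R u w -> R u v.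

Definition is_limit (W : Type) (R : rel W) (w : W) : Prop :=
  ~ is_first R w /\ forall v, ~ is_next R v w.

Definition ordinal_sum (V W : Type) (R : rel V) (S : rel W) : rel (V + W) :=
  fun x y => match x, y with
  | inl v, inl v' => R v v'
  | inl _, inr _ => true
  | inr _, inl _ => false
  | inr w, inr w' => S w w'
  end.

Definition ordinal_succ (W : Type) (R : rel W) : rel (W + unit) :=
  ordinal_sum R (fun _ _ => true).

(* [F w] is aleph_alpha, where alpha is the order type of the set of the
   elements strictly below [w]. *)
Definition aleph_sequence (W : Type) (R : rel W) (F : W -> cardinal) : Prop :=
  [/\ forall w, is_first R w -> card_equal (F w) nat,
      forall v w, is_next R v w -> is_card_succ (F v) (F w) &
      forall w, is_limit R w ->
        is_card_sup [set v | strictly_below R v w] F (F w)].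

(* [K] is aleph_alpha, where alpha is the order type of [R]: the elements below
   the top element [inr tt] of [ordinal_succ R] are those of [W]. *)
Definition is_aleph (W : Type) (R : rel W) (K : cardinal) : Prop :=
  well_order R /\
  exists F : W + unit -> cardinal,
    aleph_sequence (ordinal_succ R) F /\ card_equal (F (inr tt)) K.

(* [K] is the rho-th cardinal successor of the continuum, where rho is the order
   type of [R]: if the continuum is aleph_xi, with xi the order type of [S], then
   [K] is aleph_(xi + rho). *)
Definition is_continuum_succ (W : Type) (R : rel W) (K : cardinal) : Prop :=
  exists (V : Type) (S : rel V),
    is_aleph S continuum /\ is_aleph (ordinal_sum S R) K.

Definition is_omega1 (W : Type) (R : rel W) : Prop :=
  [/\ well_order R,
      ~ countable [set: W] &
      forall w, countable [set v | strictly_below R v w]].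

(** * Topology *)

Definition crowded (X : topologicalType) : Prop :=
  forall x : X, ~ isolated [set: X] x.

Definition pi_regular (X : topologicalType) : Prop :=
  hausdorff_space X /\
  forall U : set X, open U -> U !=set0 ->
    exists V : set X, [/\ open V, V !=set0 & closure V `<=` U].

Definition locally_finite (X : topologicalType) (U : set (set X)) : Prop :=
  forall x : X, exists2 N : set X, nbhs x N &
    finite_set [set A | U A /\ A `&` N !=set0].

Definition feebly_compact (X : topologicalType) : Prop :=
  forall U : set (set X), (forall A, U A -> open A) ->
    locally_finite U -> finite_set U.

Definition resolvable (mu : cardinal) (X : topologicalType) : Prop :=
  exists D : mu -> set X, (forall i, dense (D i)) /\ trivIset [set: mu] D.

Definition cellular_family (X : topologicalType) (U : set (set X)) : Prop :=
  (forall A, U A -> open A /\ A !=set0) /\ trivIset U id.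

Definition is_cellularity (X : topologicalType) (C : cardinal) : Prop :=
  least_cardinal (fun L => card_leq nat L /\
    forall U : set (set X), cellular_family U -> U #<= [set: L]) C.

(* c(X) is smaller than the rho-th cardinal successor of the continuum, where
   rho is the order type of [R]. *)
Definition cellularity_lt_continuum_succ (X : topologicalType)
    (W : Type) (R : rel W) : Prop :=
  exists C K : cardinal,
    [/\ is_cellularity X C, is_continuum_succ R K & card_lt C K].

(* Main.v *)
Require Import Defs.
From Stdlib Require List.
From mathcomp Require Import all_boot all_order.
From mathcomp Require Import boolp classical_sets functions cardinality wochoice.
From mathcomp Require Import topology.

Set Implicit Arguments.
Unset Strict Implicit.
Unset Printing Implicit Defensive.

Local Open Scope classical_set_scope.
Local Open Scope card_scope.

(** Call an open set colourable if it has a map to the continuum such that every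
    fibre meets every nonempty open subset. Colourings of the members of a maximal
    disjoint family of colourable sets glue, so a space that is not
    continuum-resolvable has a region [W] without nonempty open colourable subsets.
    The nonempty open subsets of [W] are used as forcing conditions. Given
    decreasing conditions [V n] and pieces [O n] inside [V n] off [V n.+1],
    feeble compactness yields a point [p] of all [V n] whose neighbourhoods meet
    infinitely many [O n]; if the [O n] disagree with the branch, then [p] decides
    no more than the branch does. Colouring the points by what they decide, through
    a Bernstein set of branches or through disjoint stationary sets, contradicts the
    choice of [W] unless certain names are decided. In this way names of reals are
    decided, and countable or omega_1-indexed families of names of ordinals below a
    regular cardinal above the continuum are bounded.

    Only countably many cardinalities lie between the continuum and the
    cellularity, so that each of these cardinals is regular or of countable
    cofinality. Scales modulo ideals, as in pcf theory, bound the names of elements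
    of a product of countably many such regular cardinals, and walks on ordinals
    guided by such bounds decide all names of countable sequences of ordinals below
    the cellularity.

    On the other hand, the names asking whether the generic filter contains a given
    open set are nowhere all decided. The cofinality of a shortest undecided family
    of them is uncountable by the previous step, and in the remaining cases ordinal
    codes of its initial segments give a colouring of an open subset of [W]. *)

(** * Well-orders and cardinalities *)

(** A colouring is fixed before the open set on which it is tested, so a colour may depend only on
    what a point decides, while the points are produced inside a given open set; [bad_col] turns
    each such colouring into a contradiction. Above the continuum, the ordinal recovered from a
    point has to be prescribed: conditions are indexed by finite lists of ordinals, the branch
    follows a ladder of a closure point of that tree, and disjoint stationary sets of such points
    supply continuum many colours. Countable cofinality is forced by the [omega] many steps of a
    branch. Countable families of names of ordinals can be bounded early, but deciding them is the
    goal. For families of length omega_1 an unbounded subfamily can be decided, and which one is not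
    known in advance. Hence the guides of the walks are built along omega_1, each coping with all
    finite lists of earlier ones, so that any increasing [omega]-sequence of decided guides is
    enough. *)

Record wo (T : Type) (r : T -> T -> Prop) : Prop := Wo {
  wo_irr : forall x, ~ r x x;
  wo_tr : forall x y z, r x y -> r y z -> r x z;
  wo_min : forall P : T -> Prop, (exists x, P x) ->
    exists x, P x /\ forall y, P y -> y = x \/ r x y }.

Section WellOrder.
Variables (T : Type) (r : T -> T -> Prop) (wor : wo r).

Lemma wo_tri x y : [\/ r x y, x = y | r y x].
Proof.
have [|z [Pz zmin]] := @wo_min _ _ wor (fun z => z = x \/ z = y).
  by exists x; left.
case: Pz => ez; subst z.
  by case: (zmin y (or_intror erefl)) => [->|]; [apply: Or32|apply: Or31].
by case: (zmin x (or_introl erefl)) => [->|]; [apply: Or32|apply: Or33].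
Qed.

Lemma wo_nlt x y : ~ r x y -> x = y \/ r y x.
Proof. by case: (wo_tri x y) => // [->|]; [left|right]. Qed.

Lemma wo_asym x y : r x y -> ~ r y x.
Proof. by move=> xy yx; apply: (wo_irr wor (wo_tr wor xy yx)). Qed.

Lemma wo_le_lt x y z : x = y \/ r x y -> r y z -> r x z.
Proof. by case=> [->//|xy yz]; apply: wo_tr xy yz. Qed.

Lemma wo_ind (P : T -> Prop) :
  (forall x, (forall y, r y x -> P y) -> P x) -> forall x, P x.
Proof.
move=> H x; apply: contrapT => nPx.
have [|z [nPz zmin]] := @wo_min _ _ wor (fun z => ~ P z); first by exists x.
apply: nPz; apply: H => y yz; apply: contrapT => nPy.
case: (zmin _ nPy) => [ey|zy]; first by subst y; apply: (wo_irr wor yz).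
exact: (wo_asym yz zy).
Qed.

Lemma wo_wf : well_founded r.
Proof. by move=> x; apply: wo_ind x => x IH; constructor. Qed.

(** The step is a relation that sees a total function [g], of which only the values below [t] may
    matter. This spares dependent types at each use: [ext] fills the other values with [a0]. *)
Lemma wo_rec (A : Type) (a0 : A) (P : T -> (T -> A) -> A -> Prop) :
  (forall t g, exists x, P t g x) ->
  (forall t g g' x, (forall s, r s t -> g s = g' s) -> P t g x -> P t g' x) ->
  exists f : T -> A, forall t, P t f (f t).
Proof.
move=> Pex Pext.
pose pick t g := projT1 (cid (Pex t g)).
have pickP t g : P t g (pick t g) by rewrite /pick; case: cid.
pose ext t (rec : forall s, r s t -> A) s :=
  match pselect (r s t) with left h => rec s h | right _ => a0 end.
pose F t (rec : forall s, r s t -> A) := pick t (@ext t rec).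
pose f := Fix wo_wf (fun=> A) F.
have fE t : f t = F t (fun s _ => f s).
  rewrite /f Fix_eq // => x g g' gg'; congr (F x _).
  by apply: functional_extensionality_dep => y; apply: functional_extensionality_dep.
exists f => t; rewrite fE; apply: Pext (pickP t _) => s st.
by rewrite /ext; case: pselect.
Qed.

End WellOrder.

(** * Comparison of cardinalities by injections *)

Definition seg (T : Type) (r : T -> T -> Prop) (t : T) := {x : T | r x t}.

Definition le_card (A B : Type) := exists f : A -> B, injective f.

Lemma le_card_refl A : le_card A A. Proof. by exists id. Qed.

Lemma le_card_trans A B D : le_card A B -> le_card B D -> le_card A D.
Proof. by move=> [f fI] [g gI]; exists (g \o f); apply: inj_comp. Qed.

Lemma seg_le T (r : T -> T -> Prop) t : le_card (seg r t) T.
Proof.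
by exists (fun x => sval x) => x y; apply: eq_sig_hprop => z; apply: Prop_irrelevance.
Qed.

Lemma sig_inj (T : Type) (P : T -> Prop) (x y : {z | P z}) :
  sval x = sval y -> x = y.
Proof. by apply: eq_sig_hprop => z; apply: Prop_irrelevance. Qed.

Lemma le_card_sub T (P Q : T -> Prop) : (forall x, P x -> Q x) ->
  le_card {x | P x} {x | Q x}.
Proof.
move=> PQ; exists (fun x => exist Q (sval x) (PQ _ (proj2_sig x))).
by move=> x y [] /sig_inj.
Qed.

Lemma le_card_option A B : le_card A B -> le_card (option A) (option B).
Proof.
by move=> [f fI]; exists (omap f) => -[x|] [y|] //= [] /fI ->.
Qed.

Lemma le_card_upto T (r : T -> T -> Prop) t :
  le_card {x | x = t \/ r x t} (option (seg r t)).
Proof.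
exists (fun x => if pselect (r (sval x) t) is left h then Some (exist (fun z => r z t) _ h) else None).
move=> [x hx] [y hy] /=; case: pselect => [a|a]; case: pselect => [b|b] //.
  by move=> [] e; apply: sig_inj.
by move=> _; apply: sig_inj => /=; case: hx => [->|//]; case: hy => [->|//].
Qed.

(** The source of regularity: if a small family were unbounded, its segments would cover the order
    and make it too small. *)
Lemma le_card_cofinal T (r : T -> T -> Prop) S M (f : S -> T) :
  (forall x, exists s, x = f s \/ r x (f s)) -> (forall t, le_card (seg r t) M) ->
  le_card T (S * option M).
Proof.
move=> cov rM; have [s sP] := choice cov.
have [g gI] : exists g : forall t, {x | x = t \/ r x t} -> option M, forall t, injective (g t).
  have H t := le_card_trans (le_card_upto r t) (le_card_option (rM t)).
  by exists (fun t => projT1 (cid (H t))) => t; case: cid.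
exists (fun x => (s x, g _ (exist _ x (sP x)))) => x y [] e.
move: (sP x) (sP y); rewrite e => hx hy; by move=> /gI [].
Qed.

Lemma le_card_surj A B (f : A -> B) : (forall b, exists a, f a = b) -> le_card B A.
Proof. by move=> /choice [g gK]; exists g => x y gxy; rewrite -(gK x) gxy gK. Qed.

Lemma surj_le_card A B (b0 : B) : le_card B A -> exists f : A -> B, forall b, exists a, f a = b.
Proof.
move=> [g gI].
exists (fun a => if pselect (exists b, g b = a) is left h then projT1 (cid h) else b0) => b.
exists (g b); case: pselect => [h|[]]; last by exists b.
by case: cid => b' /= /gI.
Qed.

Lemma le_cardP A B : le_card A B <-> [set: A] #<= [set: B].
Proof.
split=> [[f fI]|].
  suff [g] : $|{injfun [set: A] >-> [set: B]}| by exact: inj_card_le.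
  by apply/injfunPex; exists f => // x y _ _; apply: fI.
move=> /card_leP [f].
have inT (T : Type) (x : T) : x \in [set: T] by rewrite inE.
exists (fun x => val (f (SigSub (inT A x)))) => x y /val_inj.
by move/(inj (in_setT _) (in_setT _)) => /(congr1 val).
Qed.

Lemma wo_of_well_order (T : Type) (R : rel T) : well_order R ->
  wo (strictly_below R) /\ forall x y, R x y <-> x = y \/ strictly_below R x y.
Proof.
move=> woR.
pose pr (P : T -> Prop) : {pred T} := [pred x | `[< P x >]].
have prE P x : (x \in pr P) = `[< P x >] by [].
have mn P : (exists x, P x) -> exists x, P x /\ forall y, P y -> R x y.
  move=> [x Px]; have [|z [[zP zl] _]] := woR (pr P); first by exists x; apply/asboolP.
  by exists z; split=> [|y Py]; [exact/asboolP|apply: zl; exact/asboolP].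
have rf x : R x x by have [|y [-> yl]] := mn (eq x); [exists x|apply: yl].
have an x y : R x y -> R y x -> x = y.
  move=> xy yx; have [|z [_ zu]] := woR (pr (fun z => z = x \/ z = y)).
    by exists x; apply/asboolP; left.
  have m w : w = x \/ w = y -> minimum_of R (pr (fun z => z = x \/ z = y)) w.
    move=> wxy; split; first exact/asboolP.
    by move=> v /asboolP [] ->; case: wxy => ->.
  by rewrite -(zu x (m x _)) ?(zu y (m y _)) //; [right|left].
have tt x y : R x y \/ R y x.
  have [|z [[] -> zl]] := mn (fun z => z = x \/ z = y); first by exists x; left.
    by left; apply: zl; right.
  by right; apply: zl; left.
have tr x y z : R x y -> R y z -> R x z.
  move=> xy yz; have [|w [ew wl]] := mn (fun w => [\/ w = x, w = y | w = z]).
    by exists x; apply: Or31.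
  case: ew => ew; subst w; first by apply: wl; apply: Or33.
    by rewrite (an x y xy) //; apply: wl; apply: Or31.
  by rewrite -(an y z yz) //; apply: wl; apply: Or32.
split; last first.
  move=> x y; split=> [xy|[<-|[]//]]; last exact: rf.
  have [yx|/negP yx] := pselect (R y x); [left; exact: an|by right; split].
split.
- by move=> x [->].
- move=> x y z [xy nyx] [yz nzy]; split; first exact: tr xy yz.
  by apply/negP => zx; move/negP: nyx; apply; apply: tr yz zx.
move=> P /mn [x [Px xl]]; exists x; split=> // y Py.
have [xy|xy] := pselect (y = x); first by left.
right; split; first exact: xl.
by apply/negP => yx; apply: xy; apply: an => //; apply: xl.
Qed.

Lemma wo_exists T : exists r : T -> T -> Prop, wo r.
Proof.
have [R woR] := well_ordering_principle {classic T}.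
by exists (strictly_below R); exact: (wo_of_well_order woR).1.
Qed.

Lemma wo_pull A T (r : T -> T -> Prop) (f : A -> T) : wo r -> injective f ->
  wo (fun x y => r (f x) (f y)).
Proof.
move=> wor fI; split=> [x|x y z|P [x Px]]; first exact: wo_irr.
  exact: wo_tr.
have [|t [[y [Py <-]] tmin]] := @wo_min _ _ wor (fun t => exists y, P y /\ f y = t).
  by exists (f x), x.
by exists y; split=> // z Pz; case: (tmin (f z)) => [|/fI|]; [exists z|left|right].
Qed.

Lemma wo_lex A B (r : A -> A -> Prop) (s : B -> B -> Prop) : wo r -> wo s ->
  wo (fun p q : A * B => r p.1 q.1 \/ p.1 = q.1 /\ s p.2 q.2).
Proof.
move=> wor wos; split.
- by move=> [a b] /= [/(wo_irr wor)|[_ /(wo_irr wos)]].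
- move=> [a b] [a' b'] [a'' b''] /= [ab|[-> ab]] [bc|[<- bc]]; try by left.
    by left; apply: wo_tr ab bc.
  by right; split=> //; apply: wo_tr ab bc.
move=> P [[a b] Pab].
have [|x [[b' Pxb'] xmin]] := @wo_min _ _ wor (fun x => exists b, P (x, b)).
  by exists a, b.
have [|y [Pxy ymin]] := @wo_min _ _ wos (fun y => P (x, y)); first by exists b'.
exists (x, y); split=> // -[c d] Pcd /=.
case: (xmin c) => [|e|]; [by exists d| |by right; left].
by subst c; case: (ymin d Pcd) => [->|]; [left|right; right].
Qed.

(** The order type is an initial ordinal, that is, a cardinal. *)
Definition init (T : Type) (r : T -> T -> Prop) := forall t, ~ le_card T (seg r t).

Lemma init_exists T : exists r : T -> T -> Prop, wo r /\ init r.
Proof.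
have [r wor] := wo_exists T.
have [ini|/existsNP [t0 /contrapT Tt0]] := pselect (init r); first by exists r.
have [|t [[f fI] tmin]] := @wo_min _ _ wor (fun t => le_card T (seg r t)).
  by exists t0.
have gI : injective (fun x => sval (f x)) by move=> x y /sig_inj /fI.
exists (fun x y => r (sval (f x)) (sval (f y))); split.
  exact: (wo_pull wor gI).
move=> x Tx.
have : le_card T (seg r (sval (f x))).
  apply: le_card_trans Tx _.
  exists (fun y : seg (fun x y => r (sval (f x)) (sval (f y))) x =>
    exist (fun z => r z (sval (f x))) (sval (f (sval y))) (proj2_sig y)).
  by move=> y z [] /sig_inj /fI /sig_inj.
have := proj2_sig (f x); move: (sval (f x)) => y yt /tmin [e|ty].
  by subst y; apply: (wo_irr wor yt).
exact: (wo_asym wor yt ty).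
Qed.

(** Values in [A] are chosen by recursion, each new as long as a new one exists. Either the choice
    never gets stuck and is injective, or the values before some [t] exhaust [A]. *)
Lemma card_dich T (r : T -> T -> Prop) A : wo r ->
  le_card T A \/ exists t, le_card A (seg r t).
Proof.
move=> wor; have [[a0]|nA] := pselect (inhabited A); last first.
  have [[t]|nT] := pselect (inhabited T); last first.
    by left; exists (fun t => False_rect _ (nT (inhabits t))) => t; case: nT.
  by right; exists t, (fun a => False_rect _ (nA (inhabits a))) => a; case: nA.
have [||f fP] := @wo_rec _ _ wor A a0 (fun t g x =>
  (exists x', forall s, r s t -> g s <> x') -> forall s, r s t -> g s <> x).
- move=> t g; have [[x' x'P]|nx] := pselect (exists x', forall s, r s t -> g s <> x').
    by exists x'.
  by exists a0.
- move=> t g g' x gg' H [x' x'P] s st; rewrite -gg' //; apply: H => //.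
  by exists x' => u ut; rewrite gg' //; apply: x'P.
have [H|/existsNP [t nt]] := pselect (forall t, exists x, forall s, r s t -> f s <> x).
  left; exists f => x y fxy; case: (wo_tri wor x y) => // h.
    by case: (fP y (H y) x h).
  by case: (fP x (H x) y h).
right; exists t; apply: (@le_card_surj _ _ (fun s : seg r t => f (sval s))) => a.
apply: contrapT => na; apply: nt; exists a => s st fs; apply: na.
by exists (exist _ s st).
Qed.

Lemma le_card_total A B : le_card A B \/ le_card B A.
Proof.
have [r wor] := wo_exists A.
case: (card_dich B wor) => [|[t Bt]]; [by left|right].
exact: le_card_trans Bt (seg_le _ _).
Qed.

Lemma le_card_pair A A' B B' : le_card A A' -> le_card B B' -> le_card (A * B) (A' * B').
Proof.
move=> [f fI] [g gI]; exists (fun p => (f p.1, g p.2)).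
by move=> [a b] [a' b'] /= [] /fI -> /gI ->.
Qed.

Lemma nat_le_cardN B : ~ le_card nat B -> finite_set [set: B].
Proof. by move=> nB; apply: contrapT => h; apply: nB; apply/le_cardP/infiniteP. Qed.

Lemma option_sq_finite B : ~ le_card nat B -> ~ le_card nat (option B * option B).
Proof.
move=> nB h; have fB := nat_le_cardN nB; have : infinite_set [set: option B * option B].
  by apply/infiniteP/le_cardP.
apply.
have fO : finite_set [set: option B].
  apply: (@sub_finite_set _ _ ((some @` [set: B]) `|` [set None])).
    by move=> [b|] _; [left; exists b|right].
  by rewrite finite_setU; split; [apply: finite_image|apply: finite_set1].
by rewrite -setXTT; apply: finite_setX.
Qed.

Lemma option_le B : le_card nat B -> le_card (option B) B.
Proof.
move=> [f fI].
exists (fun o => match o with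
  | None => f 0
  | Some b => if pselect (exists n, f n = b) is left h then f (projT1 (cid h)).+1 else b
  end) => -[x|] [y|] //=.
- case: pselect => [hx|nx]; case: pselect => [hy|ny].
  + case: cid => n /= <-; case: cid => m /= <- /fI [->] //.
  + by move=> e; case: ny; rewrite -e; exists (projT1 (cid hx)).+1.
  + by move=> e; case: nx; rewrite e; exists (projT1 (cid hy)).+1.
  + by move=> ->.
- case: pselect => [hx /fI //|nx e]; case: nx; by exists 0.
- case: pselect => [hx /fI //|nx e]; case: nx; by exists 0.
Qed.

(** Hessenberg's argument. Pairs are ordered by their maximum [M], then lexicographically; a proper
    segment of pairs lies in the square of a shorter closed segment, which is small by induction.
    The first case disposes of those [t] that are not initial. *)
Lemma seg_sq T (r : T -> T -> Prop) : wo r -> forall t, le_card nat (seg r t) ->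
  le_card (seg r t * seg r t) (seg r t).
Proof.
move=> wor; apply: (wo_ind wor) => t IH tinf.
have [[s [st ts]]|nts] := pselect (exists s, r s t /\ le_card (seg r t) (seg r s)).
  apply: le_card_trans (le_card_pair ts ts) _.
  apply: le_card_trans (IH s st (le_card_trans tinf ts)) _.
  by apply: le_card_sub => x xs; apply: wo_tr xs st.
pose A := seg r t.
have woA : wo (fun x y : A => r (sval x) (sval y)).
  by apply: (wo_pull wor) => x y /sig_inj.
pose M (p : A * A) := if pselect (r (sval p.1) (sval p.2)) then p.2 else p.1.
have MI : injective (fun p => (M p, p)) by move=> p q [].
case: (card_dich A (wo_pull (wo_lex woA (wo_lex woA woA)) MI)) => // -[p Ap].
exfalso; pose m := M p.
have mt : r (sval m) t := proj2_sig m.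
have Am : le_card A (option (seg r (sval m)) * option (seg r (sval m))).
  apply: le_card_trans Ap _.
  have Mle q : (sval q.1 = sval (M q) \/ r (sval q.1) (sval (M q)))
     /\ (sval q.2 = sval (M q) \/ r (sval q.2) (sval (M q))).
    rewrite /M; case: pselect => [h|nh]; first by split; [right|left].
    have h := wo_nlt wor nh.
    by split; [left|case: h => [->|]; [left|right]].
  pose h (x : A) : option (seg r (sval m)) :=
    match pselect (r (sval x) (sval m)) with left H => Some (exist _ _ H) | _ => None end.
  have hI x y : sval x = sval m \/ r (sval x) (sval m) ->
                sval y = sval m \/ r (sval y) (sval m) ->
                h x = h y -> x = y.
    move=> lx ly; rewrite /h; case: pselect => [hx|nx]; case: pselect => [hy|ny] //.
      by move=> [] /sig_inj.
    move=> _; apply: sig_inj.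
    by case: lx => [->|//]; case: ly => [->|//].
  have le_m q : r (sval (M q)) (sval m) \/ M q = m ->
     (sval q.1 = sval m \/ r (sval q.1) (sval m))
     /\ (sval q.2 = sval m \/ r (sval q.2) (sval m)).
    move=> [Mm|<-]; last exact: Mle.
    have [l1 l2] := Mle q.
    by split; right; [apply: wo_le_lt l1 Mm|apply: wo_le_lt l2 Mm].
  exists (fun q => (h (sval q).1, h (sval q).2)).
  move=> [q qp] [q' q'p] /= [] e1 e2; apply: sig_inj => /=.
  have l x : (r (sval (M x)) (sval (M p)) \/ M x = M p /\
    (r (sval x.1) (sval p.1) \/
    x.1 = p.1 /\ r (sval x.2) (sval p.2))) ->
    r (sval (M x)) (sval m) \/ M x = m by move=> [|[]]; [left|right].
  have [a1 a2] := le_m _ (l _ qp); have [b1 b2] := le_m _ (l _ q'p).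
  by case: q q' {qp q'p} e1 e2 a1 a2 b1 b2 => q1 q2 [q1' q2'] /= e1 e2 *; congr pair; apply: hI.
have [minf|mfin] := pselect (le_card nat (seg r (sval m))); last first.
  by apply: (option_sq_finite mfin); apply: le_card_trans tinf Am.
apply: nts; exists (sval m); split=> //; apply: le_card_trans Am _.
apply: le_card_trans (le_card_pair (option_le minf) (option_le minf)) _.
exact: IH.
Qed.

(** A point on top turns the whole type into a proper segment, so that results about [seg r t] also
    cover it. *)
Definition with_top A (r : A -> A -> Prop) (x y : option A) := match x, y with
  | Some a, Some b => r a b | Some _, None => True | None, _ => False end.

Lemma wo_top A (r : A -> A -> Prop) : wo r -> wo (with_top r).
Proof.
move=> wor; split; first by move=> [a|] //=; apply: wo_irr.
  by move=> [a|] [b|] [c|] //=; apply: wo_tr.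
move=> P [x Px]; have [[a Pa]|na] := pselect (exists a, P (Some a)).
  have [|b [Pb bmin]] := @wo_min _ _ wor (fun a => P (Some a)); first by exists a.
  exists (Some b); split=> // -[c|] Pc; last by right.
  by case: (bmin c Pc) => [->|]; [left|right].
exists None; split; first by case: x Px => // a Pa; case: na; exists a.
by move=> [a|] Pa; [case: na; exists a|left].
Qed.

Lemma le_card_sq A : le_card nat A -> le_card (A * A) A.
Proof.
move=> Ainf; have [r wor] := wo_exists A.
have AS : le_card A (seg (with_top r) None).
  by exists (fun a => exist (fun x => with_top r x None) (Some a) I) => a b [].
have SA : le_card (seg (with_top r) None) A.
  have H (x : seg (with_top r) None) : exists a, sval x = Some a.
    by case: x => -[a|] //= _; exists a.
  exists (fun x => projT1 (cid (H x))) => x y; case: cid => a /= ea; case: cid => b /= eb e.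
  by apply: sig_inj; rewrite ea eb e.
apply: le_card_trans (le_card_pair AS AS) _; apply: le_card_trans SA.
by apply: seg_sq (wo_top wor) _ _; apply: le_card_trans Ainf AS.
Qed.

Lemma le_card_prod A B D : le_card nat D -> le_card A D -> le_card B D -> le_card (A * B) D.
Proof.
by move=> Dinf AD BD; apply: le_card_trans (le_card_pair AD BD) (le_card_sq Dinf).
Qed.

Lemma le_card_list A D : le_card nat D -> le_card A D -> le_card (list A) D.
Proof.
move=> Dinf [i iI]; have [pr prI] := le_card_sq Dinf; have [nd ndI] := Dinf.
pose code := fix code (l : list A) := match l with
  | [::] => nd 0 | x :: l' => pr (i x, code l') end.
exists (fun l => pr (nd (size l), code l)) => l l' /prI [] /ndI.
elim: l l' => [|x l IH] [|y l'] //= [] sz /prI [] /iI -> e; congr (_ :: _).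
exact: IH.
Qed.

(** * Strong well-orders and stationary sets *)

Notation cont := (nat -> bool).

Lemma le_nat_cont : le_card nat cont.
Proof.
exists (fun n m => m == n) => n m /(congr1 (fun f => f n)).
by rewrite eqxx => /esym /eqP.
Qed.

Lemma le_cont_fun I Q : le_card I nat -> le_card Q cont -> le_card (I -> Q) cont.
Proof.
move=> [i iI] [q qI].
exists (fun f n => `[< exists a m, n = pickle (i a, m) /\ q (f a) m >]).
move=> f g fg; apply: funext => a; apply: qI; apply: funext => m.
have e := asbool_eq_equiv (congr1 (fun h => h (pickle (i a, m))) fg).
have key h : (exists a' m', pickle (i a, m) = pickle (i a', m') /\ q (h a') m') <-> q (h a) m.
  split=> [[a' [m' [/(pcan_inj pickleK) [/iI <- <-]]]] //|H].
  by exists a, m.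
have e1 : _ -> _ := iffLR e; have e2 : _ -> _ := iffRL e; apply/idP/idP => H.
  by apply/(key g)/e1/(key f).
by apply/(key f)/e2/(key g).
Qed.

Lemma le_list_nat A : le_card A nat -> le_card (list A) nat.
Proof. exact: le_card_list (le_card_refl _). Qed.

Lemma le_bool_nat : le_card bool nat.
Proof. by exists nat_of_bool => -[] []. Qed.

Lemma le_unit_nat : le_card unit nat.
Proof. by exists (fun=> 0) => -[] []. Qed.

Lemma cont_sq : le_card (cont * cont) cont.
Proof. exact: le_card_sq le_nat_cont. Qed.

Lemma cantor_cont A : le_card cont A -> ~ le_card A nat.
Proof.
move=> CA An; have [f fI] := le_card_trans CA An.
pose D n := `[< forall g, f g = n -> g n = false >].
have [d|nd] := boolP (D (f D)); last first.
  move: (nd) => /asboolP; apply => g /fI ->; exact: negbTE.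
by move: (d) => /asboolP /(_ D erefl); rewrite d.
Qed.

(** Pairs of an index and a colour are enumerated along an initial order of size continuum. Fewer
    than continuum many points are taken before a stage, so the injective [F th] still offers a
    fresh point for the prescribed colour. *)
Lemma bernstein (Th Y : Type) (F : Th -> cont -> Y) :
  le_card Th cont -> (forall th, injective (F th)) ->
  exists col : Y -> cont, forall th k, exists x, col (F th x) = k.
Proof.
move=> Thc FI.
have [[th0]|nTh] := pselect (inhabited Th); last first.
  by exists (fun _ _ => true) => th; case: nTh.
have [r [wor ini]] := init_exists cont.
have [e eS] : exists e : cont -> Th * cont, forall b, exists a, e a = b.
  apply: surj_le_card; first exact: (th0, fun=> true).
  exact: le_card_trans (le_card_pair Thc (le_card_refl _)) cont_sq.
have [||x xP] := @wo_rec _ _ wor cont (fun=> true)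
    (fun t g x => forall s, r s t -> F (e s).1 (g s) <> F (e t).1 x).
- move=> t g; apply: contrapT => /forallNP H; apply: (ini t).
  have {}H x : exists s : seg r t, F (e (sval s)).1 (g (sval s)) = F (e t).1 x.
    have /existsNP [s /not_implyP [st /contrapT]] := H x.
    by exists (exist _ s st).
  have [h hP] := choice H.
  by exists h => a b ab; apply: (FI (e t).1); rewrite -!hP ab.
- by move=> t g g' x gg' H s st; rewrite -gg' //; apply: H.
have xI s t : F (e s).1 (x s) = F (e t).1 (x t) -> s = t.
  by case: (wo_tri wor s t) => // h; [move/xP|move=> /esym/xP]; case/(_ h).
exists (fun y => if pselect (exists t, y = F (e t).1 (x t)) is left h
          then (e (projT1 (cid h))).2 else (fun=> true)) => th k.
have [t et] := eS (th, k); exists (x t).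
case: pselect => [h|[]]; last by exists t; rewrite et.
by case: cid => t' /=; rewrite -[th]/((th, k).1) -et => /xI <-; rewrite et.
Qed.

Definition bounding (T : Type) (r : T -> T -> Prop) (S : Type) :=
  forall f : S -> T, exists b, forall s, r (f s) b.

(* Plays the role of a regular cardinal above the continuum. *)
Record strong (T : Type) (r : T -> T -> Prop) : Prop := Strong {
  strong_wo :> wo r;
  strong_inh : inhabited T;
  strong_list : forall t, bounding r (list (seg r t) * cont) }.
Arguments strong_list [T r] _ t _.

Lemma bounding_le T (r : T -> T -> Prop) S S' : inhabited T ->
  le_card S S' -> bounding r S' -> bounding r S.
Proof.
move=> [t0] [i iI] bS' f.
have [b bP] := bS' (fun s' => if pselect (exists s, i s = s') is left h
   then f (projT1 (cid h)) else t0).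
exists b => s; have := bP (i s); case: pselect => [h|[]]; last by exists s.
by case: cid => s' /= /iI ->.
Qed.

Fixpoint below (T : Type) (r : T -> T -> Prop) (d : T) (l : list T) :=
  if l is x :: l' then r x d /\ below r d l' else True.

Lemma below_trans (T : Type) (r : T -> T -> Prop) d d' l : wo r ->
  r d d' \/ d = d' -> below r d l -> below r d' l.
Proof.
move=> wor dd'; elim: l => //= x l IH [xd /IH]; split=> //.
by case: dd' => [h|<- //]; apply: (wo_tr wor xd h).
Qed.

(** Closure points of finitary operations replace club sets: the conditions built below are indexed
    by finite lists of ordinals, and each construction yields an operation of this form. *)
Definition closed_at (T : Type) (r : T -> T -> Prop) (Phi : list T -> T) d :=
  forall l, below r d l -> r (Phi l) d.

Section Club.
Variables (T : Type) (r : T -> T -> Prop) (wor : wo r).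

Definition ladder (d : T) (eta : nat -> T) :=
  (forall n, r (eta n) d) /\ (forall x, r x d -> exists n, r x (eta n)).

Definition stat (S : T -> Prop) := forall Phi : list T -> T,
  exists d, [/\ S d, closed_at r Phi d & exists eta, ladder d eta].

Hypotheses (bn : bounding r nat) (bl : forall t, bounding r (list (seg r t))).

Lemma bounding_below t (f : list T -> T) : exists b, forall l, below r t l -> r (f l) b.
Proof.
have [b bP] := @bl t (fun l => f (map (fun x => sval x) l)).
exists b => l lt; suff [l' <-] : exists l' : list (seg r t), map (fun x => sval x) l' = l by [].
elim: l lt => [|x l IH] /=; first by exists [::].
by move=> [xt /IH [l' <-]]; exists (exist _ x xt :: l').
Qed.

(** [d] is the supremum of an [omega]-iteration of [nx], which outgrows [Phi] on all lists below its
    argument. *)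
Lemma club (Phi : list T -> T) (t : T) :
  exists d, [/\ r t d, closed_at r Phi d & exists eta, ladder d eta].
Proof.
have step x : exists y, r x y /\ forall l, below r x l -> r (Phi l) y.
  have [b bP] := bounding_below x Phi; have [c cP] := bn (fun n => if n is 0 then x else b).
  by exists c; split=> [|l /bP lb]; [exact: (cP 0)|exact: (wo_tr wor lb (cP 1))].
have [nx nxP] := choice step.
pose eta n := iter n nx t.
have etaS n : r (eta n) (eta n.+1) by exact: (nxP _).1.
have eta_le n m : n <= m -> r (eta n) (eta m) \/ eta n = eta m.
  move=> /subnK <-; elim: (m - n) => [|k [IH|IH]]; first by right.
    by left; rewrite addSn; apply: (wo_tr wor IH (etaS _)).
  by left; rewrite addSn IH; apply: etaS.
have [|d [dub dmin]] := @wo_min _ _ wor (fun d => forall n, r (eta n) d).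
  by have [b bP] := bn eta; exists b.
have lad : ladder d eta.
  split=> // x xd; apply: contrapT => /forallNP H.
  have xub n : r (eta n) x.
    by case: (wo_nlt wor (H n.+1)) => [->//|h]; apply: (wo_tr wor (etaS n) h).
  by case: (dmin x xub) => [e|h]; [subst x; exact: (wo_irr wor xd)|exact: (wo_asym wor xd h)].
exists d; split; [exact: (dub 0)| |by exists eta].
move=> l ld; suff [n ln] : exists n, below r (eta n) l.
  by apply: (wo_tr wor _ (dub n.+1)); apply: (nxP (eta n)).2.
elim: l ld => [|x l IH] /=; first by exists 0.
move=> [/(proj2 lad) [n xn] /IH [m lm]]; exists (maxn n m); split.
  by case: (eta_le n (maxn n m)) => [|h|<-] //; [apply: leq_maxl|apply: (wo_tr wor xn h)].
by apply: (below_trans wor _ lm); apply: eta_le; apply: leq_maxr.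
Qed.

End Club.

Section Strong.
Variables (T : Type) (r : T -> T -> Prop) (str : strong r).
Let wor := strong_wo str.
Let inh := strong_inh str.

Lemma strong_cont S : le_card S cont -> bounding r S.
Proof.
have [t0] := inh => Sc; refine (bounding_le inh _ (strong_list str t0)).
case: Sc => i iI; exists (fun s => ([::], i s)) => x y [] /iI //.
Qed.

Lemma strong_nat S : le_card S nat -> bounding r S.
Proof. by move=> Sn; apply: strong_cont (le_card_trans Sn le_nat_cont). Qed.

Lemma strong_gt t : exists t', r t t'.
Proof. by have [b /(_ tt) tb] := strong_nat le_unit_nat (fun=> t); exists b. Qed.

Lemma strong_gt2 s t : exists b, r s b /\ r t b.
Proof.
have [b bP] := strong_nat le_bool_nat (fun x : bool => if x then s else t).
by exists b; split; [apply: (bP true)|apply: (bP false)].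
Qed.

Lemma strong_club (Phi : list T -> T) (t : T) :
  exists d, [/\ r t d, closed_at r Phi d & exists eta, ladder r d eta].
Proof.
apply: (club wor) => [|{}t]; first exact: strong_nat (le_card_refl _).
apply: bounding_le inh _ (strong_list str t).
by exists (fun l => (l, fun=> true)) => x y [].
Qed.

Lemma unbounded_cont (G : T -> Prop) : (forall b, exists t, G t /\ ~ r t b) ->
  exists g : cont -> T, injective g /\ forall k, G (g k).
Proof.
move=> Gu; case: (le_card_total cont {t | G t}) => [[g gI]|Gc].
  exists (fun k => sval (g k)); split; last by move=> k; apply: proj2_sig.
  by move=> x y /sig_inj /gI.
have [b bP] := strong_cont Gc (fun x => sval x).
by have [t [Gt nt]] := Gu b; case: nt; apply: (bP (exist _ t Gt)).
Qed.

(* Solovay's splitting, for points of countable cofinality. *)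
Lemma solovay : exists S : cont -> T -> Prop,
  (forall k, stat r (S k)) /\ (forall k k' t, S k t -> S k' t -> k = k').
Proof.
have [lad ladP] : exists lad : T -> nat -> T, forall d, (exists eta, ladder r d eta) -> ladder r d (lad d).
  suff /choice [lad H] : forall d, exists eta, (exists eta, ladder r d eta) -> ladder r d eta.
    by exists lad.
  move=> d; have [[eta ?]|nl] := pselect (exists eta, ladder r d eta); first by exists eta.
  by exists (fun=> d).
(* Some rung [n] is unbounded on stationary sets: otherwise the bounds for all [n] have a common
   bound [b], and the ladder of a suitable closure point above [b] would stay below [b]. *)
have [n nP] : exists n, forall b, stat r (fun d => ~ r (lad d n) b).
  apply: contrapT => /forallNP H.
  have {}H n : exists bP : T * (list T -> T), forall d, (exists eta, ladder r d eta) ->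
      closed_at r bP.2 d -> r (lad d n) bP.1.
    have /existsNP [b /existsNP [Phi nd]] := H n; exists (b, Phi) => d ld cd /=.
    by apply: contrapT => nr; apply: nd; exists d.
  have [bP bPP] := choice H.
  have [b bub] := strong_nat (le_card_refl _) (fun n => (bP n).1).
  have [m mP] : exists m : list T -> T, forall l n, r ((bP n).2 l) (m l).
    suff H' : forall l, exists y, forall n, r ((bP n).2 l) y by have [m mP] := choice H'; exists m.
    by move=> l; exact: strong_nat (le_card_refl _) (fun n => (bP n).2 l).
  have [d [bd cd ld]] := strong_club m b.
  have [_ /(_ b bd) [k bk]] := ladP d ld.
  apply: (wo_irr wor (x := b)); apply: (wo_tr wor bk).
  apply: (wo_tr wor _ (bub k)); apply: bPP => // l /cd h.
  exact: (wo_tr wor (mP l k) h).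
(* Pressing down: the fibre [St g] is stationary for unboundedly many [g]. Otherwise the operations
   [Ph g] refuting this are merged into one, with the head of the list as [g], and a closure point
   is closed under the operation for its own rung. *)
pose St g d := lad d n = g.
have [|g [gI gS]] := @unbounded_cont (fun g => stat r (St g)).
  move=> b; apply: contrapT => /forallNP H.
  have {}H g : exists Phi, ~ r g b -> forall d, (exists eta, ladder r d eta) -> closed_at r Phi d -> ~ St g d.
    have [rgb|nrgb] := pselect (r g b); first by exists (fun=> b).
    have ns : ~ stat r (St g) by move=> s; apply: (H g).
    have /existsNP [Phi nd] := ns; exists Phi => _ d ld cd Sd.
    by apply: nd; exists d.
  have [Ph PhP] := choice H.
  have [d [nrd cd ld]] := nP b (fun l => if l is x :: l' then Ph x l' else b).
  apply: (PhP (lad d n) nrd d ld _ erefl) => l ld'.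
  by apply: (cd (_ :: _)); split=> //; apply: (ladP d ld).1.
by exists (fun k => St (g k)); split=> // k k' t; rewrite /St => e e'; apply: gI; rewrite -e -e'.
Qed.

End Strong.

(** The common form of the colourings by stationary sets: [Lim p d] recovers an ordinal from a
    point, and the colour is the index of the set that contains it. *)
Lemma limit_color Y T (S : cont -> T -> Prop) (Lim : Y -> T -> Prop) :
  (forall k k' t, S k t -> S k' t -> k = k') ->
  (forall p d d', Lim p d -> Lim p d' -> d = d') ->
  exists col : Y -> cont, forall p d k, Lim p d -> S k d -> col p = k.
Proof.
move=> Sdis Lim_fun.
exists (fun p => if pselect (exists k, exists d, Lim p d /\ S k d) is left h
  then projT1 (cid h) else fun=> true) => p d k Ld Sd.
case: pselect => [h|[]]; last by exists k, d.
case: cid => k' /= [d' [Ld' Sd']]; rewrite (Lim_fun _ _ _ Ld Ld') in Sd.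
exact: Sdis Sd' Sd.
Qed.

Lemma strong_intro T (r : T -> T -> Prop) : wo r -> init r ->
  (forall t, bounding r (seg r t)) -> ~ le_card T cont -> strong r.
Proof.
move=> wor ini reg nT.
have inh : inhabited T.
  by apply: contrapT => nh; apply: nT; exists (fun t => False_rect _ (nh (inhabits t))) => t; case: nh.
split=> // t.
case: (card_dich (list (seg r t) * cont) wor) => [Tl|[s ls]]; last exact: bounding_le inh ls (reg s).
exfalso; case: (le_card_total (seg r t) cont) => h.
  apply: nT; apply: le_card_trans Tl _; apply: le_card_prod le_nat_cont _ (le_card_refl _).
  exact: le_card_list le_nat_cont h.
have inf := le_card_trans le_nat_cont h.
apply: (ini t); apply: le_card_trans Tl _; apply: (le_card_prod inf _ h).
exact: le_card_list inf (le_card_refl _).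
Qed.

(** * Bad regions and names *)

Definition colorable (X : topologicalType) (U : set X) :=
  exists col : X -> cont, forall V, open V -> V !=set0 -> V `<=` U ->
    forall k, exists p, V p /\ col p = k.

Record bad_region (X : topologicalType) (W : set X) : Prop := BadRegion {
  br_crowded : crowded X;
  br_feebly : feebly_compact X;
  br_regular : pi_regular X;
  br_open : open W;
  br_nonempty : W !=set0;
  br_bad : forall U, open U -> U !=set0 -> U `<=` W -> ~ colorable U }.

Section Region.
Variables (X : topologicalType) (W : set X).

(* The forcing conditions. *)
Definition po (V : set X) := [/\ open V, V !=set0 & V `<=` W].

Lemma po_sub V V' : po V -> open V' -> V' !=set0 -> V' `<=` V -> po V'.
Proof. by move=> [_ _ VW] oV' nV' V'V; split=> // x /V'V /VW. Qed.

Lemma po_meet V G : po V -> open G -> (V `&` G) !=set0 -> po (V `&` G).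
Proof.
move=> pV oG VG; have oV : open V by case: pV.
by apply: (po_sub pV (openI oV oG) VG) => x [].
Qed.

(* Names for elements of [A]: [frc N V a] reads that [V] forces [N] to be [a]. *)
Record name (A : Type) := Name {
  frc :> set X -> A -> Prop;
  frc_her : forall V V' a, po V' -> V' `<=` V -> frc V a -> frc V' a;
  frc_dense : forall V, po V -> exists V' a, [/\ po V', V' `<=` V & frc V' a];
  frc_fun : forall V a b, po V -> frc V a -> frc V b -> a = b;
  frc_reg : forall V a, po V ->
    (forall V' b, po V' -> V' `<=` V -> frc V' b -> b = a) -> frc V a }.

(** It is enough that [dec] is dense and consistent: letting [V] force [a] when no smaller condition
    decides otherwise completes it to a name. *)
Lemma mk_name (A : Type) (dec : set X -> A -> Prop) :
  (forall V, po V -> exists V' a, [/\ po V', V' `<=` V & dec V' a]) ->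
  (forall V V' a b, po V -> po V' -> dec V a -> dec V' b -> (V `&` V') !=set0 -> a = b) ->
  { N : name A | forall V a, po V -> dec V a -> N V a }.
Proof.
move=> dd df; pose fr V a := forall V' b, po V' -> V' `<=` V -> dec V' b -> b = a.
have decfr V a : po V -> dec V a -> fr V a.
  move=> pV Va V' b pV' V'V V'b; apply: (df _ _ _ _ pV' pV V'b Va).
  by case: pV' => _ [x V'x] _; exists x; split=> //; apply: V'V.
have her V V' a : po V' -> V' `<=` V -> fr V a -> fr V' a.
  by move=> pV' V'V fVa V'' b pV'' V''V'; apply: fVa => // x /V''V' /V'V.
have dense V : po V -> exists V' a, [/\ po V', V' `<=` V & fr V' a].
  by move=> /dd [V' [a [pV' V'V /decfr-/(_ pV')]]]; exists V', a.
have func V a b : po V -> fr V a -> fr V b -> a = b.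
  by move=> /dd [V' [c [pV' V'V cV']]] fa fb; rewrite -(fa V' c) // -(fb V' c).
have reg V a : po V -> (forall V' b, po V' -> V' `<=` V -> fr V' b -> b = a) -> fr V a.
  by move=> pV H V' b pV' V'V /(decfr _ _ pV'); apply: H.
by exists (Name her dense func reg).
Qed.

(** The purpose of [frc_reg]: failure to decide produces two smaller conditions with different
    values, the splitting on which the trees of conditions rest. *)
Lemma name_split A (N : name A) V : po V -> (exists a, N V a) \/
  exists V1 V2 a1 a2, [/\ po V1, V1 `<=` V & N V1 a1] /\ [/\ po V2, V2 `<=` V, N V2 a2 & a1 <> a2].
Proof.
move=> pV; have [V1 [a1 [pV1 V1V N1]]] := frc_dense N pV.
have [NV|nNV] := pselect (N V a1); [by left; exists a1|right].
have : ~ (forall V' b, po V' -> V' `<=` V -> N V' b -> b = a1) by move=> /(frc_reg pV).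
move=> /existsNP [V2 /existsNP [a2 /not_implyP [pV2 /not_implyP [V2V /not_implyP [N2 ne]]]]].
by exists V1, V2, a1, a2; split=> //; split=> // e; apply: ne.
Qed.

Lemma frc_meet A (N : name A) V V' a b : po V -> po V' -> N V a -> N V' b ->
  (V `&` V') !=set0 -> a = b.
Proof.
move=> pV pV' Na Nb m; have pm := po_meet pV (let: And3 h _ _ := pV' in h) m.
apply: (frc_fun pm); [apply: (frc_her pm _ Na)|apply: (frc_her pm _ Nb)].
  exact: subIsetl.
exact: subIsetr.
Qed.

Lemma name_map A B (f : A -> B) (N : name A) :
  { M : name B | forall V a, po V -> N V a -> M V (f a) }.
Proof.
have [||M MP] := @mk_name B (fun V b => exists a, N V a /\ f a = b).
- move=> V pV; have [V' [a [pV' V'V NV']]] := frc_dense N pV.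
  by exists V', (f a); split=> //; exists a.
- by move=> V V' a b pV pV' [c [Nc <-]] [d [Nd <-]] m; rewrite (frc_meet pV pV' Nc Nd m).
by exists M => V a pV NV; apply: MP => //; exists a.
Qed.

Definition at_pt A (N : name A) (p : X) (a : A) := exists G, [/\ po G, G p & N G a].

Lemma at_fun A (N : name A) p a b : at_pt N p a -> at_pt N p b -> a = b.
Proof. by move=> [G [pG Gp Na]] [H [pH Hp Nb]]; apply: (frc_meet pG pH Na Nb); exists p. Qed.

Hypothesis br : bad_region W.

Lemma poW : po W. Proof. by split=> //; case: br. Qed.

Lemma bad_col U (col : X -> cont) : po U ->
  (forall V, po V -> V `<=` U -> forall k, exists p, V p /\ col p = k) -> False.
Proof.
move=> pU H; case: (pU) => oU nU UW; apply: (br_bad br oU nU UW).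
by exists col => V oV nV VU; apply: H => //; apply: po_sub pU oV nV VU.
Qed.

Lemma po_shrink V : po V -> exists V', po V' /\ closure V' `<=` V.
Proof.
move=> pV; have [oV nV VW] := pV; have [V' [oV' nV' cV']] := (br_regular br).2 V oV nV.
by exists V'; split=> //; split=> // x V'x; apply: VW; apply: cV'; apply: subset_closure.
Qed.

Lemma po_split V : po V -> exists V1 V2, [/\ po V1, po V2, closure V1 `<=` V,
  closure V2 `<=` V & V1 `&` V2 = set0].
Proof.
move=> pV; have [oV [x Vx] VW] := pV.
have [y [Vy xy]] : exists y, V y /\ y <> x.
  apply: contrapT => /forallNP H; apply: (br_crowded br (x := x)).
  split; [by rewrite inE|exists V; first by apply: open_nbhs_nbhs].
  rewrite setIT; apply/seteqP; split=> [y Vy|y ->] //.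
  by apply: contrapT => yx; apply: (H y).
have [[A B] /= [/set_mem Ax /set_mem By] [oA oB /eqP AB]] :
    exists2 AB : set X * set X, (x \in AB.1 /\ y \in AB.2) & [/\ open AB.1, open AB.2 & AB.1 `&` AB.2 == set0].
  have := (br_regular br).1; rewrite open_hausdorff; apply.
  by apply/eqP => e; apply: xy.
have [|V1 [p1 s1]] := @po_shrink (V `&` A); first by apply: po_meet pV oA _; exists x.
have [|V2 [p2 s2]] := @po_shrink (V `&` B); first by apply: po_meet pV oB _; exists y.
exists V1, V2; split=> // [z /s1 []|z /s2 []|] //.
rewrite -subset0 -AB => z [/subset_closure/s1 [_ Az] /subset_closure/s2 [_ Bz]] //.
Qed.

(* The only use of feeble compactness. *)
Lemma realize (V O : nat -> set X) :
  (forall n, po (V n)) -> (forall n, closure (V n.+1) `<=` V n) ->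
  (forall n, po (O n)) -> (forall n, O n `<=` V n) ->
  (forall n x, O n x -> V n.+1 x -> False) ->
  exists p, (forall n, V n p) /\
    forall G, open G -> G p -> forall n, exists m, n <= m /\ (G `&` O m) !=set0.
Proof.
move=> pV cV pO OV OnV.
have Vle n m : n <= m -> V m `<=` V n.
  move=> /subnK <-; elim: (m - n) => [|k IH] //.
  by rewrite addSn => x /subset_closure /cV /IH.
have Odisj n m x : n < m -> O n x -> O m x -> False.
  by move=> nm On /OV /(Vle _ _ nm) /(OnV _ _ On).
(* Feeble compactness counts the members of a collection, so the pieces must be distinct sets for
   [range O] to be infinite. *)
have OI : injective O.
  move=> n m e; have [_ [x Ox] _] := pO n; have Ox' := Ox; rewrite e in Ox'.
  by case: (ltngtP n m) => // h; [case: (Odisj n m x)|case: (Odisj m n x)].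
have nlf : ~ locally_finite (range O).
  move=> /(br_feebly br) H.
  have {}H : finite_set (range O) by apply: H => A [n _ <-]; case: (pO n).
  have e : (range O #= [set: nat])%card by apply: inj_card_eq => x y _ _; apply: OI.
  by apply: infinite_nat; rewrite -(eq_finite_set e).
have /existsNP [p np] := nlf.
have acc G : open G -> G p -> forall n, exists m, n <= m /\ (G `&` O m) !=set0.
  move=> oG Gp n; apply: contrapT => /forallNP H; apply: np; exists G; first by apply: open_nbhs_nbhs.
  apply: (@sub_finite_set _ _ (O @` `I_n)); last exact: finite_image (finite_II n).
  move=> A /= [[m _ <-] [x [Om Gx]]]; exists m => //=; rewrite ltnNge; apply/negP => nm.
  by apply: (H m); split=> //; exists x.
(* Every neighbourhood of [p] meets some [O m] with [m > n], hence [V n.+1]; so [p] lies in the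
   closure of [V n.+1]. *)
exists p; split=> // n; apply: (cV n) => B; rewrite nbhsE => -[G [oG Gp] GB].
have [m [nm [x [Gx Omx]]]] := acc G oG Gp n.+1.
by exists x; split; [apply: (Vle _ _ nm); apply: OV|apply: GB].
Qed.
End Region.

(** * Branches of trees of names *)

Section Branch.
Variables (X : topologicalType) (W : set X) (br : bad_region W).
Variables (K : Type) (rk : K -> K -> Prop) (wok : wo rk).
Variables (A : Type) (N : K -> name W A) (res : K -> K -> A -> A).

Definition leK j i := j = i \/ rk j i.

Hypothesis coh : forall i j V a, po W V -> leK j i -> N i V a -> N j V (res i j a).
Hypothesis und : forall V, po W V -> exists i, ~ exists a, N i V a.

Lemma leK_refl i : leK i i. Proof. by left. Qed.

Lemma leK_trans i j k : leK i j -> leK j k -> leK i k.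
Proof.
move=> [->//|ij] [<-|jk]; first by right.
by right; apply: (wo_tr wok ij jk).
Qed.

Lemma leK_total i j : leK i j \/ rk j i.
Proof. by case: (wo_tri wok i j) => h; [left; right|left; left|right]. Qed.

(** Undecidedness moves up: deciding a later index would decide [i] by coherence. So the split can
    be found past any [i0]. *)
Lemma und_split V i0 : po W V -> exists i V1 V2 a1 a2, [/\ leK i0 i, a1 <> a2,
  po W V1 /\ po W V2, V1 `<=` V /\ V2 `<=` V & N i V1 a1 /\ N i V2 a2].
Proof.
move=> pV; have [i nNi] := und pV.
have [k [i0k ik]] : exists k, leK i0 k /\ leK i k.
  case: (leK_total i0 i) => h; [exists i|exists i0]; split=> //; try exact: leK_refl.
  by right.
case: (name_split (N k) pV) => [[a Na]|[V1 [V2 [a1 [a2 [[p1 s1 n1] [p2 s2 n2 ne]]]]]]].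
  by case: nNi; exists (res k i a); apply: coh Na.
by exists k, V1, V2, a1, a2.
Qed.

(* Off-branch pieces that disagree with the branch keep the limit point from
   deciding more than the branch does. *)
Lemma branch_at (V O : nat -> set X) (i j : nat -> K) (a b : nat -> A) (p : X) :
  (forall n, po W (V n)) -> (forall n, po W (O n)) ->
  (forall n, N (i n) (V n.+1) (a n)) ->
  (forall n, [/\ leK (j n) (i n), N (j n) (O n) (b n) & b n <> res (i n) (j n) (a n)]) ->
  (forall n, V n p) ->
  (forall G, open G -> G p -> forall n, exists m, n <= m /\ (G `&` O m) !=set0) ->
  forall k c, at_pt (N k) p c <-> exists n, leK k (i n) /\ c = res (i n) k (a n).
Proof.
move=> pV pO NV NO Vp acc k c; split=> [[G [pG Gp NG]]|[n [ki ->]]]; last first.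
  by exists (V n.+1); split=> //; apply: coh.
(* If no [i n] reaches [k], all lie below it; then [G] decides index [j m] by coherence, yet it
   meets both [O m] and [V m.+1], which disagree there. *)
apply: contrapT => /forallNP H.
have ik n : rk (i n) k.
  case: (leK_total k (i n)) => // h; case: (H n); split=> //.
  apply: (frc_meet pG (pV n.+1) NG); first exact: coh (NV n).
  by exists p.
have [m [_ [x [Gx Ox]]]] := acc G (let: And3 h _ _ := pG in h) Gp 0.
have [ji NOm ne] := NO m; apply: ne.
have jk : leK (j m) k by apply: leK_trans ji _; right.
have NGj : N (j m) G (res k (j m) c) by apply: coh.
rewrite -(frc_meet pG (pO m) NGj NOm); last by exists x.
apply: (frc_meet pG (pV m.+1) NGj); first exact: coh (NV m).
by exists p.
Qed.

Definition path (r : cont) n : list bool := map r (rev (iota 0 n)).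

Lemma pathS r n : path r n.+1 = r n :: path r n.
Proof. by rewrite /path -addn1 iotaD rev_cat. Qed.

Lemma path_ext r r' n : (forall m, m < n -> r m = r' m) -> path r n = path r' n.
Proof.
by move=> H; apply/eq_in_map => m; rewrite mem_rev mem_iota => /andP[_]; apply: H.
Qed.

(* If cofinally many nodes of the tree of decisions may be taken from a set of
   size at most the continuum, a Bernstein colouring of its branches applies. *)
Lemma bernstein_branch (Q : K * A -> Prop) :
  le_card {q | Q q} cont ->
  (forall V i0, po W V -> exists V' i a, [/\ po W V', V' `<=` V, leK i0 i, Q (i, a) & N i V' a]) ->
  False.
Proof.
move=> Qc Qd.
pose QT := {q | Q q}.
(* [H q] is everything decided along the nodes [q]. A map [th] labels the binary tree with nodes,
   and [F0 th] sends a real to what its branch decides. Only continuum many [th] exist, so one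
   colouring serves all of them. *)
pose H (q : nat -> QT) (k : K) (c : A) := exists n,
  leK k (sval (q n)).1 /\ c = res (sval (q n)).1 k (sval (q n)).2.
pose F0 (th : list bool -> QT) (r : cont) := H (fun n => th (path r n.+1)).
pose Th := {th | injective (F0 th)}.
have Thc : le_card Th cont.
  apply: (@le_card_trans _ (list bool -> QT)).
    by exists (fun x => sval x) => x y /sig_inj.
  by apply: le_cont_fun => //; apply: le_list_nat; apply: le_bool_nat.
have [colB colBP] := @bernstein Th _ (fun th => F0 (sval th)) Thc (fun th => proj2_sig th).
apply: (@bad_col _ _ br W (fun p => colB (fun k c => at_pt (N k) p c))); first exact: poW.
move=> V0 pV0 _ k.
have step V : exists (c : bool -> set X * QT) (jb : K * (bool -> A)), po W V ->
   forall b, [/\ po W (c b).1, closure (c b).1 `<=` V, leK jb.1 (sval (c b).2).1,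
      N (sval (c b).2).1 (c b).1 (sval (c b).2).2 /\ N jb.1 (c b).1 (jb.2 b) &
      jb.2 b <> jb.2 (~~ b)].
  have [pV|nV] := pselect (po W V); last first.
    have [V' [i [a [_ _ _ Qia _]]]] := Qd W (projT1 (cid (und (poW br)))) (poW br).
    by exists (fun=> (V, exist _ _ Qia)), (i, fun=> a).
  have [i [V1 [V2 [a1 [a2 [_ ne [p1 p2] [s1 s2] [n1 n2]]]]]]] := und_split (projT1 (cid (und (poW br)))) pV.
  have sub V' a' : po W V' -> V' `<=` V -> N i V' a' -> exists c : set X * QT,
     [/\ po W c.1, closure c.1 `<=` V, leK i (sval c.2).1,
      N (sval c.2).1 c.1 (sval c.2).2 & N i c.1 a'].
    move=> pV' sV' NV'; have [V3 [p3 c3]] := po_shrink br pV'.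
    have [V4 [i4 [a4 [p4 s4 i4i Q4 n4]]]] := Qd V3 i p3.
    exists (V4, exist _ _ Q4); split=> //=.
      by apply: subset_trans (closureS s4) _; apply: subset_trans c3 sV'.
    by apply: frc_her NV' => // x /s4 /subset_closure /c3.
  have [c1 [p1' s1' l1 n1' m1]] := sub _ _ p1 s1 n1.
  have [c2 [p2' s2' l2 n2' m2]] := sub _ _ p2 s2 n2.
  exists (fun b => if b then c1 else c2), (i, fun b => if b then a1 else a2) => _ [] //=.
  by split=> // e; apply: ne.
have [cc ccP] := choice step; have {ccP} [jb stepP] := choice ccP.
pose Vs := fix Vs (s : list bool) : set X := if s is b :: s' then (cc (Vs s') b).1 else V0.
(* The value at the empty list is a dummy: [F0] reads [th] only on nonempty paths. *)
pose th (s : list bool) : QT := if s is b :: s' then (cc (Vs s') b).2 else (cc V0 true).2.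
have pVs s : po W (Vs s).
  by elim: s => //= b s pVs; have [] := stepP _ pVs b.
have real r : exists p, V0 p /\ (forall k c, at_pt (N k) p c <-> F0 th r k c)
     /\ forall n, Vs (path r n) p.
  pose V n := Vs (path r n).
  (* The piece left at stage [n] is the sibling of the branch, which disagrees with it at the index
     [jb]. *)
  pose O n := (cc (V n) (~~ r n)).1.
  have VS n : V n.+1 = (cc (V n) (r n)).1 by rewrite /V pathS.
  have pV n : po W (V n) by apply: pVs.
  have pO n : po W (O n) by have [] := stepP _ (pV n) (~~ r n).
  pose i n := (sval (th (path r n.+1))).1.
  pose a n := (sval (th (path r n.+1))).2.
  have thE n : th (path r n.+1) = (cc (V n) (r n)).2 by rewrite pathS.
  have NV n : N (i n) (V n.+1) (a n).
    by rewrite /i /a VS thE; have [_ _ _ []] := stepP _ (pV n) (r n).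
  have NO n : [/\ leK (jb (V n)).1 (i n), N (jb (V n)).1 (O n) ((jb (V n)).2 (~~ r n)) &
        (jb (V n)).2 (~~ r n) <> res (i n) (jb (V n)).1 (a n)].
    have [_ _ l [_ nj] ne] := stepP _ (pV n) (r n).
    have [_ _ _ [_ nO] _] := stepP _ (pV n) (~~ r n).
    have ji : leK (jb (V n)).1 (i n) by rewrite /i thE.
    split=> // e; apply: ne; rewrite e.
    by apply: (frc_fun (pV n.+1) (n := N (jb (V n)).1)); [rewrite VS|apply: coh].
  have [|||p [Vp acc]] := realize br pV _ pO.
  - by move=> n; rewrite VS; have [] := stepP _ (pV n) (r n).
  - by move=> n x /subset_closure; have [_ cl _ _ _] := stepP _ (pV n) (~~ r n); apply: cl.
  - move=> n x Ox Vx; have [_ _ ne] := NO n.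
    have [_ _ _ [_ nj] ne'] := stepP _ (pV n) (r n).
    have [_ nO _] := NO n.
    apply: ne'; apply: (frc_meet (pV n.+1) (pO n) (N := N (jb (V n)).1)) => //; first by rewrite VS.
    by exists x.
  exists p; split; [exact: (Vp 0)|split=> // k' c].
  exact: (branch_at pV pO NV NO Vp acc).
have thI : injective (F0 th).
  move=> r r' e; apply: contrapT => ne.
  have [n nP] : exists n, r n != r' n.
    by apply: contrapT => /forallNP Hn; apply: ne; apply: funext => n; have /negP := Hn n; rewrite negbK => /eqP.
  pose m := ex_minn (ex_intro (fun n => r n != r' n) n nP).
  have [rm mmin] : r m != r' m /\ forall k, k < m -> r k = r' k.
    rewrite /m; case: ex_minnP => m' rm' Hm; split=> // k' km.
    by apply/eqP; apply: contraLR km => /Hm; rewrite -leqNgt.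
  have pm := path_ext mmin.
  have [p [_ [pP Vp]]] := real r; have [p' [_ [pP' Vp']]] := real r'.
  pose Vm := Vs (path r m).
  have at1 : at_pt (N (jb Vm).1) p ((jb Vm).2 (r m)).
    exists (Vs (path r m.+1)); split=> //.
    by rewrite pathS /=; have [_ _ _ []] := stepP _ (pVs (path r m)) (r m).
  have at2 : at_pt (N (jb Vm).1) p' ((jb Vm).2 (r' m)).
    exists (Vs (path r' m.+1)); split=> //.
    by rewrite pathS /= -pm; have [_ _ _ []] := stepP _ (pVs (path r m)) (r' m).
  have [_ _ _ _ ne'] := stepP _ (pVs (path r m)) (r m).
  apply: ne'; rewrite -/Vm; apply: (at_fun at1).
  have -> : ~~ r m = r' m by move: rm; case: (r m); case: (r' m).
  by apply/pP; rewrite e; apply/pP'.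
have [r rk'] := colBP (exist _ th thI) k.
have [p [Vp [pP _]]] := real r; exists p; split=> //; rewrite -rk' /=; congr colB.
by apply: funext => k'; apply: funext => c; apply/propext; apply: pP.
Qed.

(* Colouring by the limit inferior of ordinals read off the branch. *)
Lemma liminf_branch (T : Type) (r : T -> T -> Prop) (e : K -> A -> T) : strong r ->
  (forall V x, po W V -> exists V' j, [/\ po W V', V' `<=` V &
     forall i V'' a, leK j i -> po W V'' -> V'' `<=` V' -> N i V'' a -> ~ r (e i a) x]) ->
  False.
Proof.
move=> str He; have wor := strong_wo str.
have [S [Sst Sdis]] := solovay str.
(* [d] is the lower limit of [e] over the indices decided at [p]: eventually not below any [x]
   smaller than [d], and cofinally below [d]. *)
pose Lim (p : X) d := (forall x, r x d -> exists j, (exists a, at_pt (N j) p a) /\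
      forall i a, leK j i -> at_pt (N i) p a -> ~ r (e i a) x) /\
   (forall j, (exists a, at_pt (N j) p a) -> exists i a, [/\ leK j i, at_pt (N i) p a & r (e i a) d]).
have Lim_lt p d d' : Lim p d -> Lim p d' -> ~ r d d'.
  move=> [_ l] [l' _] dd'; have [j [ja jP]] := l' d dd'.
  by have [i [a [ji ia]]] := l j ja; apply: jP.
have Lim_fun p d d' : Lim p d -> Lim p d' -> d = d'.
  by move=> l l'; case: (wo_tri wor d d') => // h; [case: (Lim_lt _ _ _ l l')|case: (Lim_lt _ _ _ l' l)].
have [col colP] := limit_color Sdis Lim_fun.
apply: (@bad_col _ _ br W col); first exact: poW.
move=> V0 pV0 _ k.
have step (q : set X * T) : exists z : (set X * set X) * (K * K) * (A * A), po W q.1 ->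
   let: (V', Q, (i, j), (a, b)) := z in
   [/\ [/\ po W V', closure V' `<=` q.1, po W Q & Q `<=` q.1], N i V' a, N i Q b /\ b <> a, leK j i &
    forall i V'' a, leK j i -> po W V'' -> V'' `<=` V' -> N i V'' a -> ~ r (e i a) q.2].
  case: q => V x /=; have [pV|nV] := pselect (po W V); last first.
    pose i0 := projT1 (cid (und (poW br))).
    have [V' [a _]] := frc_dense (N i0) (poW br).
    by exists (V, V, (i0, i0), (a, a)).
  have [V1 [j [p1 s1 jP]]] := He V x pV.
  have [i [V2 [V3 [a2 [a3 [ji ne [p2 p3] [s2 s3] [n2 n3]]]]]]] := und_split j p1.
  have [V4 [p4 s4]] := po_shrink br p2.
  exists (V4, V3, (i, j), (a2, a3)); split=> //.
  - split=> //; first by move=> y /s4 /s2 /s1.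
    by move=> y /s3 /s1.
  - by apply: frc_her n2 => // y /subset_closure /s4.
  - by split=> // h; apply: ne.
  - by move=> i' V'' a ji' p'' s''; apply: jP => // y /s'' /subset_closure /s4 /s2.
have [st stP] := choice step.
pose Vs := fix Vs (l : list T) : set X := if l is x :: l' then (st (Vs l', x)).1.1.1 else V0.
have pVs l : po W (Vs l).
  elim: l => //= x l IH; have := stP (Vs l, x) IH.
  by case: (st _) => [[[V' O] [i j]] [a b]] [[]].
have [t0] := strong_inh str.
pose dat (l : list T) x := st (Vs l, x).
(* Closure under [Phi] keeps the values met on the branch below [d], while [He] pushes them past
   each rung. *)
pose Phi (l : list T) := if l is x :: l' then e (dat l' x).1.2.1 (dat l' x).2.1 else t0.
have [d [Sd cd [eta [eta1 eta2]]]] := Sst k Phi.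
pose L := fix L n := if n is m.+1 then eta m :: L m else [::].
have belL n : below r d (L n) by elim: n => //= n IH; split.
pose V n := Vs (L n).
pose O n := (dat (L n) (eta n)).1.1.2.
pose i n := (dat (L n) (eta n)).1.2.1.
pose j n := (dat (L n) (eta n)).1.2.2.
pose a n := (dat (L n) (eta n)).2.1.
pose b n := (dat (L n) (eta n)).2.2.
have dP n : [/\ [/\ po W (V n.+1), closure (V n.+1) `<=` V n, po W (O n) & O n `<=` V n],
   N (i n) (V n.+1) (a n), N (i n) (O n) (b n) /\ b n <> a n, leK (j n) (i n) &
    forall i V'' a, leK (j n) i -> po W V'' -> V'' `<=` V n.+1 -> N i V'' a -> ~ r (e i a) (eta n)].
  have := stP (Vs (L n), eta n) (pVs _); rewrite /V /O /i /j /a /b /dat /=.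
  by case: (st _) => [[[V' O'] [i' j']] [a' b']].
have pV n : po W (V n) by apply: pVs.
have pO n : po W (O n) by case: (dP n) => -[].
have NV n : N (i n) (V n.+1) (a n) by case: (dP n).
have resa n : res (i n) (i n) (a n) = a n.
  by apply: (frc_fun (pV n.+1) _ (NV n)); apply: coh (NV n) => //; apply: leK_refl.
have NO n : [/\ leK (i n) (i n), N (i n) (O n) (b n) & b n <> res (i n) (i n) (a n)].
  by case: (dP n) => _ _ [NO ne] _ _; split=> //; [apply: leK_refl|rewrite resa].
have [|||p [Vp acc]] := realize br pV _ pO.
- by move=> n; case: (dP n) => -[].
- by move=> n; case: (dP n) => -[].
- move=> n x Ox Vx; case: (dP n) => _ Na [Nb ne] _ _; apply: ne.
  by apply: (frc_meet (pO n) (pV n.+1) Nb Na); exists x.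
have pP := branch_at pV pO NV NO Vp acc.
exists p; split; first exact: (Vp 0).
apply: (colP p d k) => //; split.
- move=> x /eta2 [n xn]; exists (j n); split.
    exists (res (i n) (j n) (a n)); apply/pP; exists n; split=> //.
    by case: (dP n).
  move=> i' c ji' [G [pG Gp NG]] ex.
  have m : (G `&` V n.+1) !=set0 by exists p.
  have pm := po_meet pG (let: And3 h _ _ := pV n.+1 in h) m.
  have NG' : N i' (G `&` V n.+1) c by apply: (frc_her pm _ NG) => y [].
  have sV : G `&` V n.+1 `<=` V n.+1 by move=> y [].
  case: (dP n) => _ _ _ _ h; apply: (h i' _ c ji' pm sV NG').
  exact: (wo_tr wor ex xn).
- move=> j' [c /pP [n [jn _]]]; exists (i n), (a n); split=> //.
    by apply/pP; exists n; split; [apply: leK_refl|rewrite resa].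
  exact: (cd (eta n :: L n) (conj (eta1 n) (belL n))).
Qed.

End Branch.

(** * Deciding and bounding countable families *)

Section Localize.
Variables (X : topologicalType) (W : set X).

Lemma po_le W' V : po W W' -> po W' V -> po W V.
Proof. by move=> [_ _ WW'] [oV nV VW]; split=> // x /VW /WW'. Qed.

Lemma po_in W' V : po W V -> V `<=` W' -> po W' V.
Proof. by move=> [oV nV _] VW; split. Qed.

Lemma bad_sub W' : bad_region W -> po W W' -> bad_region W'.
Proof.
move=> [cr fe re oW nW bad] [oW' nW' WW']; split=> // U oU nU UW'.
by apply: bad => // x /UW' /WW'.
Qed.

(** Smaller conditions are again bad regions, so density of [P] can be proved by refuting a region
    in which [P] fails everywhere. *)
Lemma localize (P : set X -> Prop) : bad_region W ->
  (forall W', bad_region W' -> po W W' -> (forall V, po W' V -> ~ P V) -> False) ->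
  forall V, po W V -> exists V', [/\ po W V', V' `<=` V & P V'].
Proof.
move=> br H V pV; apply: contrapT => /forallNP nV.
apply: (H V (bad_sub br pV) pV) => V' pV' PV'; apply: (nV V'); split=> //.
  exact: po_le pV pV'.
by case: pV'.
Qed.

Lemma restr W' A (N : name W A) : po W W' ->
  { M : name W' A | forall V a, M V a <-> N V a }.
Proof.
move=> pW'.
have her V V' a : po W' V' -> V' `<=` V -> N V a -> N V' a.
  by move=> pV'; apply: frc_her; apply: po_le pV'.
have dense V : po W' V -> exists V' a, [/\ po W' V', V' `<=` V & N V' a].
  move=> pV; have [V' [a [pV' V'V NV']]] := frc_dense N (po_le pW' pV).
  exists V', a; split=> //; apply: po_in pV' _ => x /V'V.
  by case: pV => _ _; apply.
have func V a b : po W' V -> N V a -> N V b -> a = b.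
  by move=> pV; apply: frc_fun; apply: po_le pV.
have reg V a : po W' V -> (forall V' b, po W' V' -> V' `<=` V -> N V' b -> b = a) -> N V a.
  move=> pV H; apply: frc_reg; first exact: po_le pV.
  move=> V' b pV' V'V NV'; apply: (H V') => //; apply: po_in pV' _ => x /V'V.
  by case: pV => _ _; apply.
by exists (Name her dense func reg).
Qed.

Lemma const_name A (a0 : A) : { N : name W A | forall V a, N V a <-> a = a0 }.
Proof.
have her V V' a : po W V' -> V' `<=` V -> a = a0 -> a = a0 by [].
have dense V : po W V -> exists V' a, [/\ po W V', V' `<=` V & a = a0].
  move=> pV; exists V, a0; split; [exact: pV|exact: subset_refl|by []].
have func V a b : po W V -> a = a0 -> b = a0 -> a = b by move=> _ -> ->.
have reg V a : po W V -> (forall V' b, po W V' -> V' `<=` V -> b = a0 -> b = a) -> a = a0.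
  by move=> pV H; rewrite -(H V a0).
by exists (@Name _ W A (fun _ a => a = a0) her dense func reg).
Qed.

Lemma joint_name I B (x : I -> name W B) :
  (forall V, po W V -> exists V' f, [/\ po W V', V' `<=` V & forall i, x i V' (f i)]) ->
  { N : name W (I -> B) | forall V f, N V f <-> forall i, x i V (f i) }.
Proof.
move=> dense.
have her V V' f : po W V' -> V' `<=` V -> (forall i, x i V (f i)) -> forall i, x i V' (f i).
  by move=> pV' V'V H i; apply: frc_her V'V (H i).
have func V f g : po W V -> (forall i, x i V (f i)) -> (forall i, x i V (g i)) -> f = g.
  by move=> pV Hf Hg; apply: funext => i; apply: frc_fun (Hf i) (Hg i).
have reg V f : po W V -> (forall V' g, po W V' -> V' `<=` V -> (forall i, x i V' (g i)) -> g = f) ->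
    forall i, x i V (f i).
  move=> pV H i; apply: frc_reg => // V' b pV' V'V xV'.
  have [V2 [g [p2 s2 Hg]]] := dense V' pV'.
  rewrite -(H V2 g) //; last by move=> y /s2 /V'V.
  by apply: (frc_fun p2 _ (Hg i)); apply: frc_her xV'.
by exists (Name her dense func reg).
Qed.

End Localize.

Section Tree.
Variables (X : topologicalType) (W : set X) (br : bad_region W).
Variables (K : Type) (rk : K -> K -> Prop) (wok : wo rk).
Variables (B : Type) (b0 : B) (x : K -> name W B).
Hypothesis segdec : forall k V, po W V -> exists V' f,
  [/\ po W V', V' `<=` V & forall z, leK rk z k -> x z V' (f z)].
Hypothesis undec : forall V, po W V -> ~ exists f, forall k, x k V (f k).

(** Values beyond [k] are reset to [b0], so that a segment has exactly one representing function. *)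
Definition cut k (f : K -> B) : K -> B := fun z => if pselect (leK rk z k) then f z else b0.

Lemma tree_names : { N : K -> name W (K -> B) |
  (forall k V f, N k V f <-> (forall z, leK rk z k -> x z V (f z)) /\ f = cut k f) }.
Proof.
have H k : { N : name W (K -> B) | forall V f, N V f <->
   (forall z, leK rk z k -> x z V (f z)) /\ f = cut k f }.
  have [cn cnP] := const_name W b0.
  pose x' z := if pselect (leK rk z k) then x z else cn.
  have [|N NP] := @joint_name X W K B x'.
    move=> V /(segdec k) [V' [f [pV' V'V Hf]]]; exists V', (cut k f); split=> // z.
    rewrite /x' /cut; case: pselect => [h|h]; first exact: Hf.
    exact/cnP.
  exists N => V f; rewrite NP; split=> [Hf|[Hf ef] z].
    split=> [z zk|]; first by have := Hf z; rewrite /x'; case: pselect.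
    apply: funext => z; rewrite /cut; case: pselect => // nz.
    by have := Hf z; rewrite /x'; case: pselect => // h0 /cnP.
  rewrite /x'; case: pselect => [h|h]; first exact: Hf.
  by apply/cnP; rewrite ef /cut; case: pselect.
by exists (fun k => sval (H k)) => k; exact: (proj2_sig (H k)).
Qed.

Let N := sval tree_names.
Let NP := proj2_sig tree_names.

Lemma tree_coh i j V f : po W V -> leK rk j i -> N i V f -> N j V (cut j f).
Proof.
move=> pV ji /NP [Hf ef]; apply/NP; split=> [z zj|].
  rewrite /cut; case: pselect => // h0; apply: Hf; exact: (leK_trans wok zj ji).
by apply: funext => z; rewrite /cut; case: pselect.
Qed.

Lemma tree_und V : po W V -> exists k, ~ exists f, N k V f.
Proof.
move=> pV; apply: contrapT => /forallNP H; apply: (undec pV).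
have {}H k : exists f, N k V f by apply: contrapT; apply: H.
have [F FP] := choice H; exists (fun k => F k k) => k.
by have /NP [Hk _] := FP k; apply: Hk; left.
Qed.

Lemma tree_bernstein (Q : K * (K -> B) -> Prop) :
  le_card {q | Q q} cont ->
  (forall V k0, po W V -> exists V' k f, [/\ po W V', V' `<=` V, leK rk k0 k,
     Q (k, cut k f) & forall z, leK rk z k -> x z V' (f z)]) -> False.
Proof.
move=> Qc Qd.
apply: (@bernstein_branch X W br K rk wok _ N (fun _ j f => cut j f) _ tree_und Q Qc).
  by move=> i j V f; apply: tree_coh.
move=> V i0 /(Qd V i0) [V' [k [f [pV' V'V i0k Qk Hf]]]]; exists V', k, (cut k f); split=> //.
apply/NP; split; last by apply: funext => z; rewrite /cut; case: pselect.
by move=> z zk; rewrite /cut; case: pselect => // h0; apply: Hf.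
Qed.

Lemma tree_liminf (T : Type) (r : T -> T -> Prop) (e : K -> (K -> B) -> T) : strong r ->
  (forall V t, po W V -> exists V' j, [/\ po W V', V' `<=` V &
     forall k V'' f, leK rk j k -> po W V'' -> V'' `<=` V' ->
       (forall z, leK rk z k -> x z V'' (f z)) -> f = cut k f -> ~ r (e k f) t]) ->
  False.
Proof.
move=> str He.
apply: (@liminf_branch X W br K rk wok _ N (fun _ j f => cut j f) _ tree_und T r e str).
  by move=> i j V f; apply: tree_coh.
move=> V t /(He V t) [V' [j [pV' V'V H]]]; exists V', j; split=> //.
by move=> k V'' f jk p'' s'' /NP [H1 H2]; apply: (H k V'' f jk p'' s'' H1 H2).
Qed.

End Tree.

Section Decide.
Variables (X : topologicalType).

Definition decided W B Y (x : Y -> name W B) (V : set X) := exists f, forall y, x y V (f y).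

(* A family of names that is nowhere decided has a shortest initial segment that
   is undecided everywhere in some smaller region. *)
Lemma undecided_tree W (br : bad_region W) Y (r : Y -> Y -> Prop) B (b0 : B)
    (x : Y -> name W B) : wo r ->
  (exists V, po W V /\ forall V', po W V' -> V' `<=` V -> ~ decided x V') ->
  exists W' (D : Y -> Prop) (x' : {y | D y} -> name W' B),
   [/\ po W W', (forall y z, D y -> r z y -> D z),
     (forall k V b, x' k V b <-> x (sval k) V b),
     (forall k V, po W' V -> exists V' f, [/\ po W' V', V' `<=` V &
        forall z : {y | D y}, leK (fun y z => r (sval y) (sval z)) z k -> x' z V' (f z)]) &
     (forall V, po W' V -> ~ exists f, forall k, x' k V (f k))].
Proof.
move=> wor [V0 [pV0 nV0]].
pose dec D V := exists f, forall y : Y, D y -> x y V (f y).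
pose dns D := forall V, po W V -> exists V', [/\ po W V', V' `<=` V & dec D V'].
have main D : (forall y z, D y -> r z y -> D z) ->
   (forall y, D y -> dns (fun z => leK r z y)) -> ~ dns D ->
   exists W' (x' : {y | D y} -> name W' B),
   [/\ po W W',
     (forall k V b, x' k V b <-> x (sval k) V b),
     (forall k V, po W' V -> exists V' f, [/\ po W' V', V' `<=` V &
        forall z : {y | D y}, leK (fun y z => r (sval y) (sval z)) z k -> x' z V' (f z)]) &
     (forall V, po W' V -> ~ exists f, forall k, x' k V (f k))].
  move=> dD sD nD.
  have /existsNP [W' /not_implyP [pW' /forallNP nW']] := nD.
  exists W', (fun k => sval (restr (x (sval k)) pW')).
  have xE k V b : sval (restr (x (sval k)) pW') V b <-> x (sval k) V b.
    exact: (proj2_sig (restr (x (sval k)) pW')).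
  split=> //.
  - move=> [y Dy] V pV; have [V' [pV' V'V [f Hf]]] := sD y Dy V (po_le pW' pV).
    exists V', (fun z => f (sval z)); split=> //.
      by apply: (po_in pV') => p /V'V; case: pV => _ _; apply.
    move=> z zk; apply/xE; apply: Hf.
    by case: zk => [->|zy]; [left|right].
  - move=> V pV [f Hf]; apply: (nW' V); split; [exact: po_le pV| by case: pV|].
    exists (fun y => if pselect (D y) is left h then f (exist _ y h) else b0) => y Dy.
    by case: pselect => // h; have /xE := Hf (exist _ y h).
have [all|/existsNP [y0 ny0]] := pselect (forall y, dns (fun z => leK r z y)).
  have [//|y _||W' [x' [h1 h2 h3 h4]]] := main (fun=> True); first exact: all.
    move=> /(_ V0 pV0) [V' [pV' V'V [f Hf]]]; apply: (nV0 V') => //.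
    by exists f => y; apply: Hf.
  by exists W', (fun=> True), x'.
have [|y [ny ymin]] := @wo_min _ _ wor (fun y => ~ dns (fun z => leK r z y)); first by exists y0.
have [|||W' [x' [h1 h2 h3 h4]]] := main (fun z => r z y).
- by move=> a b ay ba; apply: (wo_tr wor ba ay).
- move=> z zy; apply: contrapT => /ymin [e|yz]; first by subst z; apply: (wo_irr wor zy).
  exact: (wo_asym wor zy yz).
(* One further name is decided by a single extension, so the least segment that is not densely
   decided fails already without its top [y]. *)
- move=> dy; apply: ny => V /dy [V1 [p1 s1 [f Hf]]].
  have [V2 [b [p2 s2 Hb]]] := frc_dense (x y) p1.
  exists V2; split=> //; first by move=> p /s2 /s1.
  exists (fun z => if pselect (z = y) then b else f z) => z zy.
  case: pselect => [e|nzy] /=; first by rewrite e.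
  case: zy => // zy; exact: (frc_her p2 s2 (Hf z zy)).
by exists W', (fun z => r z y), x'; split=> // a b ay ba; apply: (wo_tr wor ba ay).
Qed.

(** Segments are countable and values at most continuum many, so by [c^omega = c] the tree has at
    most continuum many nodes, and [tree_bernstein] can take all of them. *)
Lemma decide_countable W (br : bad_region W) Y (r : Y -> Y -> Prop) B (x : Y -> name W B) :
  wo r -> (forall y, le_card (seg r y) nat) -> le_card Y cont -> le_card B cont ->
  forall V, po W V -> exists V', [/\ po W V', V' `<=` V & decided x V'].
Proof.
move=> wor cy Yc Bc V pV; apply: contrapT => /forallNP nV.
have [[b0]|nB] := pselect (inhabited B); last first.
  apply: (nV V); split=> //.
  have [[y]|nY] := pselect (inhabited Y).
    by have [V' [b _]] := frc_dense (x y) pV; case: nB.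
  by exists (fun y => False_rect _ (nY (inhabits y))) => y; case: nY.
have [|W' [D [x' [pW' dD xE sD uD]]]] := undecided_tree br b0 (x := x) wor.
  by exists V; split=> // V' pV' V'V dV'; apply: (nV V').
pose K := {y | D y}; pose rk (y z : K) := r (sval y) (sval z).
have wok : wo rk by apply: (wo_pull wor) => y z /sig_inj.
apply: (@tree_bernstein X W' (bad_sub br pW') K rk wok B b0 x' sD uD (fun q => q.2 = cut rk b0 q.1 q.2)).
  have cK (k : K) : exists i : {z | leK rk z k} -> nat, injective i.
    have [i iI] := cy (sval k).
    exists (fun z => if pselect (rk (sval z) k) is left h
      then (i (exist (fun y => r y (sval k)) (sval (sval z)) h)).+1 else 0).
    move=> [z zk] [w wk] /=; case: pselect => [hz|nz]; case: pselect => [hw|nw] //.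
      by move=> [] /iI [] /sig_inj e; apply: sig_inj.
    move=> _; apply: sig_inj => /=.
    by case: zk => [->|//]; case: wk => [->|//].
  have [i iI] : exists i : forall k : K, {z | leK rk z k} -> nat, forall k, injective (i k).
    by exists (fun k => projT1 (cid (cK k))) => k; case: cid.
  have [c cI] := Bc.
  have [bc bcI] : le_card (nat -> B) cont by apply: le_cont_fun => //; apply: le_card_refl.
  apply: (@le_card_trans _ (cont * cont)); last exact: cont_sq.
  have [yc ycI] := Yc.
  exists (fun q : {q : K * (K -> B) | q.2 = cut rk b0 q.1 q.2} => let k := (sval q).1 in let f := (sval q).2 in
    (yc (sval k), bc (fun n => if pselect (exists z, i k z = n) is left h
        then f (sval (projT1 (cid h))) else b0))).
  move=> [[k f] /= ef] [[k' f'] /= ef'] [] /ycI /sig_inj e; subst k'.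
  move=> /bcI e; apply: sig_inj => /=; congr pair; rewrite ef ef'; apply: funext => z.
  rewrite /cut; case: pselect => // zk.
  have := congr1 (fun h => h (i k (exist _ z zk))) e; case: pselect => [h|[]]; last by exists (exist _ z zk).
  by case: cid => w /= /iI ->.
move=> V1 k p1; have [V2 [f [p2 s2 Hf]]] := sD k V1 p1.
exists V2, k, f; split; [exact: p2|exact: s2|by left| |exact: Hf].
by apply: funext => z /=; rewrite /cut; case: pselect.
Qed.

Lemma decide_real W (br : bad_region W) B (x : nat -> name W B) : le_card B cont ->
  forall V, po W V -> exists V', [/\ po W V', V' `<=` V & decided x V'].
Proof.
move=> Bc; apply: (@decide_countable W br nat (fun m n => (m < n)%N)) => //.
- split; [by move=> n; rewrite ltnn|by move=> a b c; apply: ltn_trans|].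
  move=> P [n0 Pn0]; have exP : exists n, `[< P n >] by exists n0; apply/asboolP.
  exists (ex_minn exP); case: ex_minnP => m /asboolP Pm mmin; split=> // y Py.
  have := mmin y (introT (asboolP _) Py); rewrite leq_eqVlt => /orP [/eqP ->|]; [by left|by right].
- by move=> y; apply: seg_le.
- exact: le_nat_cont.
Qed.

(** If no bound can be forced, the running maximum [mx] can be forced not to lie below any given
    ordinal from some index on, as [tree_liminf] requires. *)
Lemma bound_nat (W : set X) (br : bad_region W) T (r : T -> T -> Prop) (y : nat -> name W T) : strong r ->
  forall V, po W V -> exists V', [/\ po W V', V' `<=` V &
     exists b, forall n V'' a, po W V'' -> V'' `<=` V' -> y n V'' a -> r a b].
Proof.
move=> str; apply: localize => // W' br' pW' nW'; have wor := strong_wo str.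
pose x n := sval (restr (y n) pW').
have xE n V a : x n V a <-> y n V a by exact: (proj2_sig (restr (y n) pW')).
have won : wo (fun m n => (m < n)%N).
  split; [by move=> n; rewrite ltnn|by move=> a b c; apply: ltn_trans|].
  move=> P [n0 Pn0]; have exP : exists n, `[< P n >] by exists n0; apply/asboolP.
  exists (ex_minn exP); case: ex_minnP => m /asboolP Pm mmin; split=> // z Pz.
  have := mmin z (introT (asboolP _) Pz); rewrite leq_eqVlt => /orP [/eqP ->|]; [by left|by right].
have [t0] := strong_inh str.
pose mx := fix mx (f : nat -> T) n := if n is m.+1
  then (if pselect (r (mx f m) (f m.+1)) then f m.+1 else mx f m) else f 0.
have mxS f n : ~ r (mx f n.+1) (mx f n).
  by move=> /=; case: pselect => // h; [apply: (wo_asym wor)|apply: (wo_irr wor)].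
have mxP f m n : m <= n -> ~ r (mx f n) (f m).
  move=> /subnK <-; elim: (n - m) => [|k IH].
    by case: m => [|m] /=; [apply: (wo_irr wor)|case: pselect => // h0; apply: (wo_irr wor)].
  rewrite addSn => h; have := mxS f (k + m) => nh; apply: IH.
  by case: (wo_nlt wor nh) => [<-//|h1]; apply: (wo_tr wor h1 h).
apply: (@tree_liminf X W' br' nat _ won T t0 x _ _ T r (fun n f => mx f n) str).
- elim=> [|n IH] V pV.
    have [V' [a [pV' V'V Ha]]] := frc_dense (x 0) pV.
    by exists V', (fun=> a); split=> // z [->|].
  have [V1 [f [p1 s1 Hf]]] := IH V pV; have [V2 [a [p2 s2 Ha]]] := frc_dense (x n.+1) p1.
  exists V2, (fun m => if m == n.+1 then a else f m); split=> //; first by move=> p /s2 /s1.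
  move=> z zn; case: eqP => [->//|ne].
  apply: (frc_her p2 s2); apply: Hf.
  case: zn => // zn; rewrite ltnS leq_eqVlt in zn.
  by case/orP: zn => [/eqP ->|]; [left|right].
- move=> V pV [f Hf]; apply: (nW' V pV); have [b bP] := strong_nat str (le_card_refl _) f.
  exists b => n V'' a p'' s'' Ha; suff -> : a = f n by [].
  have p3 : po W' V'' by apply: (po_in p'') => p /s''; case: pV => _ _; apply.
  exact: (frc_fun p3 (proj2 (xE n V'' a) Ha) (frc_her p3 s'' (Hf n))).
- move=> V t pV; apply: contrapT => H; apply: (nW' V pV); have [b tb] := strong_gt str t; exists b.
  move=> n V'' a p'' s'' Ha; apply: contrapT => nab; apply: H.
  have p3 : po W' V'' by apply: (po_in p'') => p /s''; case: pV => _ _; apply.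
  exists V'', n; split=> // k V3 f nk pV3 s3 Hf _ ht.
  have fn : f n = a.
    apply: (frc_fun pV3 (n := x n)); first by apply: Hf; case: nk => [->|]; [left|right].
    by apply: (frc_her pV3 s3); apply/xE.
  have nle : n <= k by case: nk => [->//|]; apply: ltnW.
  apply: (mxP f n k nle); rewrite fn; apply: (wo_tr wor ht).
  by case: (wo_nlt wor nab) => [->|] //; apply: (wo_tr wor tb).
Qed.

End Decide.

(** * Families indexed by the first uncountable ordinal *)

Record omega1 (O : Type) (ro : O -> O -> Prop) : Prop := Omega1 {
  o1_wo : wo ro;
  o1_unc : ~ le_card O nat;
  o1_seg : forall o, le_card (seg ro o) nat }.

Lemma le_card_finite_list A (l : list A) (P : A -> Prop) : (forall a, P a -> List.In a l) ->
  le_card {a | P a} nat.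
Proof.
move=> H.
have idx (l' : list A) a : List.In a l' -> exists n, List.nth_error l' n = Some a.
  by apply: List.In_nth_error.
have {}H (x : {a | P a}) : exists n, List.nth_error l n = Some (sval x).
  exact: idx (H _ (proj2_sig x)).
have [f fP] := choice H; exists f => x y e; apply: sig_inj.
by have := fP x; rewrite e fP => -[].
Qed.

Section O1.
Variables (O : Type) (ro : O -> O -> Prop) (o1 : omega1 ro).
Let woo := o1_wo o1.

Lemma o1_bound S : le_card S nat -> bounding ro S.
Proof.
move=> Sn f; apply: contrapT => /forallNP H; apply: (o1_unc o1).
apply: le_card_trans (le_card_prod (le_card_refl _) Sn (option_le (le_card_refl _))).
apply: (le_card_cofinal (f := f)) (o1_seg o1) => o.
have /existsNP [s ns] := H o; exists s.
by case: (wo_nlt woo ns) => [->|]; [left|right].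
Qed.

Lemma o1_inh : inhabited O.
Proof.
apply: contrapT => no; apply: (o1_unc o1).
by exists (fun o => False_rect _ (no (inhabits o))) => o; case: no.
Qed.

Lemma o1_cont : le_card O cont.
Proof.
case: (card_dich cont woo) => // -[o h]; exfalso.
exact: (cantor_cont h (o1_seg o1 o)).
Qed.

Lemma o1_club (f : list O -> O) : exists o, (exists j, ro j o) /\ closed_at ro f o.
Proof.
have [t] := o1_inh.
have [||o [to co _]] := @club O ro woo _ _ f t.
- exact: o1_bound (le_card_refl _).
- by move=> o; apply: o1_bound; apply: le_list_nat; apply: o1_seg.
by exists o; split=> //; exists t.
Qed.

Section Bound.
Variables (X : topologicalType) (T : Type) (r : T -> T -> Prop) (str : strong r).
Let wor := strong_wo str.

(* Colour [p] by the supremum of the values it decides before the first one that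
   it leaves undecided. *)
Lemma bound_mono (W : set X) (br : bad_region W) (y : O -> name W T) :
  (forall i i' V a a', po W V -> ro i i' -> y i V a -> y i' V a' -> ~ r a' a) ->
  (forall V t, po W V -> exists V' i a, [/\ po W V', V' `<=` V, y i V' a & r t a]) ->
  False.
Proof.
move=> mono unb.
have [t0] := strong_inh str; have [o0] := o1_inh.
have [S [Sst Sdis]] := solovay str.
pose Lim (p : X) d := exists i, [/\ (forall j, ro j i -> exists a, at_pt (y j) p a /\ r a d),
   ~ (exists a, at_pt (y i) p a) &
   (forall x, r x d -> exists j a, [/\ ro j i, at_pt (y j) p a & r x a])].
have Lim_fun p d d' : Lim p d -> Lim p d' -> d = d'.
  move=> [i [l1 l2 l3]] [i' [l1' l2' l3']].
  have ei : i = i'.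
    case: (wo_tri woo i i') => // h.
      by case: l2; have [a [ha _]] := l1' i h; exists a.
    by case: l2'; have [a [ha _]] := l1 i' h; exists a.
  subst i'; case: (wo_tri wor d d') => // h.
    have [j [a [ji ja da]]] := l3' d h; have [b [jb bd]] := l1 j ji.
    by rewrite (at_fun ja jb) in da; case: (wo_asym wor da bd).
  have [j [a [ji ja da]]] := l3 d' h; have [b [jb bd]] := l1' j ji.
  by rewrite (at_fun ja jb) in da; case: (wo_asym wor da bd).
have [col colP] := limit_color Sdis Lim_fun.
apply: (@bad_col _ _ br W col); first exact: poW.
move=> V0 pV0 _ k.
(* The negation of [Fin] is what matters: infinitely many values of [y i] on the off-branch pieces
   will keep the limit point from deciding the final index. *)
pose Fin (V : set X) i := exists L : list T, forall V' a, po W V' -> V' `<=` V -> y i V' a -> List.In a L.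
have step (q : set X * (O * T)) : exists z : (set X * set X) * (T * T) * (O * O), po W q.1 ->
   let: (V', Q, (a, b), (i, h)) := z in
   [/\ [/\ po W V', closure V' `<=` q.1, po W Q & Q `<=` q.1], Q `&` V' = set0,
      y q.2.1 V' a, y i V' b /\ r q.2.2 b &
      (exists o, forall i, Fin Q i -> ro i o) -> forall i, Fin Q i -> ro i h].
  case: q => V [j t] /=; have [pV|nV] := pselect (po W V); last by exists (V, V, (t, t), (j, j)).
  have [V1 [V2 [p1 p2 s1 s2 d12]]] := po_split br pV.
  have [V3 [a [p3 s3 Ha]]] := frc_dense (y j) p1.
  have [V4 [i [b [p4 s4 Hb tb]]]] := unb V3 t p3.
  have [h hP] : exists h, (exists o, forall i, Fin V2 i -> ro i o) -> forall i, Fin V2 i -> ro i h.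
    have [[h hP]|nh] := pselect (exists o, forall i, Fin V2 i -> ro i o); first by exists h.
    by exists j.
  exists (V4, V2, (a, b), (i, h)); split=> //.
  - split=> //; last by move=> x /subset_closure /s2.
    by apply: subset_trans s1; apply: closureS => x /s4 /s3.
  - by rewrite -subset0 -d12 => x [V2x /s4 /s3].
  - exact: (frc_her p4 s4).
have [st stP] := choice step.
pose Vs := fix Vs (l : list (O * T)) : set X := if l is x :: l' then (st (Vs l', x)).1.1.1 else V0.
have pVs l : po W (Vs l).
  elim: l => //= x l IH; have := stP (Vs l, x) IH.
  by case: (st _) => [[[V' Q] [a b]] [i h]] [[]].
pose dat l x := st (Vs l, x).
pose va (l : list (O * T)) := if l is x :: l' then (dat l' x).1.2.1 else t0.
pose vb (l : list (O * T)) := if l is x :: l' then (dat l' x).1.2.2 else t0.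
pose ii (l : list (O * T)) := if l is x :: l' then (dat l' x).2.1 else o0.
pose hh (l : list (O * T)) := if l is x :: l' then (dat l' x).2.2 else o0.
have [Phi PhiP] : exists Phi : list T -> T, forall m, r (va m) (Phi (map snd m)) /\ r (vb m) (Phi (map snd m)).
  suff /choice [Phi PhiP] : forall l, exists b, forall m, map snd m = l -> r (va m) b /\ r (vb m) b.
    by exists Phi => m; apply: PhiP.
  move=> l; have Oc : le_card (list O * bool) cont.
    apply: (le_card_prod le_nat_cont); first exact: le_card_list le_nat_cont o1_cont.
    exact: le_card_trans le_bool_nat le_nat_cont.
  have [b bP] := strong_cont str Oc (fun q => if q.2 then va (zip q.1 l) else vb (zip q.1 l)).
  exists b => m ml; have := bP (map fst m, true); have := bP (map fst m, false) => /=.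
  by rewrite -ml zip_unzip.
have [d [Sd cd [eta [eta1 eta2]]]] := Sst k Phi.
(* With the ladder [eta] fixed, countably many labellings remain, and a closure point [is_] of [Psi]
   lies above all indices used on the branch. *)
have [Psi PsiP] : exists Psi : list O -> O, forall l,
    (forall m n, m = zip l (map eta n) -> ro (ii m) (Psi l) /\ ro (hh m) (Psi l)).
  suff /choice [Psi PsiP] : forall l, exists b, forall m n, m = zip l (map eta n) -> ro (ii m) b /\ ro (hh m) b.
    by exists Psi.
  move=> l; have Oc : le_card (list nat * bool) nat.
    by apply: (le_card_prod (le_card_refl _) (le_list_nat (le_card_refl _)) le_bool_nat).
  have [b bP] := o1_bound Oc (fun q => if q.2 then ii (zip l (map eta q.1)) else hh (zip l (map eta q.1))).
  by exists b => m n ->; split; [exact: (bP (n, true))|exact: (bP (n, false))].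
have [is_ [[j0 j0i] cis]] := o1_club Psi.
(* The branch runs through all indices below [is_], so that the limit point decides each of them. *)
have [en enP] : exists en : nat -> O, (forall n, ro (en n) is_) /\ forall j, ro j is_ -> exists n, en n = j.
  have [en enS] := surj_le_card (exist (fun j => ro j is_) j0 j0i) (o1_seg o1 is_).
  exists (fun n => sval (en n)); split; first by move=> n; exact: (proj2_sig (en n)).
  by move=> j ji; have [n en_n] := enS (exist _ j ji); exists n; rewrite en_n.
pose L := fix L n := if n is m.+1 then (en m, eta m) :: L m else [::].
have LE n : L n = zip (map fst (L n)) (map eta (rev (iota 0 n))).
  elim: n => // n IH.
  have -> : rev (iota 0 n.+1) = n :: rev (iota 0 n) by rewrite -addn1 iotaD rev_cat.
  by rewrite /= {1}IH.
have belT n : below r d (map snd (L n)) by elim: n => //= n IH; split.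
have belO n : below ro is_ (map fst (L n)) by elim: n => //= n IH; split=> //; apply: enP.1.
have iiL n : ro (ii (L n)) is_ /\ ro (hh (L n)) is_.
  have [h1 h2] := PsiP _ _ _ (LE n); have h3 := cis _ (belO n).
  by split; [apply: (wo_tr woo h1 h3)|apply: (wo_tr woo h2 h3)].
have vL n : r (va (L n)) d /\ r (vb (L n)) d.
  have [h1 h2] := PhiP (L n); have h3 := cd _ (belT n).
  by split; [apply: (wo_tr wor h1 h3)|apply: (wo_tr wor h2 h3)].
pose V n := Vs (L n).
pose Q n := (dat (L n) (en n, eta n)).1.1.2.
have dP n : [/\ [/\ po W (V n.+1), closure (V n.+1) `<=` V n, po W (Q n) & Q n `<=` V n],
    Q n `&` V n.+1 = set0, y (en n) (V n.+1) (va (L n.+1)),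
    y (ii (L n.+1)) (V n.+1) (vb (L n.+1)) /\ r (eta n) (vb (L n.+1)) &
    (exists o, forall i, Fin (Q n) i -> ro i o) -> forall i, Fin (Q n) i -> ro i (hh (L n.+1))].
  have := stP (Vs (L n), (en n, eta n)) (pVs _); rewrite /V /Q /= /dat /=.
  by case: (st _) => [[[V' Q'] [a b]] [i h]].
have pV n : po W (V n) by apply: pVs.
have pQ n : po W (Q n) by case: (dP n) => -[].
have nFin n : ~ Fin (Q n) is_.
  move=> Fi; have [_ _ _ _ H] := dP n.
  have [bd|nbd] := pselect (exists o, forall i, Fin (Q n) i -> ro i o).
    exact: (wo_asym woo (H bd _ Fi) (iiL n.+1).2).
  (* Finitely many values at cofinally many indices have a common bound [b]; by monotonicity it
     would bound all the names on [Q n], against [unb]. *)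
  have [b bP] : exists b, forall i, Fin (Q n) i -> forall V' a, po W V' -> V' `<=` Q n -> y i V' a -> r a b.
    have H1 i : exists b, Fin (Q n) i -> forall V' a, po W V' -> V' `<=` Q n -> y i V' a -> r a b.
      have [[Ls LsP]|nf] := pselect (Fin (Q n) i); last by exists t0.
      have [|b bP] := @strong_nat _ _ str {a | List.In a Ls} _ (fun x => sval x).
        exact: (@le_card_finite_list _ Ls).
      by exists b => _ V' a p' s' Ha; apply: (bP (exist _ a (LsP V' a p' s' Ha))).
    have [g gP] := choice H1; have [b bP] := strong_cont str o1_cont g.
    by exists b => i Fi' V' a p' s' Ha; apply: (wo_tr wor (gP i Fi' V' a p' s' Ha) (bP i)).
  have [V1 [i [c [p1 s1 Hc bc]]]] := unb (Q n) b (pQ n).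
  have [i' [Fi' ii']] : exists i', Fin (Q n) i' /\ leK ro i i'.
    apply: contrapT => /forallNP Hn; apply: nbd; exists i => i' Fi'.
    by case: (leK_total woo i i') => // h; case: (Hn i').
  have [V2 [c' [p2 s2 Hc']]] := frc_dense (y i') p1.
  have c'b : r c' b by apply: (bP i' Fi' V2) => // x /s2 /s1.
  have Hc2 := frc_her p2 s2 Hc.
  case: ii' => [e|lt].
    by subst i'; rewrite (frc_fun p2 Hc2 Hc') in bc; apply: (wo_asym wor bc c'b).
  by apply: (mono i i' V2 c c' p2 lt Hc2 Hc'); apply: (wo_tr wor c'b bc).
(* Each piece gets a value of [y is_] outside the list of those already used. A neighbourhood
   meeting two pieces therefore cannot decide [y is_]. *)
have [pk pkP] : exists pk : nat * list T -> set X * T, forall q,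
    [/\ po W (pk q).1, (pk q).1 `<=` Q q.1, y is_ (pk q).1 (pk q).2 & ~ List.In (pk q).2 q.2].
  suff /choice [pk H] : forall q : nat * list T, exists z : set X * T,
     [/\ po W z.1, z.1 `<=` Q q.1, y is_ z.1 z.2 & ~ List.In z.2 q.2] by exists pk.
  move=> [n Ls]; have /forallNP /(_ Ls) := nFin n.
  move=> /existsNP [V' /existsNP [a /not_implyP [p' /not_implyP [s' /not_implyP [Ha na]]]]].
  by exists (V', a).
pose Z := fix Z n := if n is m.+1 then (pk (m, Z m)).2 :: Z m else [::].
have ZI m n : m < n -> List.In (pk (m, Z m)).2 (Z n).
  elim: n => // n IH; rewrite ltnS leq_eqVlt => /orP [/eqP ->|/IH h] /=; [by left|by right].
pose U n := (pk (n, Z n)).1.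
have [||||p [Vp acc]] := realize br (O := U) pV.
- by move=> n; case: (dP n) => -[].
- by move=> n; case: (pkP (n, Z n)).
- by move=> n; case: (pkP (n, Z n)) => _ h _ _ x /h; case: (dP n) => -[_ _ _ h'] _ _ _ _; apply: h'.
- move=> n x Ux Vx; case: (pkP (n, Z n)) => _ h _ _; case: (dP n) => _ h' _ _ _.
  by have : set0 x by rewrite -h'; split=> //; apply: h.
exists p; split; first exact: (Vp 0).
apply: (colP p d k) => //; exists is_; split.
- move=> j /enP.2 [n <-]; exists (va (L n.+1)); split; last exact: (vL n.+1).1.
  by exists (V n.+1); split=> //; case: (dP n).
- move=> [a [G [pG Gp Ga]]]; have oG : open G by case: pG.
  have [m [_ [x [Gx Ux]]]] := acc G oG Gp 0.
  have [m' [mm' [x' [Gx' Ux']]]] := acc G oG Gp m.+1.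
  have [q1 _ q3 _] := pkP (m, Z m); have [q1' _ q3' q4'] := pkP (m', Z m').
  have e : a = (pk (m, Z m)).2 by apply: (frc_meet pG q1 Ga q3); exists x.
  have e' : a = (pk (m', Z m')).2 by apply: (frc_meet pG q1' Ga q3'); exists x'.
  by apply: q4'; rewrite -e' e; apply: ZI.
- move=> x /eta2 [n xn]; exists (ii (L n.+1)), (vb (L n.+1)); split.
  + exact: (iiL n.+1).1.
  + by exists (V n.+1); split=> //; case: (dP n) => _ _ _ [].
  + by case: (dP n) => _ _ _ [_ h] _; apply: (wo_tr wor xn h).
Qed.

End Bound.
End O1.

(** * Cofinalities below the cellularity *)

Definition countably_many_cardinals (K0 : Type) := exists G : nat -> Type,
  forall A : Type, le_card cont A -> le_card A K0 ->
    exists n, le_card A (G n) /\ le_card (G n) A.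

(* A singular cardinal of uncountable cofinality would have uncountably many
   cardinals below it. *)
Lemma regular_or_cofinal (K0 T : Type) (r : T -> T -> Prop) : countably_many_cardinals K0 ->
  wo r -> init r -> le_card T K0 -> ~ le_card T cont ->
  (exists eta : nat -> T, forall t, exists n, ~ r (eta n) t) \/ strong r.
Proof.
move=> [G GP] wor ini TK nT.
have [h|/forallNP ncof] := pselect (exists eta : nat -> T, forall t, exists n, ~ r (eta n) t).
  by left.
(* Segments are sorted by size, [None] meaning at most the continuum. As the cofinality is
   uncountable, one of these countably many classes is cofinal, and its size [M] bounds every
   segment, as below a successor cardinal. *)
right; pose cls (c : option nat) t := if c is Some n
  then [/\ le_card cont (seg r t), le_card (seg r t) (G n) & le_card (G n) (seg r t)] else le_card (seg r t) cont.
have clsP t : exists c, cls c t.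
  case: (le_card_total (seg r t) cont) => h; first by exists None.
  have [n [n1 n2]] := GP _ h (le_card_trans (seg_le r t) TK); by exists (Some n).
have [c cu] : exists c, forall b, exists t, cls c t /\ ~ r t b.
  apply: contrapT => /forallNP H.
  have {}H c : exists b, forall t, cls c t -> r t b.
    have /existsNP [b /forallNP bP] := H c; exists b => t ct.
    by apply: contrapT => nr; apply: (bP t).
  have [b bP] := choice H.
  apply: (ncof (fun n => b (if n is m.+1 then Some m else None))) => t.
  have [c ct] := clsP t; exists (if c is Some m then m.+1 else 0) => rt.
  apply: (wo_irr wor (x := t)); apply: (wo_tr wor (bP c t ct)).
  by case: c ct rt.
pose M := if c is Some n then G n else cont.
have segM t : le_card (seg r t) M.
  have [t' [ct' nt']] := cu t.
  apply: (@le_card_trans _ (seg r t')).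
    apply: le_card_sub => x xt; case: (wo_nlt wor nt') => [->//|h]; exact: (wo_tr wor xt h).
  by rewrite /M; move: ct'; case: (c) => [n []|].
have [t0] : inhabited T.
  apply: contrapT => nT0; apply: nT.
  by exists (fun t => False_rect _ (nT0 (inhabits t))) => t; case: nT0.
have nTM : ~ le_card T M.
  rewrite /M; move: cu; case: (c) => [n cu TM|] //.
  have [t [[_ _ h] _]] := cu t0.
  exact: (ini t (le_card_trans TM h)).
have Minf : le_card nat M.
  rewrite /M; move: cu; case: (c) => [n cu|_]; last exact: le_nat_cont.
  have [t [[h1 h2 _] _]] := cu t0.
  exact: (le_card_trans le_nat_cont (le_card_trans h1 h2)).
apply: strong_intro => // t f; apply: contrapT => /forallNP H; apply: nTM.
apply: le_card_trans (le_card_prod Minf (segM t) (option_le Minf)).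
apply: (le_card_cofinal (f := f)) segM => x.
have /existsNP [s ns] := H x; exists s.
by case: (wo_nlt wor ns) => [->|]; [left|right].
Qed.

(** The case distinction behind every later induction on a bound [t]; its second case is that of a
    [t] that is not a cardinal. *)
Lemma seg_cases (K0 T : Type) (r : T -> T -> Prop) t : countably_many_cardinals K0 ->
  wo r -> le_card (seg r t) K0 ->
  [\/ le_card (seg r t) cont, (exists s, r s t /\ le_card (seg r t) (seg r s)),
     (exists eta : nat -> T, (forall n, r (eta n) t) /\ forall x, r x t -> exists n, r x (eta n)) |
     strong (fun x y : seg r t => r (sval x) (sval y))].
Proof.
move=> KG wor tK.
have [h1|h1] := pselect (le_card (seg r t) cont); first exact: Or41.
have [h2|/forallNP h2] := pselect (exists s, r s t /\ le_card (seg r t) (seg r s)); first exact: Or42.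
pose r' := fun x y : seg r t => r (sval x) (sval y).
have wor' : wo r' by apply: (wo_pull wor) => x y /sig_inj.
have ini' : init r'.
  move=> s h; apply: (h2 (sval s)); split; first exact: (proj2_sig s).
  apply: (le_card_trans h).
  exists (fun x => exist (fun z => r z (sval s)) (sval (sval x)) (proj2_sig x)).
  by move=> x y [] /sig_inj /sig_inj.
case: (regular_or_cofinal KG wor' ini' tK h1) => [[eta etaP]|]; last exact: Or44.
have inf : le_card nat (seg r t).
  by case: (le_card_total nat (seg r t)) => // h; case: h1; apply: (le_card_trans h le_nat_cont).
(* The ladder found above is cofinal only in the weak sense; the absence of a maximum makes it
   strict. *)
have nomax x : r x t -> exists y, r x y /\ r y t.
  move=> xt; apply: contrapT => /forallNP H; apply: (h2 x); split=> //.
  have tx : le_card (seg r t) (option (seg r x)).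
    apply: le_card_trans (le_card_upto r x); apply: le_card_sub => w wt.
    have [wx|/(wo_nlt wor) [->|xw]] := pselect (r w x); [by right|by left|by case: (H w)].
  have xinf : le_card nat (seg r x).
    case: (pselect (le_card nat (seg r x))) => // nx; exfalso.
    apply: (option_sq_finite nx); apply: (le_card_trans inf); apply: (le_card_trans tx).
    by exists (fun z => (None, z)) => y z [].
  exact: le_card_trans tx (option_le xinf).
apply: Or43; exists (fun n => sval (eta n)); split; first by move=> n; exact: (proj2_sig (eta n)).
move=> x xt; have [y [xy yt]] := nomax x xt.
have [n nP] := etaP (exist _ y yt); exists n.
by case: (wo_nlt wor nP) => [->//|h]; apply: (wo_tr wor xy h).
Qed.

Section Unc.
Variables (O : Type) (ro : O -> O -> Prop) (o1 : omega1 ro).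
Variable (X : topologicalType).
Let woo := o1_wo o1.

Lemma leK_countable i : le_card {j | leK ro j i} nat.
Proof.
apply: le_card_trans (le_card_upto ro i) _.
exact: le_card_trans (le_card_option (o1_seg o1 i)) (option_le (le_card_refl _)).
Qed.

Lemma bound_countable (W : set X) (br : bad_region W) T (r : T -> T -> Prop) I (y : I -> name W T) :
  strong r -> le_card I nat ->
  forall V, po W V -> exists V', [/\ po W V', V' `<=` V &
     exists b, forall i V'' a, po W V'' -> V'' `<=` V' -> y i V'' a -> r a b].
Proof.
move=> str In V pV; have [[i0]|nI] := pselect (inhabited I); last first.
  have [t0] := strong_inh str; exists V; split; [exact: pV|exact: subset_refl|].
  by exists t0 => i; case: nI.
have [e eS] := surj_le_card i0 In.
have [V' [p' s' [b bP]]] := bound_nat br (fun n => y (e n)) str pV.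
exists V'; split=> //; exists b => i V'' a p'' s''.
by have [n <-] := eS i; apply: bP.
Qed.

Lemma bound_o1 (W : set X) (br : bad_region W) T (r : T -> T -> Prop) (y : O -> name W T) :
  strong r ->
  forall V, po W V -> exists V', [/\ po W V', V' `<=` V &
     exists b, forall i V'' a, po W V'' -> V'' `<=` V' -> y i V'' a -> r a b].
Proof.
move=> str; apply: localize => // W' br' pW' nW'; have wor := strong_wo str.
(* To obtain monotone names, [y i] is replaced by the least weak upper bound of the [y j] with [j]
   up to [i]. Requiring leastness in all smaller conditions makes the values of [dec] consistent. *)
pose UB V i b := forall j, leK ro j i -> forall V'' a, po W' V'' -> V'' `<=` V -> y j V'' a -> ~ r b a.
pose dec i V b := UB V i b /\ forall V' b', po W' V' -> V' `<=` V -> UB V' i b' -> ~ r b' b.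
have pWW V : po W' V -> po W V by exact: po_le.
have pin V V' : po W V' -> po W' V -> V' `<=` V -> po W' V'.
  by move=> pV' pV s; apply: (po_in pV') => p /s; case: pV => _ _; apply.
have UB_sub V V' i b : V' `<=` V -> UB V i b -> UB V' i b.
  by move=> s H j ji V'' a p'' s''; apply: (H j ji V'' a p'') => p /s'' /s.
have H i : { N : name W' T | forall V a, po W' V -> dec i V a -> N V a }.
  apply: mk_name.
    move=> V pV; have [V1 [p1 s1 [b bP]]] :=
      bound_countable br (fun j : {j | leK ro j i} => y (sval j)) str (leK_countable i) (pWW V pV).
    have p1' := pin _ _ p1 pV s1.
    have [|c [[V2 [p2 s2 ub2]] cmin]] := @wo_min _ _ wor (fun c => exists V2, [/\ po W' V2, V2 `<=` V1 & UB V2 i c]).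
      exists b, V1; split; [exact: p1'|exact: subset_refl|].
      by move=> j ji V'' a p'' s'' Ha; apply: (wo_asym wor); apply: (bP (exist _ j ji) V'' a (pWW _ p'') s'' Ha).
    exists V2, c; split=> //; first by move=> p /s2 /s1.
    split=> // V' b' pV' V'2 ub'; have : exists V2, [/\ po W' V2, V2 `<=` V1 & UB V2 i b'].
      by exists V'; split=> // p /V'2 /s2.
    by move=> /cmin [->|h]; [apply: (wo_irr wor)|apply: (wo_asym wor)].
  move=> V V' a b pV pV' [ua ma] [ub mb] m.
  have pm := po_meet pV (let: And3 h _ _ := pV' in h) m.
  have s1 : V `&` V' `<=` V by move=> p [].
  have s2 : V `&` V' `<=` V' by move=> p [].
  have n1 := ma _ b pm s1 (UB_sub _ _ _ _ s2 ub).
  have n2 := mb _ a pm s2 (UB_sub _ _ _ _ s1 ua).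
  by case: (wo_tri wor a b).
pose z i := sval (H i).
have zP i V a : po W' V -> dec i V a -> z i V a by exact: (proj2_sig (H i)).
have zdec i V a : po W' V -> z i V a -> exists V', [/\ po W' V', V' `<=` V & dec i V' a].
  move=> pV zV.
  have [V2 [p2 s2 [c dc]]] : exists V2, [/\ po W' V2, V2 `<=` V & exists c, dec i V2 c].
    have [V1 [p1 s1 [b bP]]] :=
      bound_countable br (fun j : {j | leK ro j i} => y (sval j)) str (leK_countable i) (pWW V pV).
    have p1' := pin _ _ p1 pV s1.
    have [|c [[V2 [p2 s2 ub2]] cmin]] := @wo_min _ _ wor (fun c => exists V2, [/\ po W' V2, V2 `<=` V1 & UB V2 i c]).
      exists b, V1; split; [exact: p1'|exact: subset_refl|].
      by move=> j ji V'' a' p'' s'' Ha; apply: (wo_asym wor); apply: (bP (exist _ j ji) V'' a' (pWW _ p'') s'' Ha).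
    exists V2; split=> //; first by move=> p /s2 /s1.
    exists c; split=> // V' b' pV' V'2 ub'; have : exists V2, [/\ po W' V2, V2 `<=` V1 & UB V2 i b'].
      by exists V'; split=> // p /V'2 /s2.
    by move=> /cmin [->|h]; [apply: (wo_irr wor)|apply: (wo_asym wor)].
  exists V2; split=> //; suff <- : c = a by [].
  apply: (frc_fun p2 (zP i V2 c p2 dc)); exact: (frc_her p2 s2 zV).
apply: (@bound_mono O ro o1 X T r str W' br' z).
- move=> i i' V a a' pV ii' za za'.
  have [V1 [p1 s1 [u1 m1]]] := zdec i V a pV za.
  have [V2 [p2 s2 [u2 m2]]] := zdec i' V1 a' p1 (frc_her p1 s1 za').
  apply: (m1 V2) => // j ji; apply: u2.
  by right; case: ji => [->//|h]; apply: (wo_tr woo h ii').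
- move=> V t pV; apply: contrapT => Hn; apply: (nW' V pV); have [c tc] := strong_gt str t.
  exists c => i V'' a p'' s'' Ha; apply: contrapT => nac; apply: Hn.
  have p3 := pin _ _ p'' pV s''.
  have [V1 [b [p1 s1 zb]]] := frc_dense (z i) p3.
  exists V1, i, b; split=> //; first by move=> p /s1 /s''.
  have [V2 [p2 s2 [u2 _]]] := zdec i V1 b p1 zb.
  have nba : ~ r b a.
    apply: (u2 i (or_introl erefl) V2 a p2); first exact: subset_refl.
    by apply: (frc_her (pWW _ p2) _ Ha) => p /s2 /s1.
  have ta : r t a by case: (wo_nlt wor nac) => [->//|h]; apply: (wo_tr wor tc h).
  by case: (wo_nlt wor nba) => [->//|h]; apply: (wo_tr wor ta h).
Qed.

Lemma name_map_inv (W : set X) A B (f : A -> B) (N : name W A) (M : name W B) V a :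
  (forall V a, po W V -> N V a -> M V (f a)) -> po W V ->
  (forall V' a', po W V' -> V' `<=` V -> N V' a' -> f a' = f a -> a' = a) ->
  M V (f a) -> N V a.
Proof.
move=> NM pV fI MV; apply: frc_reg => // V' b pV' V'V Nb; apply: (fI V') => //.
exact: (frc_fun pV' (NM _ _ pV' Nb) (frc_her pV' V'V MV)).
Qed.

(* Induction on the bound [t]: regular values are replaced by a smaller bound, and
   values of countable cofinality are split along a ladder. *)
Lemma decide_uncountable (W : set X) (br : bad_region W) K0 (T : Type) (r : T -> T -> Prop) :
  countably_many_cardinals K0 -> wo r ->
  forall t, le_card (seg r t) K0 -> forall (e : O -> name W T) (J : O -> Prop),
  (forall o, exists i, J i /\ ro o i) -> forall V, po W V ->
  (forall i V'' a, J i -> po W V'' -> V'' `<=` V -> e i V'' a -> r a t) ->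
  exists V' I, [/\ po W V', V' `<=` V, (forall i, I i -> J i),
     (forall o, exists i, I i /\ ro o i) & exists f, forall i, I i -> e i V' (f i)].
Proof.
move=> KG wor; apply: (wo_ind wor) => t IH tK e J Junb V pV et.
have [o0] := o1_inh o1.
have [s0 s0t] : exists s, r s t.
  have [i [Ji _]] := Junb o0; have [V1 [a [p1 s1 Ha]]] := frc_dense (e i) pV.
  by exists a; apply: (et i V1).
pose f x : seg r t := if pselect (r x t) is left h then exist (fun y => r y t) x h else exist (fun y => r y t) s0 s0t.
have fE x : r x t -> sval (f x) = x by rewrite /f; case: pselect.
pose ef i := sval (name_map f (e i)).
have efP i V1 a : po W V1 -> e i V1 a -> ef i V1 (f a) by exact: (proj2_sig (name_map f (e i))).
have back i V1 s : J i -> po W V1 -> V1 `<=` V -> ef i V1 s -> e i V1 (sval s).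
  move=> Ji p1 s1 H1; have fs : f (sval s) = s.
    by apply: sig_inj; rewrite fE //; exact: (proj2_sig s).
  apply: (name_map_inv (f := f) (efP i) p1); last by rewrite fs.
  move=> V2 b p2 s2 Hb; rewrite fs => e1; rewrite -e1 fE //.
  by apply: (et i V2) => // p /s2 /s1.
case: (seg_cases KG wor tK) => [tc|[s [st ts]]|[eta [eta1 eta2]]|str].
- have [V1 [p1 s1 [g Hg]]] := decide_countable br ef (o1_wo o1) (o1_seg o1) (o1_cont o1) tc pV.
  exists V1, J; split=> //; exists (fun i => sval (g i)) => i Ji.
  exact: back.
- have [g gI] := ts.
  pose h x := sval (g (f x)).
  pose eh i := sval (name_map h (e i)).
  have ehP i V1 a : po W V1 -> e i V1 a -> eh i V1 (h a) by exact: (proj2_sig (name_map h (e i))).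
  have ehv i V'' a : J i -> po W V'' -> V'' `<=` V -> eh i V'' a -> exists V1 b,
     [/\ po W V1, V1 `<=` V'', e i V1 b & a = h b].
    move=> Ji p'' s'' Ha; have [V1 [b [p1 s1 Hb]]] := frc_dense (e i) p''.
    exists V1, b; split=> //; exact: (frc_fun p1 (frc_her p1 s1 Ha) (ehP i V1 b p1 Hb)).
  have sK : le_card (seg r s) K0.
    by apply: (le_card_trans _ tK); apply: le_card_sub => x xs; apply: (wo_tr wor xs st).
  have [|V1 [I [p1 s1 IJ Iunb [k Hk]]]] := IH s st sK eh J Junb V pV.
    move=> i V'' a Ji p'' s'' Ha; have [V1 [b [_ _ _ ->]]] := ehv i V'' a Ji p'' s'' Ha.
    exact: (proj2_sig (g (f b))).
  have H1 i : exists a, I i -> e i V1 a.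
    have [Ii|nIi] := pselect (I i); last by exists t.
    have [V2 [b [p2 s2 Hb kb]]] := ehv i V1 (k i) (IJ i Ii) p1 s1 (Hk i Ii).
    exists b => _; apply: (name_map_inv (f := h) (ehP i) p1); last by rewrite -kb; apply: Hk.
    move=> V' a' p' s' Ha' /sig_inj /gI fab.
    have a't : r a' t by apply: (et i V') => //; [exact: IJ|move=> p /s' /s1].
    have bt : r b t by apply: (et i V2) => //; [exact: IJ|move=> p /s2 /s1].
    by rewrite -(fE _ a't) fab fE.
  have [k' Hk'] := choice H1.
  by exists V1, I; split=> //; exists k'.
- have et1 x : exists n, r x t -> r x (eta n).
    have [/eta2 [n xn]|nx] := pselect (r x t); first by exists n.
    by exists 0.
  have [m mP] := choice et1.
  pose em i := sval (name_map m (e i)).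
  have emP i V1 a : po W V1 -> e i V1 a -> em i V1 (m a) by exact: (proj2_sig (name_map m (e i))).
  have [V1 [p1 s1 [g Hg]]] := decide_countable br em (o1_wo o1) (o1_seg o1) (o1_cont o1) le_nat_cont pV.
  (* Countably many rungs cannot split [J] into bounded sets, so one rung [n] serves unboundedly
     many indices. *)
  have [n nP] : exists n, forall o, exists i, (J i /\ g i = n) /\ ro o i.
    apply: contrapT => /forallNP H.
    have {}H n : exists o, forall i, J i -> g i = n -> ~ ro o i.
      have /existsNP [o /forallNP ho] := H n; exists o => i Ji gi oi; exact: (ho i).
    have [o oP] := choice H; have [b bP] := o1_bound o1 (le_card_refl _) o.
    have [i [Ji bi]] := Junb b; apply: (oP (g i) i Ji erefl); exact: (wo_tr woo (bP _) bi).
  have nK : le_card (seg r (eta n)) K0.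
    by apply: (le_card_trans _ tK); apply: le_card_sub => x xs; apply: (wo_tr wor xs (eta1 n)).
  have [|V2 [I [p2 s2 IJ Iunb [k Hk]]]] := IH _ (eta1 n) nK e (fun i => J i /\ g i = n) nP V1 p1.
    move=> i V'' a [Ji gi] p'' s'' Ha; rewrite -gi.
    have -> : g i = m a by apply: (frc_fun p'' (frc_her p'' s'' (Hg i)) (emP i V'' a p'' Ha)).
    by apply: mP; apply: (et i V'') => // p /s'' /s1.
  exists V2, I; split=> //; first by move=> p /s2 /s1.
    by move=> i /IJ [].
  by exists k.
- have [V1 [p1 s1 [b bP]]] := bound_o1 br ef str pV.
  have bK : le_card (seg r (sval b)) K0.
    apply: (le_card_trans _ tK); apply: le_card_sub => x xs.
    exact: (wo_tr wor xs (proj2_sig b)).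
  have [|V2 [I [p2 s2 IJ Iunb Hk]]] := IH _ (proj2_sig b) bK e J Junb V1 p1.
    move=> i V'' a Ji p'' s'' Ha.
    have := bP i V'' (f a) p'' s'' (efP i V'' a p'' Ha); rewrite fE //.
    by apply: (et i V'') => // p /s'' /s1.
  by exists V2, I; split=> // p /s2 /s1.
Qed.

End Unc.

(** * Bounds along a partition of the integers *)

Definition incr (f : nat -> nat) := forall n, f n < f n.+1.

Lemma incr_lt f m n : incr f -> m < n -> f m < f n.
Proof.
move=> fi; elim: n => // n IH; rewrite ltnS leq_eqVlt => /orP [/eqP ->//|/IH h].
exact: ltn_trans h (fi n).
Qed.

Lemma incr_ge f n : incr f -> n <= f n.
Proof. by move=> fi; elim: n => // n IH; apply: leq_ltn_trans IH (fi n). Qed.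

Lemma incr_comp f g : incr f -> incr g -> incr (f \o g).
Proof. by move=> fi gi n; apply: incr_lt fi (gi n). Qed.

Definition unbounded_nat (P : nat -> Prop) := forall m, exists n, m <= n /\ P n.

Lemma unbounded_incr P : unbounded_nat P -> exists f, incr f /\ forall n, P (f n).
Proof.
move=> H; have [g gP] := choice H.
pose f := fix f n := if n is m.+1 then g (f m).+1 else g 0.
exists f; split; first by move=> n; exact: (gP (f n).+1).1.
by case=> [|n]; [exact: (gP 0).2|exact: (gP (f n).+1).2].
Qed.

(** The lists of stages met on a branch decrease strictly, newest first. Finitely many have a given
    head, so a threshold depending on the whole list is bounded in terms of its head. *)
Fixpoint declists n : list (list nat) :=
  if n is m.+1 then declists m ++ map (cons m) (declists m) else [:: [::]].

Lemma declistsP n h : sorted gtn h -> all (fun x => x < n) h -> h \in declists n.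
Proof.
elim: n h => [|n IH] [|x h] //=.
  by move=> _ _; rewrite mem_cat IH.
move=> xh /andP [xn hn]; rewrite mem_cat.
have h_lt : all (fun y => y < x) h.
  by have := order_path_min (fun a b c ab bc => ltn_trans bc ab) xh.
move: xn; rewrite ltnS leq_eqVlt => /orP [/eqP xn|xn].
  subst x; apply/orP; right; apply/mapP; exists h => //.
  by apply: IH; [exact: path_sorted xh|].
apply/orP; left; apply: IH => //=; rewrite xn /=.
by apply: sub_all h_lt => y yx; apply: ltn_trans yx xn.
Qed.

Lemma bound_declists (g : list nat -> nat) : exists M : nat -> nat,
  forall n h, sorted gtn h -> all (fun x => x <= n) h -> g h <= M n.
Proof.
exists (fun n => \max_(h <- declists n.+1) g h) => n h sh hn.
by apply: leq_bigmax_seq => //; apply: declistsP.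
Qed.

Section Prod.
Variables (X : topologicalType).
Variables (T : Type) (r : T -> T -> Prop) (str : strong r).
Let wor := strong_wo str.

Section Core.
Variables (W : set X) (br : bad_region W).
(* To be read as: [V] forces the [j]-th block of a sequence of ordinals to lie
   below the [j]-th block of the [t]-th function of a scale. *)
Variable Le : set X -> T -> nat -> Prop.
Hypothesis Le_her : forall V V' t j, po W V' -> V' `<=` V -> Le V t j -> Le V' t j.
Hypothesis Le_mono : forall s t, r s t -> exists m, forall j, m <= j ->
  forall V, po W V -> Le V s j -> Le V t j.
Hypothesis Le_bound : forall V, po W V -> exists t m, forall n, exists V',
  [/\ po W V', V' `<=` V & forall j, m <= j < n -> Le V' t j].
Hypothesis Le_dec : forall t V, po W V -> exists V' (L : nat -> bool),
  [/\ po W V', V' `<=` V & forall j, (L j -> Le V' t j) /\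
     (~~ L j -> forall V'', po W V'' -> V'' `<=` V' -> ~ Le V'' t j)].
Hypothesis Le_not : forall V t m, po W V -> exists j, m <= j /\ ~ Le V t j.

Definition nle V t j := forall V', po W V' -> V' `<=` V -> ~ Le V' t j.

Lemma nle_dense V t : po W V -> exists V' K, [/\ po W V', V' `<=` V, unbounded_nat K &
  forall j, K j \/ Le V' t j /\ ~ K j] /\ forall j, K j -> nle V' t j.
Proof.
move=> pV; have [V' [L [p' s' HL]]] := Le_dec t pV.
exists V', (fun j => ~~ L j); split; last by move=> j; exact: (HL j).2.
split=> //.
  move=> m; have [j [mj nj]] := Le_not t m p'; exists j; split=> //.
  by apply/negP => /(HL j).1.
move=> j; case: (boolP (L j)) => h; [right|left] => //.
by split; [exact: (HL j).1|].
Qed.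

Definition full V t (c : nat -> nat) n := forall j, c n <= j < c n.+1 -> Le V t j.

(* A point is coloured through the least [t] for which none of its neighbourhoods
   forbids [Le _ t] on almost all blocks of the interval partition [c]. *)
Lemma meager_case (c : nat -> nat) : incr c ->
  (forall V t f, po W V -> incr f -> exists n, ~ full V t c (f n)) -> False.
Proof.
move=> ci Hc.
have [t0] := strong_inh str.
have [S [Sst Sdis]] := solovay str.
pose Op t p := exists G m, [/\ po W G, G p & forall n V, m <= n -> po W V -> V `<=` G -> ~ full V t c n].
pose Lim p d := ~ Op d p /\ forall x, r x d -> Op x p.
have Lim_fun p d d' : Lim p d -> Lim p d' -> d = d'.
  move=> [n1 l1] [n2 l2]; case: (wo_tri wor d d') => // h.
    by case: n1; apply: l2.
  by case: n2; apply: l1.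
have [col colP] := limit_color Sdis Lim_fun.
have Op_mono s t p : r s t -> Op t p -> Op s p.
  move=> st [G [m [pG Gp HG]]]; have [m' m'P] := Le_mono st.
  exists G, (maxn m m'); split=> // n V; rewrite geq_max => /andP [mn m'n] pV VG Hf.
  apply: (HG n V mn pV VG) => j /andP [nj jn]; apply: m'P => //; last by apply: Hf; rewrite nj.
  by apply: leq_trans m'n _; apply: leq_trans nj; apply: incr_ge.
apply: (@bad_col _ _ br W col); first exact: poW.
move=> V0 pV0 _ k.
have step (q : set X * T) : exists z : (set X * set X) * nat * (T * nat), po W q.1 ->
   let: (V', Q, m, (t, mQ)) := z in
   [/\ [/\ po W V', closure V' `<=` q.1, po W Q & Q `<=` q.1], Q `&` V' = set0,
     (forall n V, m <= n -> po W V -> V `<=` V' -> ~ full V q.2 c n) &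
     forall n, exists V', [/\ po W V', V' `<=` Q & forall j, mQ <= j < n -> Le V' t j]].
  case: q => V t /=; have [pV|nV] := pselect (po W V); last by exists (V, V, 0, (t, 0)).
  have [V1 [V2 [p1 p2 s1 s2 d12]]] := po_split br pV.
  have [V3 [K [[p3 s3 _ HK] nK]]] := nle_dense t p1.
  have [s [mQ Hs]] := Le_bound p2.
  (* Otherwise infinitely many intervals contain no point of [K], and [V3] satisfies [Le _ t] on all
     of them, against [Hc]. *)
  have [m mP] : exists m, forall n V, m <= n -> po W V -> V `<=` V3 -> ~ full V t c n.
    apply: contrapT => /forallNP H.
    have inf : unbounded_nat (fun n => forall j, c n <= j < c n.+1 -> ~ K j).
      move=> m; have /existsNP [n /existsNP [V' /not_implyP [mn /not_implyP [p' /not_implyP [s' /contrapT Hf]]]]] := H m.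
      by exists n; split=> // j jn /nK /(_ V' p' s'); apply; apply: Hf.
    have [f [fi fP]] := unbounded_incr inf.
    have [n nn] := Hc V3 t f p3 fi; apply: nn => j jn.
    by case: (HK j) => [/(fP n j jn)|[]].
  exists (V3, V2, m, (s, mQ)); split=> //.
  - split=> //; last by move=> x /subset_closure /s2.
    exact: subset_trans (closureS s3) s1.
  - by rewrite -subset0 -d12 => x [? /s3].
have [st stP] := choice step.
pose Vs := fix Vs (l : list T) : set X := if l is x :: l' then (st (Vs l', x)).1.1.1 else V0.
have pVs l : po W (Vs l).
  elim: l => //= x l IH; have := stP (Vs l, x) IH.
  by case: (st _) => [[[V' Q] m] [t mQ]] [[]].
pose Phi (l : list T) := if l is x :: l' then (st (Vs l', x)).2.1 else t0.
have [d [Sd cd [eta [eta1 eta2]]]] := Sst k Phi.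
pose L := fix L n := if n is m.+1 then eta m :: L m else [::].
have belL n : below r d (L n) by elim: n => //= n IH; split.
pose V n := Vs (L n).
pose D n := st (V n, eta n).
pose Q n := (D n).1.1.2.
have dP n : [/\ [/\ po W (V n.+1), closure (V n.+1) `<=` V n, po W (Q n) & Q n `<=` V n],
   Q n `&` V n.+1 = set0,
     (forall i V', (D n).1.2 <= i -> po W V' -> V' `<=` V n.+1 -> ~ full V' (eta n) c i) &
     forall i, exists V', [/\ po W V', V' `<=` Q n & forall j, (D n).2.2 <= j < i -> Le V' (D n).2.1 j]].
  have := stP (Vs (L n), eta n) (pVs _); rewrite /Q /D /V /=.
  by case: (st _) => [[[V' Q'] m] [t mQ]].
have pV n : po W (V n) by apply: pVs.
have xd n : r (D n).2.1 d by exact: (cd (eta n :: L n) (conj (eta1 n) (belL n))).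
(* The off-branch piece satisfies [Le _ d] on an interval at least as far out as [n]; hence no
   neighbourhood of [p] forbids [d] on almost all intervals. *)
have HU n : exists U, [/\ po W U, U `<=` Q n & exists i, n <= i /\ full U d c i].
  have [m' m'P] := Le_mono (xd n).
  pose i := maxn n (maxn (D n).2.2 m').
  case: (dP n) => _ _ _ /(_ (c i.+1)) [U [pU UQ HU]]; exists U; split=> //.
  exists i; split; first exact: leq_maxl.
  move=> j /andP [ij ji].
  have ii : maxn (D n).2.2 m' <= j.
    by apply: leq_trans (leq_maxr n _) _; apply: leq_trans ij; apply: incr_ge.
  move: ii; rewrite geq_max => /andP [i1 i2]; apply: m'P => //; apply: HU; apply/andP; split=> //.
have [U UP] := choice HU.
have [||||p [Vp acc]] := realize br (O := U) pV.
- by move=> n; case: (dP n) => -[].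
- by move=> n; case: (UP n).
- by move=> n; case: (UP n) => _ h _ x /h; case: (dP n) => -[_ _ _ h'] _ _ _; apply: h'.
- move=> n x Ux Vx; case: (UP n) => _ h _; case: (dP n) => _ h' _ _.
  by have : set0 x by rewrite -h'; split=> //; apply: h.
exists p; split; first exact: (Vp 0).
apply: (colP p d k) => //; split.
- move=> [G [m [pG Gp HG]]]; have oG : open G by case: pG.
  have [n [mn GU]] := acc G oG Gp m; have [pU UQ [i [ni fi]]] := UP n.
  have pGU := po_meet pG (let: And3 h _ _ := pU in h) GU.
  apply: (HG i (G `&` U n) (leq_trans mn ni) pGU); first by move=> x [].
  by move=> j /fi; apply: Le_her => // x [].
- move=> x /eta2 [n xn]; apply: (Op_mono _ _ p xn).
  by exists (V n.+1), (D n).1.2; split=> //; case: (dP n).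
Qed.

(* Here the least [t] is taken for which no neighbourhood forbids [Le _ t] on
   infinitely many [j]. The stages of the branch are spread along an interval
   partition [c] growing faster than every threshold met on the way, and the
   pieces off the branch satisfy [Le _ d] on the intervals in between. *)
Lemma nonmeager_case :
  (forall V c, po W V -> incr c -> exists V' t f, [/\ po W V', V' `<=` V, incr f &
     forall n, full V' t c (f n)]) -> False.
Proof.
move=> Hc.
have [t0] := strong_inh str.
have [S [Sst Sdis]] := solovay str.
pose Op t p := exists G K, [/\ po W G, G p, unbounded_nat K & forall j, K j -> nle G t j].
pose Lim p d := ~ Op d p /\ forall x, r x d -> Op x p.
have Lim_fun p d d' : Lim p d -> Lim p d' -> d = d'.
  move=> [n1 l1] [n2 l2]; case: (wo_tri wor d d') => // h.
    by case: n1; apply: l2.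
  by case: n2; apply: l1.
have [col colP] := limit_color Sdis Lim_fun.
have Op_mono s t p : r s t -> Op t p -> Op s p.
  move=> st [G [K [pG Gp Ku HG]]]; have [m mP] := Le_mono st.
  exists G, (fun j => m <= j /\ K j); split=> //.
    move=> i; have [j [ij Kj]] := Ku (maxn i m); exists j.
    by move: ij; rewrite geq_max => /andP [].
  move=> j [mj Kj] V' p' s' h; apply: (HG j Kj V' p' s'); exact: mP.
apply: (@bad_col _ _ br W col); first exact: poW.
move=> V0 pV0 _ k.
have bd V : exists z : T * nat, po W V -> forall n, exists V',
    [/\ po W V', V' `<=` V & forall j, z.2 <= j < n -> Le V' z.1 j].
  have [pV|nV] := pselect (po W V); last by exists (t0, 0).
  by have [t [m H]] := Le_bound pV; exists (t, m).
have [xm xmP] := choice bd.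
have step (q : set X * (nat * T)) : exists z : set X * set X, po W q.1 ->
   [/\ [/\ po W z.1, closure z.1 `<=` q.1, po W z.2 & z.2 `<=` q.1], z.2 `&` z.1 = set0,
     (forall j, (xm q.1).2 <= j < q.2.1 -> Le z.1 (xm q.1).1 j) &
     exists K, unbounded_nat K /\ forall j, K j -> nle z.1 q.2.2 j].
  case: q => V [n t] /=; have [pV|nV] := pselect (po W V); last by exists (V, V).
  have [V4 [p4 s4 H4]] := xmP V pV n.
  have [V1 [V2 [p1 p2 s1 s2 d12]]] := po_split br p4.
  have [V3 [K [[p3 s3 Ku _] nK]]] := nle_dense t p1.
  exists (V3, V2); split=> /=.
  - split=> //; last by move=> x /subset_closure /s2 /s4.
    by apply: subset_trans s4; apply: subset_trans s1; apply: closureS.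
  - by rewrite -subset0 -d12 => x [? /s3].
  - by move=> j /H4; apply: Le_her => // x /s3 /subset_closure /s1.
  - by exists K.
have [st stP] := choice step.
pose Vs := fix Vs (l : list (nat * T)) : set X := if l is x :: l' then (st (Vs l', x)).1 else V0.
have pVs l : po W (Vs l).
  by elim: l => //= x l IH; have [[]] := stP (Vs l, x) IH.
pose Qs (l : list (nat * T)) : set X := if l is x :: l' then (st (Vs l', x)).2 else V0.
have pQs l : po W (Qs l).
  by case: l => //= x l; have [[]] := stP (Vs l, x) (pVs l).
have hitP0 (q : set X * (nat -> nat)) : exists z : set X * T * (nat -> nat), po W q.1 -> incr q.2 ->
    [/\ po W z.1.1, z.1.1 `<=` q.1, incr z.2 & forall n, full z.1.1 z.1.2 q.2 (z.2 n)].
  case: q => V c /=; have [pV|nV] := pselect (po W V); last by exists (V, t0, id).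
  have [ci|nc] := pselect (incr c); last by exists (V, t0, id).
  by have [V' [t [f [p' s' fi Hf]]]] := Hc V c pV ci; exists (V', t, f).
have [hit hitP] := choice hitP0.
(* The integer labels and the partition [c] are chosen only after [d], so [Phi] must serve all of
   them at once; they are at most continuum many. *)
have [Phi PhiP] : exists Phi : list T -> T, forall m, r (xm (Vs m)).1 (Phi (map snd m)) /\
    forall c, r (hit (Qs m, c)).1.2 (Phi (map snd m)).
  suff /choice [Phi PhiP] : forall l, exists b, forall m, map snd m = l -> r (xm (Vs m)).1 b /\
    forall c, r (hit (Qs m, c)).1.2 b.
    by exists Phi => m; apply: PhiP.
  move=> l; have Oc : le_card (list nat * (nat -> nat)) cont.
    apply: (le_card_prod le_nat_cont).
      exact: (le_card_trans (le_list_nat (le_card_refl _)) le_nat_cont).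
    exact: le_cont_fun (le_card_refl _) le_nat_cont.
  have [b bP] := strong_cont str Oc (fun q => (xm (Vs (zip q.1 l))).1).
  have [b' b'P] := strong_cont str Oc (fun q => (hit (Qs (zip q.1 l), q.2)).1.2).
  have [b2 [bb b'b]] := strong_gt2 str b b'.
  exists b2 => m ml; have e : m = zip (map fst m) l by rewrite -ml zip_unzip.
  rewrite e; split; first by apply: (wo_tr wor (bP (map fst m, id)) bb).
  by move=> c; apply: (wo_tr wor (b'P (map fst m, c)) b'b).
have [d [Sd cd [eta [eta1 eta2]]]] := Sst k Phi.
pose nd (h : list nat) := zip h (map eta (rev (iota 0 (size h)))).
have ndS n h : nd (n :: h) = (n, eta (size h)) :: nd h.
  rewrite /nd; have -> : rev (iota 0 (size (n :: h))) = size h :: rev (iota 0 (size h)).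
    by rewrite /= -{1}addn1 -[0 :: _]/(iota 0 (size h).+1) -addn1 iotaD rev_cat.
  by [].
have belnd h : below r d (map snd (nd h)).
  by elim: h => // n h IH; rewrite ndS /=; split.
have xd h : r (xm (Vs (nd h))).1 d by apply: (wo_tr wor (PhiP (nd h)).1); apply: cd.
have hd h c : r (hit (Qs (nd h), c)).1.2 d by apply: (wo_tr wor ((PhiP (nd h)).2 c)); apply: cd.
have [thr thrP] : exists thr : list nat -> nat, forall h,
   (xm (Vs (nd h))).2 <= thr h /\ forall j, thr h <= j -> forall V, po W V -> Le V (xm (Vs (nd h))).1 j -> Le V d j.
  suff /choice [thr H] : forall h, exists m, (xm (Vs (nd h))).2 <= m /\
    forall j, m <= j -> forall V, po W V -> Le V (xm (Vs (nd h))).1 j -> Le V d j by exists thr.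
  move=> h; have [m mP] := Le_mono (xd h); exists (maxn (xm (Vs (nd h))).2 m); split; first exact: leq_maxl.
  by move=> j; rewrite geq_max => /andP [_ mj]; apply: mP.
have [M MP] := bound_declists thr.
(* [c n.+1] exceeds the threshold of every decreasing list with entries at most [c n]; the successor
   makes [c] increasing. *)
pose c := fix c n := if n is m.+1 then (c m + M (c m)).+1 else 0.
have ci : incr c by move=> n; rewrite /= ltnS leq_addr.
have cM n h : sorted gtn (c n :: h) -> thr (c n :: h) <= c n.+1.
  move=> sh; apply: leq_trans (leqW (leq_addl _ _)); apply: MP => //=.
  rewrite leqnn /=.
  have := order_path_min (fun a b e ab be => ltn_trans be ab) sh.
  by apply: sub_all => y; apply: ltnW.
(* A state holds the list of stages, an increasing map [al] of the interval indices still allowed,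
   and the last index used. Each step thins [al] to indices of intervals on which the new off-branch
   piece is [full]. *)
pose S0 : list nat * (nat -> nat) * nat := ([::], id, 0).
pose nxt (s : list nat * (nat -> nat) * nat) :=
  let a := s.1.2 s.2.+1 in
  (c a :: s.1.1, s.1.2 \o (hit (Qs (nd (c a :: s.1.1)), c \o s.1.2)).2, a).
pose St n := iter n nxt S0.
pose h n := (St n).1.1.
pose al n := (St n).1.2.
pose a n := (St n.+1).2.
have hS n : h n.+1 = c (a n) :: h n by [].
have aE n : a n = al n (St n).2.+1 by [].
pose Q n := Qs (nd (h n.+1)).
have pQ n : po W (Q n) by apply: pQs.
have alS n : al n.+1 = al n \o (hit (Q n, c \o al n)).2 by [].
have ali n : incr (al n).
  elim: n => // n IH; rewrite alS; apply: incr_comp => //.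
  by have [] := hitP (Q n, c \o al n) (pQ n) (incr_comp ci IH).
pose z n := hit (Q n, c \o al n).
have zP n : [/\ po W (z n).1.1, (z n).1.1 `<=` Q n, incr (z n).2 &
    forall i, full (z n).1.1 (z n).1.2 (c \o al n) ((z n).2 i)].
  exact: (hitP (Q n, c \o al n) (pQ n) (incr_comp ci (ali n))).
have ai n : a n < a n.+1 by rewrite [a n.+1]aE; apply: incr_ge; apply: ali.
have al_range n m i : n <= m -> exists i', al m i = al n i'.
  move=> /subnK <-; elim: (m - n) i => [|q IH] i; first by exists i.
  by rewrite addSn alS /=; have [i' ->] := IH ((hit (Q (q + n), c \o al (q + n))).2 i); exists i'.
have sh n : sorted gtn (h n.+1).
  elim: n => // n IH; apply/andP; split; [exact: (incr_lt ci (ai n))|exact: IH].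
have thrh n : thr (h n.+1) <= c (a n).+1 by rewrite hS; apply: cM; rewrite -hS.
pose V n := Vs (nd (h n)).
have pV n : po W (V n) by apply: pVs.
have ndh n : nd (h n.+1) = (c (a n), eta (size (h n))) :: nd (h n) by rewrite hS ndS.
have dP n : [/\ [/\ po W (V n.+1), closure (V n.+1) `<=` V n, po W (Q n) & Q n `<=` V n], Q n `&` V n.+1 = set0,
     (forall j, thr (h n) <= j < c (a n) -> Le (V n.+1) d j) &
     exists K, unbounded_nat K /\ forall j, K j -> nle (V n.+1) (eta n) j].
  have szh : size (h n) = n by elim: (n) => // q IH; rewrite hS /= IH.
  have [h1 h2 h3 h4] := stP (V n, (c (a n), eta (size (h n)))) (pV n).
  have VE : V n.+1 = (st (V n, (c (a n), eta (size (h n))))).1 by rewrite /V ndh.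
  have QE : Q n = (st (V n, (c (a n), eta (size (h n))))).2 by rewrite /Q ndh.
  rewrite VE QE; split=> //; last by rewrite szh in h4 *.
  move=> j /andP [tj jc]; have [t1 t2] := thrP (h n).
  apply: t2 => //; first by case: h1.
  by apply: h3; rewrite /= jc andbT; apply: leq_trans tj.
have [||||p [Vp acc]] := realize br (O := fun n => (z n).1.1) pV.
- by move=> n; case: (dP n) => -[].
- by move=> n; case: (zP n).
- by move=> n; case: (zP n) => _ h1 _ _ x /h1; case: (dP n) => -[_ _ _ h'] _ _ _; apply: h'.
- move=> n x Ux Vx; case: (zP n) => _ h1 _ _; case: (dP n) => _ h' _ _.
  by have : set0 x by rewrite -h'; split=> //; apply: h1.
exists p; split; first exact: (Vp 0).
apply: (colP p d k) => //; split.
- move=> [G [K [pG Gp Ku HG]]]; have oG : open G by case: pG.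
  have [n [_ Gz]] := acc G oG Gp 0; have [pz zQ _ zf] := zP n.
  have pGz := po_meet pG (let: And3 h _ _ := pz in h) Gz.
  have [m3 m3P] := Le_mono (hd (h n.+1) (c \o al n)).
  have [j [jb Kj]] := Ku (maxn m3 (c (a n.+1))).
  move: jb; rewrite geq_max => /andP [m3j aj].
  (* [j] is located between consecutive stages. Past the threshold of [h i.+1], the condition
     [V i.+2] forces [Le _ d]; before it, [j] lies in an interval starting at [c (a i)] on which the
     piece of stage [n] is [full]. *)
  have [i [ni ij ji]] : exists i, [/\ n.+1 <= i, c (a i) <= j & j < c (a i.+1)].
    have ex : exists i, j < c (a i).
      exists j.+1; apply: leq_trans (incr_ge _ ci); apply: incr_ge => q; exact: ai.
    pose i := ex_minn ex.
    have [ji imin] : j < c (a i) /\ forall i', j < c (a i') -> i <= i'.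
      by rewrite /i; case: ex_minnP.
    have ni : n.+1 < i.
      rewrite ltnNge; apply/negP => le.
      have : c (a i) <= c (a n.+1).
        case: (ltngtP i n.+1) le => // [lt _|-> _ //].
        by apply: ltnW; apply: (incr_lt ci); apply: incr_lt lt.
      by move=> h1; have := leq_trans ji (leq_trans h1 aj); rewrite ltnn.
    exists i.-1; have iE : i = i.-1.+1 by rewrite prednK //; apply: leq_trans ni.
    split; [by rewrite -ltnS -iE| |by rewrite -iE].
    by rewrite leqNgt; apply/negP => /imin; rewrite {1}iE ltnn.
  have [tj|jt] := leqP (thr (h i.+1)) j.
    have m : (G `&` V i.+2) !=set0 by exists p.
    have pm := po_meet pG (let: And3 h _ _ := pV i.+2 in h) m.
    apply: (HG j Kj (G `&` V i.+2) pm); first by move=> x [].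
    case: (dP i.+1) => _ _ /(_ j) H _; have {}H : Le (V i.+2) d j by apply: H; rewrite tj.
    by apply: (Le_her pm _ H) => x [].
  have [i' ei'] : exists i', a i = al n ((z n).2 i').
    rewrite aE; have [i' ->] := al_range n.+1 i (St i).2.+1 ni.
    by exists i'; rewrite alS.
  apply: (HG j Kj (G `&` (z n).1.1) pGz); first by move=> x [].
  have L0 : Le (z n).1.1 (z n).1.2 j.
    apply: (zf i'); rewrite /= -ei' ij /=.
    apply: leq_trans (leq_trans jt (thrh i)) _.
    have lt : al n ((z n).2 i') < al n ((z n).2 i').+1 := ali n _.
    rewrite -ei' in lt; move: lt; rewrite leq_eqVlt => /orP [/eqP -> //|lt].
    by apply: ltnW; apply: (incr_lt ci).
  by apply: m3P => //; apply: (Le_her pGz _ L0) => x [].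
- move=> x /eta2 [n xn]; apply: (Op_mono _ _ p xn).
  have [_ _ _ [K [Ku HK]]] := dP n; by exists (V n.+1), K; split.
Qed.

End Core.

(** The case split follows Talagrand's criterion, read for the sets of [j] with [Le V t j]: a family
    of sets of integers closed under subsets and finite changes is meagre iff, for some interval
    partition, no member contains infinitely many intervals. *)
Lemma bound_or_color (W : set X) (br : bad_region W) (Le : set X -> T -> nat -> Prop) :
  (forall V V' t j, po W V' -> V' `<=` V -> Le V t j -> Le V' t j) ->
  (forall s t, r s t -> exists m, forall j, m <= j -> forall V, po W V -> Le V s j -> Le V t j) ->
  (forall V, po W V -> exists t m, forall n, exists V',
     [/\ po W V', V' `<=` V & forall j, m <= j < n -> Le V' t j]) ->
  (forall t V, po W V -> exists V' (L : nat -> bool),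
     [/\ po W V', V' `<=` V & forall j, (L j -> Le V' t j) /\
     (~~ L j -> forall V'', po W V'' -> V'' `<=` V' -> ~ Le V'' t j)]) ->
  forall V, po W V -> exists V', [/\ po W V', V' `<=` V & exists t m, forall j, m <= j -> Le V' t j].
Proof.
move=> Hher Hmono Hbound Hdec; apply: localize => // W' br' pW' nW'.
have pin V V' : po W V' -> po W' V -> V' `<=` V -> po W' V'.
  by move=> pV' pV s; apply: (po_in pV') => p /s; case: pV => _ _; apply.
have her W2 : po W W2 -> forall V V' t j, po W2 V' -> V' `<=` V -> Le V t j -> Le V' t j.
  by move=> p2 V V' t j pV'; apply: Hher; apply: po_le pV'.
have mono W2 : po W W2 -> forall s t, r s t -> exists m, forall j, m <= j ->
    forall V, po W2 V -> Le V s j -> Le V t j.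
  move=> p2 s t /Hmono [m mP]; exists m => j mj V pV; apply: mP => //; exact: po_le pV.
have bound W2 : po W W2 -> forall V, po W2 V -> exists t m, forall n, exists V',
     [/\ po W2 V', V' `<=` V & forall j, m <= j < n -> Le V' t j].
  move=> p2 V pV; have [t [m H]] := Hbound V (po_le p2 pV); exists t, m => n.
  have [V' [p' s' H']] := H n; exists V'; split=> //; apply: (po_in p') => p /s'.
  by case: pV => _ _; apply.
have dec W2 : po W W2 -> forall t V, po W2 V -> exists V' (L : nat -> bool),
     [/\ po W2 V', V' `<=` V & forall j, (L j -> Le V' t j) /\
     (~~ L j -> forall V'', po W2 V'' -> V'' `<=` V' -> ~ Le V'' t j)].
  move=> p2 t V pV; have [V' [L [p' s' H]]] := Hdec t V (po_le p2 pV).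
  exists V', L; split=> //; first by apply: (po_in p') => p /s'; case: pV => _ _; apply.
  move=> j; split; first exact: (H j).1.
  by move=> /(H j).2 Hn V'' p''; apply: Hn; apply: po_le p''.
have Lnot W2 : po W' W2 -> forall V t m, po W2 V -> exists j, m <= j /\ ~ Le V t j.
  move=> p2 V t m pV; apply: contrapT => /forallNP H; apply: (nW' V (po_le p2 pV)).
  by exists t, m => j mj; apply: contrapT => nl; apply: (H j).
have [Hc|/existsNP [V1 /existsNP [c /not_implyP [p1 /not_implyP [ci nc]]]]] := pselect (forall V c, po W' V -> incr c ->
    exists V' t f, [/\ po W' V', V' `<=` V, incr f & forall n, full Le V' t c (f n)]).
  exact: (@nonmeager_case W' br' Le (her _ pW') (mono _ pW') (bound _ pW') (dec _ pW') (Lnot _ (poW br')) Hc).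
have p1W := po_le pW' p1.
apply: (@meager_case V1 (bad_sub br' p1) Le (her _ p1W) (mono _ p1W) (bound _ p1W) (dec _ p1W) (Lnot _ p1) c ci).
move=> V t f pV fi; apply: contrapT => /forallNP H; apply: nc; exists V, t, f; split=> //.
- exact: po_le pV.
- by case: pV.
- by move=> n; apply: contrapT; apply: H.
Qed.

End Prod.

(** * Scales modulo an ideal *)

Record ideal (J : set nat -> Prop) : Prop := Ideal {
  ideal0 : J set0;
  idealS : forall A B, A `<=` B -> J B -> J A;
  idealU : forall A B, J A -> J B -> J (A `|` B) }.

(** Coordinates outside [W] are ignored: this is the ideal generated by [J] and the complement of
    [W]. *)
Definition trace (J : set nat -> Prop) (W A : set nat) := J (A `&` W).

Lemma trace_ideal J W : ideal J -> ideal (trace J W).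
Proof.
move=> [J0 JS JU]; split; rewrite /trace; first by rewrite set0I.
  by move=> A B AB; apply: JS => n [/AB].
by move=> A B JA JB; rewrite setIUl; apply: JU.
Qed.

Lemma le_set_nat : le_card (set nat) cont.
Proof.
exists (fun A n => `[< A n >]) => A B AB; apply: funext => n.
by apply/propext; exact: asbool_eq_equiv (congr1 (fun f => f n) AB).
Qed.

Section Scale.
Variables (D : nat -> Type) (r : forall n, D n -> D n -> Prop).
Hypothesis str : forall n, strong (@r n).
Let wor n := strong_wo (str n).
Local Notation P := (forall n, D n).

Definition lt_mod (J : set nat -> Prop) (f g : P) := J [set n | ~ r (f n) (g n)].

Definition bounded_families (J : set nat -> Prop) (S : Type) :=
  forall h : S -> P, exists g, forall s, lt_mod J (h s) g.

Lemma prod_inh : inhabited P.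
Proof. by constructor=> n; have /cid [] : exists x : D n, True by have [x] := strong_inh (str n); exists x. Qed.

Lemma prod_pick (Q : forall n, D n -> Prop) : (forall n, exists x, Q n x) ->
  exists g : P, forall n, Q n (g n).
Proof. by move=> H; exists (fun n => projT1 (cid (H n))) => n; case: cid. Qed.

Lemma bounded_cont S (h : S -> P) : le_card S cont ->
  exists g : P, forall s n, r (h s n) (g n).
Proof.
move=> Sc; have [g gP] := prod_pick (fun n => strong_cont (str n) Sc (fun s => h s n)).
by exists g.
Qed.

Section Ideal.
Variables (J : set nat -> Prop) (idJ : ideal J).

Lemma lt_mod_tr f g h : lt_mod J f g -> lt_mod J g h -> lt_mod J f h.
Proof.
move=> fg gh; apply: (idealS idJ _ (idealU idJ fg gh)) => n /= nfh.
apply: contrapT => /not_orP [/contrapT a /contrapT b]; apply: nfh.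
exact: (wo_tr (wor n) a b).
Qed.

Lemma lt_modW (f g : P) : (forall n, r (f n) (g n)) -> lt_mod J f g.
Proof.
move=> fg; apply: (idealS idJ _ (ideal0 idJ)) => n /= h; exact: h.
Qed.

Lemma bounded_le S S' : le_card S S' -> bounded_families J S' -> bounded_families J S.
Proof.
move=> [i iI] bS' h; have [g0] := prod_inh.
have [g gP] := bS' (fun s' => if pselect (exists s, i s = s') is left H
   then h (projT1 (cid H)) else g0).
exists g => s; have := gP (i s); case: pselect => [H|[]]; last by exists s.
by case: cid => s' /= /iI ->.
Qed.

Lemma bounded_leK T (t : T -> T -> Prop) x : bounded_families J (seg t x) ->
  forall h : T -> P, exists g, forall s, s = x \/ t s x -> lt_mod J (h s) g.
Proof.
move=> b h; have [g gP] := b (fun s => h (sval s)).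
have [g' g'P] := bounded_cont (fun a : bool => if a then g else h x) (le_card_trans le_bool_nat le_nat_cont).
exists g' => s [->|sx]; first by apply: lt_modW => n; apply: (g'P false).
apply: (lt_mod_tr (gP (exist _ s sx))); apply: lt_modW => n; exact: (g'P true).
Qed.

(** For least size the index order is regular, since bounds of fewer segments can be bounded again;
    it exceeds the continuum because each factor bounds continuum many values. *)
Lemma minimal_unbounded S : ~ bounded_families J S -> exists T (t : T -> T -> Prop),
  [/\ strong t, ~ bounded_families J T, forall x, bounded_families J (seg t x) & le_card T S].
Proof.
move=> nS; have [s wos] := wo_exists S.
suff [T [t [wot nT bT TS]]] : exists T (t : T -> T -> Prop),
  [/\ wo t, ~ bounded_families J T, forall x, bounded_families J (seg t x) & le_card T S].
  exists T, t; split=> //; apply: strong_intro => //.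
  - by move=> x Tx; apply: nT; apply: bounded_le Tx (bT x).
  - move=> x f; apply: contrapT => /forallNP H; apply: nT => h.
    have [k kP] := choice (fun y => bounded_leK (bT (f y)) h).
    have [g gP] := bT x k; exists g => z.
    have /existsNP [y nfy] := H z.
    apply: (lt_mod_tr (kP y z _) (gP y)).
    by case: (wo_nlt wot nfy) => [->|]; [left|right].
  - move=> Tc; apply: nT => h; have [g gP] := bounded_cont h Tc.
    by exists g => y; apply: lt_modW.
have [h|/forallNP h] := pselect (exists x, ~ bounded_families J (seg s x)); last first.
  by exists S, s; split=> //; [move=> x; apply: contrapT; apply: h|exact: le_card_refl].
have [x [nx xmin]] := wo_min wos h.
exists (seg s x), (fun y z => s (sval y) (sval z)); split=> //.
- by apply: (wo_pull wos) => y z; apply: sig_inj.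
- move=> [y yx]; have by_ : bounded_families J (seg s y).
    apply: contrapT => ny; case: (xmin y ny) => [e|xy].
      by subst y; exact: (wo_irr wos yx).
    exact: (wo_asym wos xy yx).
  apply: bounded_le by_.
  exists (fun z => exist (fun w => s w y) (sval (sval z)) (proj2_sig z)).
  by move=> [[a ax] ay] [[b bx] bY] /= [] e; subst b; apply: sig_inj; apply: sig_inj.
- exact: seg_le.
Qed.

Lemma increasing_family T (t : T -> T -> Prop) (f : T -> P) : wo t ->
  (forall x, bounded_families J (seg t x)) ->
  exists h : T -> P, (forall x y, t x y -> lt_mod J (h x) (h y)) /\
     forall x n, r (f x n) (h x n).
Proof.
move=> wot bT; have [g0] := prod_inh.
have [||h hP] := @wo_rec T t wot P g0 (fun x g k => (forall y, t y x -> lt_mod J (g y) k) /\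
    forall n, r (f x n) (k n)).
- move=> x g; have [k kP] := bT x (fun y => g (sval y)).
  have [k' k'P] := bounded_cont (fun a : bool => if a then k else f x) (le_card_trans le_bool_nat le_nat_cont).
  exists k'; split; last by move=> n; exact: (k'P false).
  move=> y yx; apply: (lt_mod_tr (kP (exist _ y yx))); apply: lt_modW => n; exact: (k'P true).
- by move=> x g g' k e [H1 H2]; split=> // y yx; rewrite -e //; apply: H1.
- by exists h; split=> [x y xy|x n]; [exact: (hP y).1|exact: (hP x).2].
Qed.

(* [A] is the value, for a [g] large enough modulo [J], of the set of coordinates
   on which the family eventually dominates [g]. *)
Lemma scale_core T (t : T -> T -> Prop) (h : T -> P) : strong t ->
  (forall x y, t x y -> lt_mod J (h x) (h y)) ->
  exists A g, (forall k, exists x, lt_mod (trace J A) k (h x)) /\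
    forall x, lt_mod (trace J (~` A)) (h x) g.
Proof.
move=> strt hi; have wot := strong_wo strt.
pose Y (g : P) x := [set n | r (g n) (h x n)].
pose st g A := forall b, exists x, t b x /\ Y g x = A.
have stex g : exists A, st g A.
  apply: contrapT => /forallNP H.
  have {}H A : exists b, forall x, Y g x = A -> ~ t b x.
    have /existsNP [b /forallNP Hb] := H A; exists b => x e bx; exact: (Hb x).
  have [b bP] := choice H.
  have [c cP] := strong_cont strt le_set_nat b.
  have [x cx] := strong_gt strt c.
  by apply: (bP (Y g x) x erefl); apply: (wo_tr wot (cP _) cx).
have Ymono g x y : t x y -> J (Y g x `\` Y g y).
  move=> /hi; apply: (idealS idJ) => n [/= gx ngy] hxy; apply: ngy.
  exact: (wo_tr (wor n) gx hxy).
have stJ g A x : st g A -> J (Y g x `\` A).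
  by move=> /(_ x) [y [xy <-]]; apply: Ymono.
have stmono g g' A A' : (forall n, r (g n) (g' n)) -> st g A -> st g' A' -> J (A' `\` A).
  move=> gg' sA sA'; have [t0] := strong_inh strt; have [x [_ <-]] := sA' t0.
  apply: (idealS idJ _ (stJ g A x sA)) => n [/= g'x nA]; split=> //.
  exact: (wo_tr (wor n) (gg' n) g'x).
(* For each candidate [A], [gA] is a function with a value not containing [A] modulo [J], if one
   exists. A [g] above all [gA] then has a value [A] that is contained, modulo [J], in the values of
   every function. *)
have H0 (A : set nat) : exists gA, (exists g B, st g B /\ ~ J (A `\` B)) ->
   exists B, st gA B /\ ~ J (A `\` B).
  have [[g [B HB]]|nH] := pselect (exists g B, st g B /\ ~ J (A `\` B)).
    by exists g => _; exists B.
  by have [g0] := prod_inh; exists g0.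
have [gA gAP] := choice H0.
have [g gP] := bounded_cont gA le_set_nat.
(* Off [A] the family is only weakly below [g]; passing to a larger function makes this strict. *)
have [g' g'P] := prod_pick (fun n => strong_gt (str n) (g n)).
have [A sA] := stex g.
exists A, g'; split=> [k|x].
  have [B sB] := stex k; have [t0] := strong_inh strt; have [x [_ eB]] := sB t0.
  exists x; have : J (A `\` B).
    apply: contrapT => nAB; have [|B' [sB' nB']] := gAP A; first by exists k, B.
    apply: nB'; exact: (stmono (gA A) g _ _ (gP A) sB' sA).
  apply: (idealS idJ) => n [/= nk An]; split=> //; by rewrite -eB.
apply: (idealS idJ _ (stJ g A x sA)) => n [/= nh nA]; split=> //.
rewrite /Y /=; apply: contrapT => /(wo_nlt (wor n)) h1; apply: nh.
by apply: (wo_le_lt (wor n) _ (g'P n)); case: h1 => [->|]; [left|right].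
Qed.

(* [E] is the union, modulo [J], of all the sets on which some [T]-indexed family is
   increasing and cofinal. *)
Lemma scale_extend T (t : T -> T -> Prop) : strong t ->
  (forall x, bounded_families J (seg t x)) ->
  exists E (h : T -> P), [/\ (forall x y, t x y -> lt_mod J (h x) (h y)),
    (forall k, exists x, lt_mod (trace J E) k (h x)) &
    bounded_families (trace J (~` E)) T].
Proof.
move=> strt bT; have wot := strong_wo strt.
pose sc (h : T -> P) A := (forall x y, t x y -> lt_mod J (h x) (h y)) /\
    (forall k, exists x, lt_mod (trace J A) k (h x)).
have [g0] := prod_inh.
have H0 A : exists h : T -> P, (exists h, sc h A) -> sc h A.
  have [[h hA]|n] := pselect (exists h, sc h A); first by exists h.
  by exists (fun=> g0).
have [hA hAP] := choice H0.
(* There are only continuum many sets [A], so a single [h] can lie above a chosen scale [hA A] for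
   each of them. *)
have [f fP] := choice (fun x => bounded_cont (fun A => hA A x) le_set_nat).
have [h [hi hf]] := increasing_family f wot bT.
have [E [g [Ec Eb]]] := scale_core strt hi.
exists E, h; split=> // k.
have [k' [k'i kk']] := increasing_family k wot bT.
have [A [g' [Ac Ab]]] := scale_core strt k'i.
have AE : J (A `\` E).
  have [|_ /(_ g) [x gx]] := hAP A; first by exists k'.
  apply: (idealS idJ _ (idealU idJ gx (Eb x))) => n [An nE] /=.
  have [gh|ngh] := pselect (r (g n) (hA A x n)); [right|by left].
  split=> // /(wo_asym (wor n)); apply.
  apply: (wo_tr (wor n) gh); exact: (wo_tr (wor n) (fP x A n) (hf x n)).
exists g' => x; apply: (idealS idJ _ (idealU idJ AE (Ab x))) => n [/= nk nE].
have [An|nA] := pselect (A n); [by left|right]; split=> // h1; apply: nk.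
exact: (wo_tr (wor n) (kk' x n) h1).
Qed.

End Ideal.

(** The family of all functions is unbounded on [W], since no function is below itself; an unbounded
    family of least size yields the scale. *)
Lemma scale_on J W : ideal J -> ~ J W ->
  exists (T : Type) (t : T -> T -> Prop) (h : T -> P) A,
   [/\ strong t, A `<=` W, ~ J A, (forall x y, t x y -> lt_mod (trace J A) (h x) (h y)) &
     forall k, exists x, lt_mod (trace J A) k (h x)].
Proof.
move=> idJ nW; have idW := trace_ideal W idJ.
have nP : ~ bounded_families (trace J W) P.
  move=> /(_ id) [g /(_ g) gg]; apply: nW; apply: (idealS idJ _ gg) => n Wn; split=> //.
  exact: wo_irr (wor n) _.
have [T [t [strt nT bT _]]] := minimal_unbounded idW nP; have wot := strong_wo strt.
have /existsNP [f /forallNP nf] := nT.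
have [h [hi fh]] := increasing_family idW f wot bT.
have [A [g [Ac Ab]]] := scale_core idW strt hi.
have sub B : trace J W B -> trace J (A `&` W) B.
  by apply: (idealS idJ) => n [Bn [_ Wn]].
exists T, t, h, (A `&` W); split=> //.
- move=> JA; apply: (nf g) => x.
  apply: (idealS idJ _ (idealU idJ JA (Ab x))) => n [/= nfg Wn].
  have [An|nA] := pselect (A n); [by left|right]; split=> //; split=> // h1; apply: nfg.
  exact: (wo_tr (wor n) (fh x n) h1).
- by move=> x y /hi; apply: sub.
- by move=> k; have [x kx] := Ac k; exists x; apply: (idealS idJ _ kx) => n [h1 [An Wn]].
Qed.

End Scale.

(** * Bounding names in a product of regular cardinals *)

Definition cellular_bound (X : topologicalType) (K0 : Type) :=
  forall S : set X -> Prop, (forall U, S U -> open U /\ U !=set0) ->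
    (forall U V, S U -> S V -> (U `&` V) !=set0 -> U = V) -> le_card {U | S U} K0.

Lemma max_antichain (X : topologicalType) (W : set X) (Q : set X -> Prop) :
  (forall V, po W V -> exists V', [/\ po W V', V' `<=` V & Q V']) ->
  exists S : set X -> Prop, [/\ forall V, S V -> po W V /\ Q V,
    forall V V', S V -> S V' -> (V `&` V') !=set0 -> V = V' &
    forall V, po W V -> exists V', S V' /\ (V `&` V') !=set0].
Proof.
move=> dQ; have [r wor] := wo_exists (set X).
have [||S SP] := @wo_rec _ r wor Prop True (fun V g s => s <->
  [/\ po W V, Q V & forall V', r V' V -> g V' -> ~ ((V `&` V') !=set0)]).
- by move=> V g; eexists; apply: iff_refl.
- move=> V g g' s e H; rewrite H; split=> -[p q h]; split=> // V' V'V; first by rewrite -e //; apply: h.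
  by rewrite e //; apply: h.
exists S; split=> [V /SP [] //|V V' SV SV' m|V pV].
- have [_ _ h] := iffLR (SP V) SV; have [_ _ h'] := iffLR (SP V') SV'.
  case: (wo_tri wor V V') => // l; first by case: (h' V l SV); rewrite setIC.
  by case: (h V' l SV').
- have [V1 [p1 s1 q1]] := dQ V pV.
  have [S1|nS1] := pselect (S V1).
    exists V1; split=> //; rewrite (_ : V `&` V1 = V1); first by case: p1.
    exact/setIidPr.
  have [V2 [S2 m2]] : exists V2, S V2 /\ (V1 `&` V2) !=set0.
    apply: contrapT => /forallNP H; apply: nS1; apply/SP; split=> // V' _ S' m.
    by apply: (H V').
  exists V2; split=> //; have [x [x1 x2]] := m2; exists x; split=> //; exact: s1.
Qed.

(** The name is the index of a member of a maximal antichain on which a witness is fixed. Witnesses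
    of any type are thereby coded within the cellularity bound; [None] is never a value. *)
Lemma choose_code (X : topologicalType) (W : set X) K0 (cell : cellular_bound X K0)
    (G : Type) (g0 : G) (Q : set X -> G -> Prop) :
  (forall V V' g, po W V' -> V' `<=` V -> Q V g -> Q V' g) ->
  (forall V, po W V -> exists V' g, [/\ po W V', V' `<=` V & Q V' g]) ->
  exists (N : name W (option K0)) (F : option K0 -> G), forall V b, po W V -> N V b ->
    b <> None /\ exists V', [/\ po W V', V' `<=` V & Q V' (F b)].
Proof.
move=> her dQ.
have [|S [SQ Sd Sm]] := @max_antichain X W (fun V => exists g, Q V g).
  by move=> V pV; have [V' [g [p s q]]] := dQ V pV; exists V'; split=> //; exists g.
have [|//|i iI] := cell S; first by move=> U /SQ [[]].
pose isc V b := exists U (h : S U), V `<=` U /\ b = Some (i (exist _ U h)).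
have H0 b : exists g, forall U (h : S U), b = Some (i (exist _ U h)) -> Q U g.
  have [[V [h e]]|n] := pselect (exists V (h : S V), b = Some (i (exist _ V h))).
    have [_ [g q]] := SQ V h; exists g => V' h' e'.
    by have [/iI []] := etrans (esym e) e' => <-.
  by exists g0 => V h e; case: n; exists V, h.
have [F FP] := choice H0.
have dn V : po W V -> exists V' b, [/\ po W V', V' `<=` V & isc V' b].
  move=> pV; have [U [SU m]] := Sm V pV.
  exists (V `&` U), (Some (i (exist _ U SU))); split=> //.
    exact: po_meet pV (let: And3 o _ _ := (SQ U SU).1 in o) m.
  by exists U, SU; split=> // x [].
have [|N NP] := @mk_name X W _ isc dn.
  move=> V V' b b' _ _ [U [h [VU ->]]] [U' [h' [VU' ->]]] [x [Vx Vx']].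
  have e : U = U' by apply: Sd => //; exists x; split; [exact: VU|exact: VU'].
  by subst U'; congr (Some (i _)); apply: sig_inj.
exists N, F => V b pV NV; have [V' [b' [p' s' iV]]] := dn V pV.
have e := frc_fun p' (frc_her p' s' NV) (NP _ _ p' iV); subst b'.
have [U [h [VU eb]]] := iV; split; first by rewrite eb.
by exists V'; split=> //; apply: (her U) => //; exact: FP eb.
Qed.

Lemma choose_name (X : topologicalType) (W : set X) (G : Type) (g0 : G) (Q : set X -> G -> Prop) :
  (forall V V' g, po W V' -> V' `<=` V -> Q V g -> Q V' g) ->
  (forall V, po W V -> exists V' g, [/\ po W V', V' `<=` V & Q V' g]) ->
  exists N : name W G, forall V g, po W V -> N V g ->
    exists V', [/\ po W V', V' `<=` V & Q V' g].
Proof.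
move=> her dQ; have cell : cellular_bound X (set X).
  by move=> S _ _; exists (fun x => sval x) => x y; apply: sig_inj.
have [N [F NF]] := choose_code cell g0 her dQ.
have [M MP] := name_map F N; exists M => V g pV MV.
have [V1 [b [p1 s1 N1]]] := frc_dense N pV.
have e := frc_fun p1 (frc_her p1 s1 MV) (MP _ _ p1 N1); subst g.
have [_ [V2 [p2 s2 q]]] := NF _ _ p1 N1; exists V2; split=> //; exact: subset_trans s1.
Qed.

Lemma few_values (X : topologicalType) (W : set X) K0 (cell : cellular_bound X K0)
    (G : Type) (g0 : G) (Q : set X -> G -> Prop) :
  (forall V V' g, po W V' -> V' `<=` V -> Q V g -> Q V' g) ->
  (forall V, po W V -> exists V' g, [/\ po W V', V' `<=` V & Q V' g]) ->
  exists F : K0 -> G, forall V, po W V -> exists V' k, [/\ po W V', V' `<=` V & Q V' (F k)].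
Proof.
move=> her dQ; have [N [F NF]] := choose_code cell g0 her dQ.
exists (F \o Some) => V pV; have [V1 [[k|] [p1 s1 N1]]] := frc_dense N pV; last first.
  by case: (NF _ _ p1 N1).
have [_ [V2 [p2 s2 q]]] := NF _ _ p1 N1; exists V2, k; split=> //; exact: subset_trans s1.
Qed.

Definition gen (E : nat -> set nat) (A : set nat) :=
  exists m, forall n, A n -> exists i, i < m /\ E i n.

Lemma gen_ideal E : ideal (gen E).
Proof.
split; first by exists 0.
  by move=> A B AB [m H]; exists m => n /AB /H.
move=> A B [m H] [m' H']; exists (maxn m m') => n [/H|/H'] [i [im Ei]]; exists i;
  by rewrite leq_max im ?orbT.
Qed.

Lemma gen_sub E E' A : (forall j, exists k, E j `<=` E' k) -> gen E A -> gen E' A.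
Proof.
move=> H [m Hm]; have [k kP] := choice H.
exists (\max_(j < m) k j).+1 => n /Hm [i [im Ei]]; exists (k i); split; last exact: kP.
by rewrite ltnS (leq_bigmax (Ordinal im)).
Qed.

Lemma bounded_sub (D : nat -> Type) (r : forall n, D n -> D n -> Prop) (J J' : set nat -> Prop) S :
  (forall A, J A -> J' A) -> bounded_families r J S -> bounded_families r J' S.
Proof. by move=> JJ b h; have [g gP] := b h; exists g => s; apply: JJ; apply: gP. Qed.

Section Bnd.
Variables (X : topologicalType) (W : set X) (br : bad_region W).
Variables (D : nat -> Type) (r : forall n, D n -> D n -> Prop).
Hypothesis str : forall n, strong (@r n).
Let wor n := strong_wo (str n).
Local Notation P := (forall n, D n).

Definition flt n (a : name W (D n)) V x := forall V' y, po W V' -> V' `<=` V -> a V' y -> r y x.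

Definition good (A : set nat) := forall (a : forall n, name W (D n)) V, po W V ->
  exists V' (g : P), [/\ po W V', V' `<=` V & forall n, A n -> flt (a n) V' (g n)].

Lemma flt_her n (a : name W (D n)) V V' x : V' `<=` V -> flt a V x -> flt a V' x.
Proof. by move=> s H V2 y p2 s2; apply: H => //; apply: subset_trans s. Qed.

Lemma flt_le n (a : name W (D n)) V x y : flt a V x -> r x y -> flt a V y.
Proof. by move=> H xy V' z p s az; apply: (wo_tr (wor n) (H V' z p s az)). Qed.

Lemma good_sub A B : A `<=` B -> good B -> good A.
Proof.
move=> AB gB a V pV; have [V' [g [p s H]]] := gB a V pV; exists V', g; split=> // n /AB; exact: H.
Qed.

Lemma good_union A B : good A -> good B -> good (A `|` B).
Proof.
move=> gA gB a V pV; have [V1 [g1 [p1 s1 H1]]] := gA a V pV.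
have [V2 [g2 [p2 s2 H2]]] := gB a V1 p1.
exists V2, (fun n => if pselect (A n) is left _ then g1 n else g2 n); split=> //.
  exact: subset_trans s1.
move=> n ABn; case: pselect => [An|nA]; first by apply: (flt_her s2); apply: H1.
by case: ABn => // /H2.
Qed.

Lemma good_set0 : good set0.
Proof. by move=> a V pV; have [g] := prod_inh str; exists V, g; split. Qed.

Lemma good_set1 m : good [set m].
Proof.
move=> a V pV; have [V' [x [p s ax]]] := frc_dense (a m) pV; have [g0] := prod_inh str.
have [g gP] : exists g : P, forall n, n = m -> flt (a n) V' (g n).
  apply: (@prod_pick D (fun n x => n = m -> flt (a n) V' x)) => n; have [e|ne] := pselect (n = m); last by exists (g0 n).
  subst m; have [y xy] := strong_gt (str n) x; exists y => _ V2 z p2 s2 az.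
  by rewrite (frc_fun p2 az (frc_her p2 s2 ax)).
by exists V', g; split=> // n /= e; apply: gP.
Qed.

Lemma good_gen E A : (forall i, good (E i)) -> gen E A -> good A.
Proof.
move=> gE [m H]; apply: (good_sub H) => {A H}; elim: m => [|m IH].
  by apply: good_sub good_set0 => n [i []].
apply: good_sub (good_union IH (gE m)) => n [i []]; rewrite ltnS leq_eqVlt => /orP [/eqP ->|im Ei]; first by right.
by left; exists i.
Qed.

Lemma decide_lt (a : forall n, name W (D n)) (g : P) V : po W V ->
  exists V' (f : nat -> bool), [/\ po W V', V' `<=` V & forall n, (f n -> flt (a n) V' (g n)) /\
    (~~ f n -> forall V'', po W V'' -> V'' `<=` V' -> ~ flt (a n) V'' (g n))].
Proof.
move=> pV.
pose b n := sval (name_map (fun y => `[< r y (g n) >]) (a n)).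
have bP n : forall V y, po W V -> a n V y -> b n V `[< r y (g n) >].
  exact: (proj2_sig (name_map (fun y => `[< r y (g n) >]) (a n))).
have [V' [p s [f fP]]] := decide_real br b (le_card_trans le_bool_nat le_nat_cont) pV.
exists V', f; split=> // n; split=> fn.
  move=> V2 y p2 s2 ay; apply/asboolP.
  by rewrite (frc_fun p2 (bP n _ _ p2 ay) (frc_her p2 s2 (fP n))).
move=> V2 p2 s2 H; have [V3 [y [p3 s3 ay]]] := frc_dense (a n) p2.
have := frc_fun p3 (bP n _ _ p3 ay) (frc_her p3 (subset_trans s3 s2) (fP n)).
by move/asboolP: (H V3 y p3 s3 ay) => -> ft; move: fn; rewrite -ft.
Qed.

(** Coordinates are grouped into blocks by the first [E j] containing them. A set in [gen E] meets
    only blocks below some [m], so the scale is increasing and cofinal in the blockwise sense of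
    [bound_or_color]. *)
Lemma good_scale E A T (t : T -> T -> Prop) (h : T -> P) :
  (forall i, good (E i)) -> (forall n, exists i, E i n) -> strong t ->
  (forall x y, t x y -> lt_mod r (trace (gen E) A) (h x) (h y)) ->
  (forall k, exists x, lt_mod r (trace (gen E) A) k (h x)) -> good A.
Proof.
move=> gE cE strt hi hc a V0 pV0.
pose blk j n := E j n /\ forall i, i < j -> ~ E i n.
have blkex n : exists j, blk j n.
  have ex : exists j, `[< E j n >] by have [i Ei] := cE n; exists i; apply/asboolP.
  exists (ex_minn ex); case: ex_minnP => m /asboolP Em mm; split=> // i im Ei.
  by move: im; rewrite ltnNge mm //; apply/asboolP.
pose Le V x j := forall n, A n -> blk j n -> flt (a n) V (h x n).
have ltE (k k' : P) m : (forall n, [set n | ~ r (k n) (k' n)] n /\ A n -> exists i, i < m /\ E i n) ->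
    forall j n, m <= j -> A n -> blk j n -> r (k n) (k' n).
  move=> H j n mj An [_ nb]; apply: contrapT => nk.
  have [i [im]] := H n (conj nk An); apply: nb; exact: leq_trans mj.
have [||||V' [p' s' [x [m HL]]]] := @bound_or_color X T t strt W br Le _ _ _ _ V0 pV0.
- by move=> V V' x j _ s H n An bn; apply: (flt_her s); apply: H.
- move=> x y /hi [m Hm]; exists m => j mj V _ H n An bn; apply: (flt_le (H n An bn)).
  exact: (ltE (h x) (h y) m Hm j n).
- move=> V pV.
  have Hm m : exists q : set X * P, [/\ po W q.1, q.1 `<=` V &
     forall n, (exists i, i < m /\ E i n) -> flt (a n) q.1 (q.2 n)].
    have [|V' [g [p s H]]] := @good_gen E (fun n => exists i, i < m /\ E i n) gE _ a V pV.
      by exists m.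
    by exists (V', g).
  have [q qP] := choice Hm.
  have [g gP] := bounded_cont str (fun m => (q m).2) le_nat_cont.
  have [x [m Hx]] := hc g; exists x, m => n; have [p s H] := qP n.
  exists (q n).1; split=> // j /andP [mj jn] n' An' bn'.
  apply: (flt_le (H n' _)); first by exists j; split=> //; case: bn'.
  by apply: (wo_tr (wor n') (gP n n')); apply: (ltE g (h x) m Hx j n').
- move=> x V pV; have [V' [f [p s H]]] := decide_lt a (h x) pV.
  exists V', (fun j => `[< forall n, A n -> blk j n -> f n >]); split=> // j; split.
    by move=> /asboolP Hf n An bn; apply: (H n).1; apply: Hf.
  move=> /asboolPn /existsNP [n /not_implyP [An /not_implyP [bn /negP fn]]] V'' p'' s'' HL.
  by apply: ((H n).2 fn V'' p'' s''); apply: HL.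
have [|V2 [g [p2 s2 Hg]]] := @good_gen E (fun n => exists i, i < m /\ E i n) gE _ a V' p'.
  by exists m.
exists V2, (fun n => if pselect (exists i, i < m /\ E i n) is left _ then g n else h x n).
split=> //; first exact: subset_trans s'.
move=> n An; case: pselect => [ex|nex]; first exact: Hg.
apply: (flt_her s2); have [j bj] := blkex n; apply: (HL j) => //.
rewrite leqNgt; apply/negP => jm; apply: nex; exists j; split=> //; by case: bj.
Qed.

(* The ideal [gen E] of good sets bounds all families of size [K0]: a least size
   of an unbounded family would yield a scale on a set outside the ideal, which is
   good by [good_scale], and adding it makes families of that size bounded. *)
Theorem prod_bound K0 : countably_many_cardinals K0 -> le_card cont K0 ->
  cellular_bound X K0 -> good setT.
Proof.
move=> [G GP] cK cell a V0 pV0.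
have [g0] := prod_inh str.
(* For each cardinality [G i], a sequence of good sets bounding families of that size is fixed, if
   there is one. Merging these sequences with all singletons gives an ideal that bounds every such
   size. *)
have H0 i : exists E : nat -> set nat, (forall j, good (E j)) /\
   ((exists E, (forall j, good (E j)) /\ bounded_families r (gen E) (G i)) -> bounded_families r (gen E) (G i)).
  have [[E [gE bE]]|n] := pselect (exists E, (forall j, good (E j)) /\ bounded_families r (gen E) (G i)).
    by exists E.
  by exists (fun=> set0); split=> // _; apply: good_set0.
have [Ei EiP] := choice H0.
pose E n := match @unpickle (nat * nat + nat)%type n with
  | Some (inl q) => Ei q.1 q.2 | Some (inr m) => [set m] | None => set0 end.
have gE n : good (E n).
  rewrite /E; case: unpickle => [[q|m]|]; [exact: (EiP _).1|exact: good_set1|exact: good_set0].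
have cE n : exists i, E i n.
  by exists (pickle (inr n : nat * nat + nat)%type); rewrite /E pickleK.
have EiE i A : gen (Ei i) A -> gen E A.
  apply: gen_sub => j; exists (pickle (inl (i, j) : nat * nat + nat)%type).
  by rewrite /E pickleK.
have idE := gen_ideal E.
have BK : bounded_families r (gen E) K0.
  apply: contrapT => nB.
  have [T [t [strt nT bT TK]]] := minimal_unbounded str idE nB.
  have cT : le_card cont T.
    case: (le_card_total cont T) => // Tc.
    by have [b /(_ b) /(wo_irr (strong_wo strt))] := strong_cont strt Tc id.
  have [i [Ti iT]] := GP T cT TK.
  have [A [h [hi hc hb]]] := scale_extend str idE strt bT.
  have gA : good A.
    apply: (@good_scale E A T t h) => // x y /hi; apply: (idealS idE) => n [] //.
  apply: nT; apply: (bounded_le str (S' := G i)) => //.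
  apply: (bounded_sub (EiE i)); apply: (EiP i).2.
  exists (fun n => if n is m.+1 then E m else A); split; first by case.
  apply: (@bounded_sub D r (trace (gen E) (~` A))); last exact: (bounded_le str (S' := T)).
  move=> B [m H]; exists m.+1 => n Bn.
  have [An|nA] := pselect (A n); first by exists 0.
  by have [j [jm Ej]] := H n (conj Bn nA); exists j.+1.
have H1 A : exists F : K0 -> P, good A -> forall V, po W V -> exists V' k,
    [/\ po W V', V' `<=` V & forall n, A n -> flt (a n) V' (F k n)].
  have [gA|nA] := pselect (good A); last by exists (fun=> g0).
  have [||F FP] := @few_values X W K0 cell P g0 (fun V g => forall n, A n -> flt (a n) V (g n)).
  - by move=> V V' g _ s H n An; apply: (flt_her s); apply: H.
  - by move=> V pV; have [V' [g [p s H]]] := gA a V pV; exists V', g.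
  by exists F.
have [F FP] := choice H1.
have inf : le_card nat K0 := le_card_trans le_nat_cont cK.
have cardI : le_card (set nat * K0) K0.
  apply: (le_card_prod inf); last exact: le_card_refl.
  exact: le_card_trans le_set_nat cK.
(* [g] exceeds, modulo the ideal, all candidate bounds on all good sets. If the coordinates where
   [a n] is not below [g] were outside the ideal, a good part of them would carry a forced bound
   that lies below [g] somewhere. *)
have [g gP] := bounded_le str cardI BK (fun q => F q.1 q.2).
have [V1 [f [p1 s1 H]]] := decide_lt a g pV0.
have [JW|nJW] := pselect (gen E [set n | ~~ f n]).
  have [V2 [g2 [p2 s2 H2]]] := good_gen gE JW a p1.
  exists V2, (fun n => if f n then g n else g2 n); split=> //; first exact: subset_trans s1.
  move=> n _; case: ifP => fn; last by apply: H2; rewrite /= fn.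
  by apply: (flt_her s2); apply: (H n).1.
exfalso; have [T [t [h [A [strt AW nA hi hc]]]]] := scale_on str idE nJW.
have gA : good A by apply: (@good_scale E A T t h).
have [V2 [k [p2 s2 H2]]] := FP A gA V1 p1.
have [n [An kn]] : exists n, A n /\ r (F A k n) (g n).
  apply: contrapT => /forallNP H3; apply: nA.
  by apply: (idealS idE _ (gP (A, k))) => n An /= h'; apply: (H3 n).
apply: ((H n).2 (AW n An) V2 p2 s2); apply: (flt_le (H2 n An) kn).
Qed.

End Bnd.

(** * Walks on ordinals *)

Section Walk.
Variables (K0 T : Type) (r : T -> T -> Prop).
Hypotheses (KG : countably_many_cardinals K0) (wor : wo r) (TK : le_card T K0).

(** The ways to descend from a bound, matching [seg_cases], with injections and ladders to be chosen
    once and for all. *)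
Inductive kind := Small of T -> cont | Shrink of T & T -> T | Ladder of nat -> T | Regular.

Definition kind_ok t k := match k with
  | Small c => forall x y, r x t -> r y t -> c x = c y -> x = y
  | Shrink s e => [/\ r s t, forall x, r x t -> r (e x) s &
      forall x y, r x t -> r y t -> e x = e y -> x = y]
  | Ladder eta => (forall n, r (eta n) t) /\ forall x, r x t -> exists n, r x (eta n)
  | Regular => strong (fun x y : seg r t => r (sval x) (sval y)) /\
      forall s, r s t -> ~ le_card (seg r t) (seg r s) end.

Lemma kind_ex t : exists k, kind_ok t k.
Proof.
have tK : le_card (seg r t) K0 := le_card_trans (seg_le r t) TK.
have [[s [st [e eI]]]|/forallNP ns] := pselect (exists s, r s t /\ le_card (seg r t) (seg r s)).
  exists (Shrink s (fun x => if pselect (r x t) is left h then sval (e (exist _ x h)) else s)).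
  split=> // [x xt|x y xt yt].
    by case: pselect => // h; exact: (proj2_sig (e _)).
  by case: pselect => // h; case: pselect => // h' /sig_inj /eI [].
have [[c cI]|[s h]|[eta h]|h] := seg_cases KG wor tK.
- exists (Small (fun x => if pselect (r x t) is left h then c (exist _ x h) else fun=> true)) => x y xt yt.
  by case: pselect => // h; case: pselect => // h' /cI [].
- by case: (ns s).
- by exists (Ladder eta).
- by exists Regular; split=> // s st h'; apply: (ns s).
Qed.

Definition kd := projT1 (choice kind_ex).
Lemma kdP t : kind_ok t (kd t). Proof. exact: (projT2 (choice kind_ex)). Qed.

(** Regular bounds are cardinals above the continuum, hence of distinct sizes, and only countably
    many sizes are available. *)
Lemma regular_countable : le_card {t | kd t = Regular} nat.
Proof.
have [G GP] := KG.
have H (t : {t | kd t = Regular}) : exists n, le_card (seg r (sval t)) (G n) /\ le_card (G n) (seg r (sval t)).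
  case: t => t /= e; have := kdP t; rewrite e => -[str _].
  apply: GP; last exact: le_card_trans (seg_le r t) TK.
  case: (le_card_total cont (seg r t)) => // h.
  by have [b /(_ b) /(wo_irr (strong_wo str))] := strong_cont str h id.
have [f fP] := choice H; exists f => s t e; apply: sig_inj.
have [s1 s2] := fP s; have [t1 t2] := fP t; rewrite e in s1 s2.
have := kdP (sval s); rewrite (proj2_sig s) => -[_ ns].
have := kdP (sval t); rewrite (proj2_sig t) => -[_ nt].
case: (wo_tri wor (sval s) (sval t)) => // l.
  by case: (nt _ l); apply: le_card_trans t1 s2.
by case: (ns _ l); apply: le_card_trans s1 t2.
Qed.

(** [Done] records the rungs taken and the final real; [Need s v] says that the walk has reached [v]
    at the regular bound [s] with no function left; [Fail] marks a step that would not descend or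
    would lose the ordinal. *)
Inductive outcome := Done of list nat & cont | Need of T & T | Fail.

Definition push n o := if o is Done p c then Done (n :: p) c else o.

Definition rung (eta : nat -> T) x : nat :=
  if pselect (exists n, r x (eta n)) is left h then projT1 (cid h) else 0.

Lemma rungP eta x : (exists n, r x (eta n)) -> r x (eta (rung eta x)).
Proof. by rewrite /rung; case: pselect => // h _; case: cid. Qed.

(* The walk of an ordinal [y] below [t] descends to ever smaller bounds; at a
   regular bound the next one is supplied by the next function of the list. *)
Definition step (t : T) (f : T -> list (T -> T) -> T -> outcome) l y := match kd t with
  | Small c => Done [::] (c y)
  | Shrink s e => if pselect (r s t) then f s l (e y) else Fail
  | Ladder eta => if pselect (r (eta (rung eta y)) t)
      then push (rung eta y) (f (eta (rung eta y)) l y) else Fail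
  | Regular => if l is g :: l' then
      if pselect (r (g t) t /\ r y (g t)) then f (g t) l' y else Fail
      else Need t y end.

Lemma walk_ex : exists f, forall t, f t = step t f.
Proof.
apply: (wo_rec wor (A := list (T -> T) -> T -> outcome) (fun _ _ => Fail) (P := fun t f x => x = step t f)).
  by move=> t g; exists (step t g).
move=> t g g' x e ->; apply: funext => l; apply: funext => y; rewrite /step.
case: (kd t) => // [s h|eta|].
- by case: pselect => //= st; rewrite e.
- by case: pselect => //= st; rewrite e.
- by case: l => // h l; case: pselect => //= -[st _]; rewrite e.
Qed.

Definition walk := projT1 (cid walk_ex).
Lemma walkE t : walk t = step t walk. Proof. by rewrite /walk; case: cid. Qed.

Lemma walk_inj t l x y p c : r x t -> r y t ->
  walk t l x = Done p c -> walk t l y = Done p c -> x = y.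
Proof.
move: t l x y p c; apply: (wo_ind wor) => t IH l x y p c xt yt; rewrite walkE /step.
have := kdP t; case: (kd t) => /= [f fI|s e [st es eI]|eta [et ec]|[_ _]].
- by move=> [_ <-] [_ /esym]; apply: fI.
- case: pselect => //= _ h1 h2; apply: eI => //.
  exact: (IH s st l (e x) (e y) p c (es x xt) (es y yt) h1 h2).
- case: pselect => //= _; case: pselect => //= _.
  have xe := rungP (ec x xt); have ye := rungP (ec y yt).
  case Ex: (walk _ l x) => [px cx||] //= [e1 e2].
  case Ey: (walk _ l y) => [py cy||] //= [e3 e4].
  move: e3; rewrite -e1 => -[er ep]; move: ye Ey; rewrite er => ye Ey.
  apply: (IH _ (et _) l x y px cx xe ye Ex); rewrite Ey; congr Done => //.
  by rewrite e2 e4.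
- case: l => // g l; case: pselect => //= -[gt xg]; case: pselect => //= -[_ yg].
  exact: (IH _ gt l x y p c xg yg).
Qed.

Lemma walk_need t l y s v : r y t -> walk t l y = Need s v -> kd s = Regular /\ r v s.
Proof.
move: t l y; apply: (wo_ind wor) => t IH l y yt; rewrite walkE /step.
have := kdP t; move Ek: (kd t) => kt; case: kt Ek => [f|s' e|eta|] Ek /= => [_|[st es eI]|[et ec]|_] //.
- by case: pselect => //= _; apply: IH => //; apply: es.
- case: pselect => //= _; have ye := rungP (ec y yt).
  case Ey: (walk _ l y) => [||] //= -[e1 e2]; subst.
  by apply: (IH _ (et _) l y ye).
- case: l => [[<- <-]|g l] //; case: pselect => //= -[gt yg].
  exact: IH.
Qed.

(** Bounds decrease at every step, so finitely many functions suffice; [G k] has to help only the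
    walk that stopped after the first [k] functions. *)
Lemma walk_done t y (G : nat -> T -> T) : r y t ->
  (forall k s v, walk t (map G (iota 0 k)) y = Need s v -> r (G k s) s /\ r v (G k s)) ->
  exists k p c, walk t (map G (iota 0 k)) y = Done p c.
Proof.
move: t y G; apply: (wo_ind wor) => t IH y G yt HG.
have := kdP t; move Ek: (kd t) => kt; case: kt Ek => [f|s' e|eta|] Ek /= => [_|[st es eI]|[et ec]|_] //.
- by exists 0, [::], (f y); rewrite walkE /step Ek.
- have E k : walk t (map G (iota 0 k)) y = walk s' (map G (iota 0 k)) (e y).
    by rewrite (walkE t) /step Ek; case: pselect.
  have [|k [p [c Ew]]] := IH s' st (e y) G (es y yt).
    by move=> k s v; rewrite -E; apply: HG.
  by exists k, p, c; rewrite E.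
- have ye := rungP (ec y yt).
  have E k : walk t (map G (iota 0 k)) y = push (rung eta y) (walk (eta (rung eta y)) (map G (iota 0 k)) y).
    by rewrite (walkE t) /step Ek; case: pselect => // n; case: n.
  have [|k [p [c Ew]]] := IH _ (et (rung eta y)) y G ye.
    by move=> k s v Ew; apply: HG; rewrite E Ew.
  by exists k, (rung eta y :: p), c; rewrite E Ew.
- have [gt yg] : r (G 0 t) t /\ r y (G 0 t) by apply: HG; rewrite walkE /step Ek.
  have E k : walk t (map G (iota 0 k.+1)) y = walk (G 0 t) (map (G \o succn) (iota 0 k)) y.
    rewrite (walkE t) /step Ek /=; case: pselect => [_|[]] //=.
    by congr walk; rewrite map_comp -[1]addn0 iotaDl -map_comp.
  have [|k [p [c Ew]]] := IH _ gt y (G \o succn) yg.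
    by move=> k s v; rewrite -E; apply: HG.
  by exists k.+1, p, c; rewrite E.
Qed.

End Walk.

Arguments Regular {T}.
Arguments Done {T}.

(** * Deciding sequences of ordinals *)

Section Cover.
Variables (O : Type) (ro : O -> O -> Prop) (o1 : omega1 ro).
Variables (X : topologicalType) (W : set X) (br : bad_region W).
Variables (K0 : Type) (KG : countably_many_cardinals K0) (cK : le_card cont K0).
Variable cell : cellular_bound X K0.
Variables (r0 : K0 -> K0 -> Prop) (wor0 : wo r0).
Let T := option K0.
Let r : T -> T -> Prop := with_top r0.
Let wor : wo r := wo_top wor0.
Let TK : le_card T K0 := option_le (le_card_trans le_nat_cont cK).
Variable a : nat -> name W K0.
Let wk gs y := walk KG wor TK None gs (Some y).

Fixpoint forced (H : O -> name W T * (T -> (T -> T))) (V : set X) js gs : Prop :=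
  match js, gs with
  | [::], [::] => True
  | j :: js', g :: gs' => (exists b, (H j).1 V b /\ (H j).2 b = g) /\ forced H V js' gs'
  | _, _ => False end.

Lemma forced_her H V V' js gs : po W V' -> V' `<=` V -> forced H V js gs -> forced H V' js gs.
Proof.
move=> p s; elim: js gs => [|j js IH] [|g gs] //= [[b [h e]] /IH hs]; split=> //.
by exists b; split=> //; apply: frc_her s h.
Qed.

Lemma forced_ext H H' V i js gs : (forall j, ro j i -> H j = H' j) -> below ro i js ->
  forced H V js gs -> forced H' V js gs.
Proof.
move=> e; elim: js gs => [|j js IH] [|g gs] //= [ji /IH bl] [h /bl hs]; split=> //.
by rewrite -e.
Qed.

Lemma forced_dense H js V : po W V -> exists V' gs, [/\ po W V', V' `<=` V & forced H V' js gs].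
Proof.
elim: js V => [|j js IH] V pV; first by exists V, [::]; split.
have [V1 [b [p1 s1 h1]]] := frc_dense (H j).1 pV.
have [V2 [gs [p2 s2 h2]]] := IH V1 p1.
exists V2, ((H j).2 b :: gs); split=> //; first exact: subset_trans s1.
by split=> //; exists b; split=> //; apply: frc_her s2 h1.
Qed.

Lemma forced_fun H js gs gs' V : po W V -> forced H V js gs -> forced H V js gs' -> gs = gs'.
Proof.
move=> pV; elim: js gs gs' => [|j js IH] [|g gs] [|g' gs'] //= [[b [h e]] hs] [[b' [h' e']] hs'].
by rewrite -e -e' (frc_fun pV h h') (IH _ _ hs hs').
Qed.

(** All finite lists [js] below [i] are allowed, because it is not known in advance which guides
    will be decided. *)
Definition bounds_walks H i V (g : T -> T) := forall js m y gs s v,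
  below ro i js -> forced H V js gs -> a m V y -> wk gs y = Need s v -> r (g s) s /\ r v (g s).

Lemma bounds_dense H i V0 : po W V0 -> exists V1 g, [/\ po W V1, V1 `<=` V0 &
  forall V, po W V -> V `<=` V1 -> bounds_walks H i V g].
Proof.
move=> pV0.
have [[t0]|nR] := pselect (inhabited {t | kd KG wor TK t = Regular}); last first.
  exists V0, id; split; [exact: pV0|exact: subset_refl|].
  move=> V _ _ js m y gs s v _ _ _ e; have [//|ks _] := walk_need _ e.
  by case: nR; exists; exists s.
have [rho rhoS] := surj_le_card t0 (regular_countable KG wor TK).
pose rn n := sval (rho n).
pose rD n := fun x y : seg r (rn n) => r (sval x) (sval y).
have str n : strong (@rD n).
  have := kdP KG wor TK (rn n); rewrite (proj2_sig (rho n)) => -[h _]; exact: h.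
have d0 n : seg r (rn n) by have /cid [] : exists x : seg r (rn n), True by have [x] := strong_inh (str n); exists x.
have In : le_card (list (seg ro i) * nat) nat.
  apply: (le_card_prod (le_card_refl _)); last exact: le_card_refl.
  apply: le_list_nat; exact: o1_seg o1 i.
(* The ordinal at which the guided walk stops at the regular bound [rn n], or the default [d0 n] if
   it does not stop there. *)
pose dec (q : list (seg ro i) * nat) n V (b : seg r (rn n)) := exists y gs,
  [/\ forced H V (map (fun j => sval j) q.1) gs, a q.2 V y &
    wk gs y = Need (rn n) (sval b) \/ (~ exists v, wk gs y = Need (rn n) v) /\ b = d0 n].
have nm q n : { N : name W (seg r (rn n)) | forall V b, po W V -> dec q n V b -> N V b }.
  apply: mk_name.
    move=> V pV; have [V1 [gs [p1 s1 h1]]] := forced_dense H (map (fun j => sval j) q.1) pV.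
    have [V2 [y [p2 s2 h2]]] := frc_dense (a q.2) p1.
    have h3 := forced_her p2 s2 h1.
    have [[v e]|nv] := pselect (exists v, wk gs y = Need (rn n) v).
      have vr : r v (rn n) by have [//|] := walk_need _ e.
      exists V2, (exist _ v vr); split=> //; first exact: subset_trans s1.
      by exists y, gs; split=> //; left.
    exists V2, (d0 n); split=> //; first exact: subset_trans s1.
    by exists y, gs; split=> //; right.
  move=> V V' b b' pV pV' [y [gs [h1 h2 h3]]] [y' [gs' [h1' h2' h3']]] m.
  have pm := po_meet pV (let: And3 o _ _ := pV' in o) m.
  have e1 : gs = gs' by apply: (forced_fun pm (forced_her pm _ h1) (forced_her pm _ h1')) => x [].
  have e2 : y = y' by apply: (frc_meet pV pV' h2 h2' m).
  subst gs' y'; case: h3 h3' => [e|[ne ->]] [e'|[ne' ->]] //.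
  - by apply: sig_inj; move: e; rewrite e' => -[].
  - by case: ne'; eexists; exact: e.
  - by case: ne; eexists; exact: e'.
pose nb n q := sval (nm q n).
(* For each [n] the countably many stopping points have a name of a common bound; [prod_bound] then
   bounds these names for all [n] together. *)
have be n : exists N : name W (seg r (rn n)), forall V b, po W V -> N V b ->
    exists V', [/\ po W V', V' `<=` V & forall q V'' c, po W V'' -> V'' `<=` V' -> nb n q V'' c -> @rD n c b].
  apply: (choose_name (d0 n) (Q := fun V b => forall q V'' c, po W V'' -> V'' `<=` V -> nb n q V'' c -> @rD n c b)).
    by move=> V V' b _ s h q V'' c p' s'; apply: h => //; apply: subset_trans s.
  move=> V pV; have [V' [p s [b h]]] := bound_countable br (nb n) (str n) In pV.
  by exists V', b.
pose beta n := projT1 (cid (be n)).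
have betaP n V b : po W V -> beta n V b ->
    exists V', [/\ po W V', V' `<=` V & forall q V'' c, po W V'' -> V'' `<=` V' -> nb n q V'' c -> @rD n c b].
  by rewrite /beta; case: cid => N h; apply: h.
have [V1 [g [p1 s1 h1]]] := prod_bound br str KG cK cell beta pV0.
pose idx s := if pselect (exists n, rn n = s) is left h then projT1 (cid h) else 0.
have idxP s : (exists n, rn n = s) -> rn (idx s) = s by rewrite /idx; case: pselect => // h _; case: cid.
exists V1, (fun s => sval (g (idx s))); split=> // V pV VV1 js m y gs s v bl fg ay ws.
have [//|ks vs] := walk_need _ ws.
have es : rn (idx s) = s.
  by apply: idxP; have [n en] := rhoS (exist _ s ks); exists n; rewrite /rn en.
split; first by rewrite -[X in r _ X]es; exact: (proj2_sig (g (idx s))).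
have [js' ejs] : exists js' : list (seg ro i), map (fun j => sval j) js' = js.
  elim: js bl {fg} => [|j js IH] /=; first by exists [::].
  by move=> [ji /IH [js' <-]]; exists (exist _ j ji :: js').
move: (idx s) es => n es; subst s.
have nbv : nb n (js', m) V (exist _ v vs).
  apply: (proj2_sig (nm (js', m) n)) => //; exists y, gs; split=> //=; first by rewrite ejs.
  by left.
have [V2 [b [p2 s2 hb]]] := frc_dense (beta n) pV.
have [V3 [p3 s3 h3]] := betaP n V2 b p2 hb.
have s3V : V3 `<=` V := subset_trans s3 s2.
have vb := h3 (js', m) V3 _ p3 (@subset_refl _ _) (frc_her p3 s3V nbv).
apply: (wo_tr wor vb); apply: (h1 n I V2) => //; exact: subset_trans VV1.
Qed.

(** Guides are passed through [choose_code] so that [(H i).1] names an ordinal below [None], the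
    form required by [decide_uncountable]. *)
Lemma bounding_names : exists H : O -> name W T * (T -> (T -> T)), forall i V b,
  po W V -> (H i).1 V b -> b <> None /\ bounds_walks H i V ((H i).2 b).
Proof.
have [cn _] := const_name W (None : T).
have [||H HP] := @wo_rec O ro (o1_wo o1) _ (cn, fun=> id) (fun i H x => forall V b,
  po W V -> x.1 V b -> b <> None /\ bounds_walks H i V (x.2 b)).
- move=> i H; have [||N [F NF]] := @choose_code X W K0 cell (T -> T) id
    (fun V g => forall V', po W V' -> V' `<=` V -> bounds_walks H i V' g).
  + by move=> V V' g _ s h V2 p2 s2; apply: h => //; apply: subset_trans s.
  + by move=> V pV; apply: bounds_dense.
  exists (N, F) => V b pV NV; have [nb [V' [p s h]]] := NF V b pV NV; split=> //.
  move=> js m y gs s' v bl fg ay; apply: (h V' p (@subset_refl _ _) js m) => //.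
    exact: forced_her fg.
  exact: frc_her ay.
- move=> i H H' x e h V b pV xb; have [nb hb] := h V b pV xb; split=> // js m y gs s v bl fg.
  have fg' : forced H V js gs by apply: (forced_ext _ bl fg) => j ji; rewrite e.
  exact: (hb js m y gs s v bl fg').
- by exists H.
Qed.

(* Every name of a sequence is decided: the values are recovered from the finite
   walks guided by a ground [omega]-sequence of the names [H i], and those walks
   are coded by reals. *)
Theorem decide_nat V0 : po W V0 -> exists V, [/\ po W V, V `<=` V0 & decided a V].
Proof.
move=> pV0; have [H HP] := bounding_names.
have TsK : le_card (seg r None) K0 := le_card_trans (seg_le r None) TK.
have unbO (o : O) : exists i, True /\ ro o i.
  by have [i oi] := o1_bound o1 le_unit_nat (fun=> o); exists i; split=> //; exact: oi tt.
have top i V b : True -> po W V -> V `<=` V0 -> (H i).1 V b -> r b None.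
  by move=> _ pV _ h; have [] := HP i V b pV h; case: b {h}.
have [V1 [I [p1 s1 _ Iu [f fP]]]] :=
  decide_uncountable o1 br KG wor TsK (e := fun i => (H i).1) unbO pV0 top.
have [nx nxP] := choice Iu.
have [o0] := o1_inh o1.
pose ik n := iter n.+1 nx o0.
have ikI n : I (ik n) by exact: (nxP _).1.
have ikS n : ro (ik n) (ik n.+1) by exact: (nxP _).2.
have iklt m n : m < n -> ro (ik m) (ik n).
  elim: n => // n IH; rewrite ltnS leq_eqVlt => /orP [/eqP -> //|/IH h].
  exact: (wo_tr (o1_wo o1) h).
pose G k := (H (ik k)).2 (f (ik k)).
have ok m V y : po W V -> V `<=` V1 -> a m V y -> forall k s v,
    wk (map G (iota 0 k)) y = Need s v -> r (G k s) s /\ r v (G k s).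
  move=> pV VV1 ay k s v.
  have hf j : (H (ik j)).1 V (f (ik j)) by apply: (frc_her pV VV1); apply: fP.
  have [_ hb] := HP (ik k) V _ pV (hf k).
  apply: (hb (map ik (iota 0 k)) m) => //.
    have : forall j, j \in iota 0 k -> j < k by move=> j; rewrite mem_iota.
    elim: (iota 0 k) => //= j l IH h; split; first by apply: iklt; apply: h; rewrite inE eqxx.
    by apply: IH => j' j'l; apply: h; rewrite inE j'l orbT.
  by elim: (iota 0 k) => //= j l IH; split=> //; exists (f (ik j)).
(* The code is the record of a completed walk with the number of guides used. By [walk_inj] it
   determines the ordinal, and there are only continuum many codes. *)
pose succ y q := wk (map G (iota 0 q.1)) y = Done q.2.1 q.2.2.
pose code y : option (nat * (list nat * cont)) :=
  if pselect (exists q, succ y q) is left h then Some (projT1 (cid h)) else None.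
have codeI m V y y' : po W V -> V `<=` V1 -> a m V y -> code y' = code y -> y' = y.
  move=> pV VV1 ay; have [//|k [p [c e]]] := @walk_done K0 T r KG wor TK None (Some y) G _ (ok m V y pV VV1 ay).
  rewrite /code; case: (pselect (exists q, succ y q)) => [h'|[]]; last by exists (k, (p, c)).
  case: pselect => // h.
  case: cid => q /= s; case: cid => q' /= s' [e']; subst q'.
  by case: (@walk_inj K0 T r KG wor TK None _ (Some y') (Some y) _ _ Logic.I Logic.I s s').
pose b m := sval (name_map code (a m)).
have bP n : forall V y, po W V -> a n V y -> b n V (code y).
  exact: (proj2_sig (name_map code (a n))).
have codeC : le_card (option (nat * (list nat * cont))) cont.
  have h : le_card (nat * (list nat * cont)) cont.
    apply: (le_card_prod le_nat_cont le_nat_cont); apply: (le_card_prod le_nat_cont); last exact: le_card_refl.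
    exact: le_card_trans (le_list_nat (le_card_refl _)) le_nat_cont.
  by have [i iI] := h; apply: le_card_trans (option_le le_nat_cont); exists (fun x => if x is Some z then Some (i z) else None) => -[x|] [y|] //= [] /iI ->.
have [V2 [p2 s2 [g gP]]] := decide_real br b codeC p1.
exists V2; split=> //; first exact: subset_trans s1.
suff /choice [y yP] : forall m, exists y, a m V2 y by exists y.
move=> m; have [V3 [y [p3 s3 ay]]] := frc_dense (a m) p2; exists y.
apply: (name_map_inv (bP m) p2).
  move=> V4 y' p4 s4 ay' e; apply: esym.
  by apply: (codeI m V4 y' y p4 _ ay' (esym e)); apply: subset_trans s2.
by rewrite (frc_fun p3 (bP m _ _ p3 ay) (frc_her p3 s3 (gP m))); exact: gP.
Qed.

End Cover.

(** * Trees of regular height *)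

(** [t] is the least length of a cofinal family [f]; recursion makes it strictly increasing while
    keeping [c a] at least [f a]. *)
Lemma cofinal_regular K (rk : K -> K -> Prop) : wo rk ->
  exists A (ra : A -> A -> Prop) (c : A -> K), [/\ wo ra,
    forall a b, ra a b -> rk (c a) (c b), forall k, exists a, leK rk k (c a) &
    forall a, bounding ra (seg ra a)].
Proof.
move=> wok; pose r := with_top rk; have wor : wo r := wo_top wok.
have NK (x : seg r None) : exists k, sval x = Some k by case: x => -[k|] //= _; exists k.
have [|t [[f fc] tmin]] := @wo_min _ _ wor (fun t => exists f : seg r t -> K, forall k, exists a, leK rk k (f a)).
  exists None; have [f fP] := choice NK; exists f => k.
  exists (exist (fun x => r x None) (Some k) Logic.I); left.
  by have := fP (exist (fun x => r x None) (Some k) Logic.I) => /= -[].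
pose ra (a b : seg r t) := r (sval a) (sval b).
have woa : wo ra by apply: (wo_pull wor) => a b; apply: sig_inj.
have nle k l : ~ leK rk k l -> rk l k.
  by case: (leK_total wok k l).
have bnd a (g : seg ra a -> K) : exists k, forall s, rk (g s) k.
  apply: contrapT => /forallNP H.
  have e (s : seg r (sval a)) : r (sval s) t := wo_tr wor (proj2_sig s) (proj2_sig a).
  case: (tmin (sval a)) => [|e'|ta].
  - exists (fun s => g (exist (fun b => ra b a) (exist _ (sval s) (e s)) (proj2_sig s))) => k.
    have /existsNP [[[s st] sa] ns] := H k; exists (exist _ s sa) => /=.
    have -> : e (exist _ s sa) = st by exact: Prop_irrelevance.
    by case: (leK_total wok k (g (exist _ (exist _ s st) sa))).
  - by apply: (wo_irr wor (x := t)); rewrite -{1}e'; exact: (proj2_sig a).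
  - exact: (wo_asym wor ta (proj2_sig a)).
have [[a0]|nA] := pselect (inhabited (seg r t)); last first.
  exists (seg r t), ra, f; split=> // [a|a]; by case: nA.
have [||c cP] := @wo_rec _ ra woa K (f a0) (fun a g k => (forall b, ra b a -> rk (g b) k) /\ leK rk (f a) k).
- move=> a g; have [k kP] := bnd a (fun s => g (sval s)).
  case: (leK_total wok (f a) k) => h.
    by exists k; split=> // b ba; exact: (kP (exist _ b ba)).
  exists (f a); split; last by left.
  by move=> b ba; apply: (wo_tr wok (kP (exist _ b ba)) h).
- by move=> a g g' k e [H1 H2]; split=> // b ba; rewrite -e //; apply: H1.
have cm a b : ra a b -> rk (c a) (c b) by move=> ab; exact: (cP b).1.
have cc k : exists a, leK rk k (c a).
  have [a ka] := fc k; exists a; exact: (leK_trans wok ka (cP a).2).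
exists (seg r t), ra, c; split=> // a g.
have [k kP] := bnd a (c \o g); have [b kb] := cc k; exists b => s.
case: (wo_tri woa (g s) b) => // [e|/cm l].
  have := kP s; rewrite /= e => h; case: kb => [e'|h']; first by rewrite e' in h; case: (wo_irr wok h).
  by case: (wo_asym wok h h').
have h := wo_tr wok l (kP s); case: kb => [e'|h']; first by rewrite e' in h; case: (wo_irr wok h).
by case: (wo_asym wok h h').
Qed.

Lemma regular_init A (ra : A -> A -> Prop) : wo ra -> (forall a, bounding ra (seg ra a)) -> init ra.
Proof.
move=> woa reg a Aa; have [f fS] := surj_le_card a Aa.
have [b bP] := reg a f; have [s e] := fS b; move: (bP s); rewrite e; exact: wo_irr.
Qed.

Section Small.
Variables (X : topologicalType) (W : set X) (br : bad_region W).
Variables (K : Type) (rk : K -> K -> Prop) (wok : wo rk) (kk : K).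
Variables (B : Type) (b0 : B) (x : K -> name W B).
Hypothesis segdec : forall k V, po W V -> exists V' f,
  [/\ po W V', V' `<=` V & forall z, leK rk z k -> x z V' (f z)].
Hypothesis undec : forall V, po W V -> ~ exists f, forall k, x k V (f k).
Hypotheses (Kc : le_card K cont) (Kunc : bounding rk nat).
Variables (K0 T : Type) (r : T -> T -> Prop).
Hypotheses (KG : countably_many_cardinals K0) (wor : wo r) (TK : le_card T K0).

(* Cofinally many restrictions of [x] to initial segments have codes below [t],
   where [F k b] is the restriction to the segment up to [k] with code [b]. *)
Definition coded (F : K -> T -> K -> B) V t := forall V' k0, po W V' -> V' `<=` V ->
  exists V'' k b, [/\ po W V'', V'' `<=` V', leK rk k0 k, r b t &
    forall z, leK rk z k -> x z V'' (F k b z)].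

Lemma uncoded F V s : ~ coded F V s -> exists V' k0, [/\ po W V', V' `<=` V &
  forall V'' k b, po W V'' -> V'' `<=` V' -> leK rk k0 k -> r b s ->
    ~ forall z, leK rk z k -> x z V'' (F k b z)].
Proof.
move=> /existsNP [V' /existsNP [k0 /not_implyP [p' /not_implyP [s' H]]]].
exists V', k0; split=> // V'' k b p'' s'' k0k bs Hx; apply: H.
by exists V'', k, b.
Qed.

Lemma small_case F t : coded F W t ->
  (forall s F' V, r s t -> po W V -> ~ coded F' V s) -> False.
Proof.
move=> HC Hmin.
have pW V : po W V -> V `<=` W by case.
have [tc|[s [st [e eI]]]|[eta [et ec]]|str] := seg_cases KG wor (le_card_trans (seg_le r t) TK).
- apply: (tree_bernstein br wok (b0 := b0) segdec undec (Q := fun q => exists b, r b t /\ q.2 = cut rk b0 q.1 (F q.1 b))).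
    apply: (@le_card_trans _ (K * seg r t)); last exact: (le_card_prod le_nat_cont Kc tc).
    have [g gP] := choice (fun q : {q : K * (K -> B) | exists b, r b t /\ q.2 = cut rk b0 q.1 (F q.1 b)} => proj2_sig q).
    exists (fun q => ((sval q).1, exist (fun b => r b t) (g q) (gP q).1)) => q q' [e1 e2].
    apply: sig_inj; have := (gP q).2; have := (gP q').2; rewrite -e1 -e2 => <-.
    by move: e1; case: (sval q) => ? ? /=; case: (sval q') => ? ? /= -> ->.
  move=> V k0 pV; have [V' [k [b [p s k0k bt H]]]] := HC V k0 pV (pW V pV).
  by exists V', k, (F k b); split=> //; exists b.
(* The injection moves the codes below [s], against the minimality of [t]. *)
- pose F' k b' := if pselect (exists b, sval (e b) = b') is left h
    then F k (sval (projT1 (cid h))) else F k t.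
  have F'E k b : F' k (sval (e b)) = F k (sval b).
    rewrite /F'; case: pselect => [h|[]]; last by exists b.
    by case: cid => b' /= /sig_inj /eI ->.
  apply: (Hmin s F' W st (poW br)) => V k0 pV sV.
  have [V' [k [b [p' s' k0k bt H]]]] := HC V k0 pV sV.
  exists V', k, (sval (e (exist _ b bt))); split=> //; first exact: (proj2_sig (e _)).
  by rewrite F'E.
(* For each [n] some index is named past which no code below [eta n] occurs. These indices can be
   decided and, by [Kunc], bounded by [km]; but a segment beyond [km] has a code below some
   [eta n]. *)
- pose Q n V k0 := forall V'' k b, po W V'' -> V'' `<=` V -> leK rk k0 k -> r b (eta n) ->
    ~ forall z, leK rk z k -> x z V'' (F k b z).
  have nm n : exists N : name W K, forall V k, po W V -> N V k -> exists V', [/\ po W V', V' `<=` V & Q n V' k].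
    apply: (choose_name kk).
      by move=> V V' k _ s h V2 k2 b p2 s2; apply: h => //; apply: subset_trans s.
    move=> V pV; have [V' [k0 [p s H]]] := uncoded (Hmin (eta n) F V (et n) pV).
    by exists V', k0.
  have [N NP] := choice nm.
  have [V1 [p1 s1 [kn knP]]] := decide_real br N Kc (poW br).
  have [km kmP] := Kunc kn.
  have [V2 [k [b [p2 s2 kmk bt H]]]] := HC V1 km p1 s1.
  have [n bn] := ec b bt.
  have [V3 [p3 s3 q3]] := NP n V2 (kn n) p2 (frc_her p2 s2 (knP n)).
  apply: (q3 V3 k b p3 (@subset_refl _ _) _ bn).
    exact: (leK_trans wok (or_intror (kmP n)) kmk).
  by move=> z zk; apply: (frc_her p3 s3); apply: H.
- have [t0] := strong_inh str.
  (* [fam k f k'] codes the part of [f] up to [k'], and [E] lies above all these codes. By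
     minimality of [t], codes of long parts are not below a given [s], so [E] tends to the top as
     [tree_liminf] requires. *)
  pose fam k f k' : seg r t := if pselect (leK rk k' k /\ exists b : seg r t, forall z, leK rk z k' -> f z = F k' (sval b) z)
    is left h then projT1 (cid (proj2 h)) else t0.
  have [E EP] := choice (fun q : K * (K -> B) => strong_cont str Kc (fam q.1 q.2)).
  apply: (tree_liminf br wok (b0 := b0) segdec undec (e := fun k f => E (k, f)) str) => V s pV.
  have [V1 [j [p1 s1 H1]]] := uncoded (Hmin (sval s) F V (proj2_sig s) pV).
  have [V2 [k1 [b [p2 s2 jk bt H2]]]] := HC V1 j p1 (pW _ p1).
  exists V2, k1; split=> //; first exact: subset_trans s1.
  move=> k V3 f k1k p3 s3 H3 _ Es.
  have := EP (k, f) k1; rewrite /fam /=; case: pselect => [h|[]].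
    case: cid => b' /= Hb' b'E; apply: (H1 V3 k1 (sval b') p3 _ jk).
    - exact: subset_trans s2.
    - exact: (wo_tr wor b'E Es).
    - by move=> z zk; rewrite -Hb' //; apply: H3; apply: (leK_trans wok zk k1k).
  split=> //; exists (exist _ b bt) => z zk /=.
  apply: (frc_fun p3 (H3 z (leK_trans wok zk k1k))).
  by apply: (frc_her p3 s3); apply: H2.
Qed.

End Small.

Section NoBad.
Variables (O : Type) (ro : O -> O -> Prop) (o1 : omega1 ro).
Variables (X : topologicalType).
Variables (K0 : Type) (KG : countably_many_cardinals K0) (cK : le_card cont K0).
Variable cell : cellular_bound X K0.

(** For countable [A] the values are coded by ordinals and [decide_nat] decides them; beyond the
    continuum the index itself is the ordinal fed to [tree_liminf]; in between, [small_case] refutes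
    a least bound on codes of segments. *)
Lemma no_undecided_regular (W : set X) (br : bad_region W) A (ra : A -> A -> Prop) (woa : wo ra)
    (B : Type) (b0 : B) (y : A -> name W B) :
  (forall a, bounding ra (seg ra a)) ->
  (forall a V, po W V -> exists V' f, [/\ po W V', V' `<=` V & forall z, leK ra z a -> y z V' (f z)]) ->
  (forall V, po W V -> ~ decided y V) -> False.
Proof.
move=> reg segdec undec.
have [[a0]|nA] := pselect (inhabited A); last first.
  by apply: (undec W (poW br)); exists (fun=> b0) => a; case: nA.
have [r0 wor0] := wo_exists K0; have [k00 _] := cK.
have k0 : K0 := k00 (fun=> true).
have inf := le_card_trans le_nat_cont cK.
have dns a V : po W V -> exists V' b, [/\ po W V', V' `<=` V & y a V' b].
  by apply: frc_dense.
have [An|nAn] := pselect (le_card A nat).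
  have [rho rhoS] := surj_le_card a0 An.
  have code n : exists (N : name W (option K0)) (F : option K0 -> B), forall V b, po W V -> N V b ->
      b <> None /\ exists V', [/\ po W V', V' `<=` V & y (rho n) V' (F b)].
    apply: (choose_code cell b0); last by move=> V; exact: frc_dense.
    by move=> V V' b; apply: frc_her.
  have [N NP] := choice code; have [F FP] := choice NP.
  pose d (o : option K0) := odflt k0 o.
  pose M n := sval (name_map d (N n)).
  have MP n : forall V b, po W V -> N n V b -> M n V (d b) by exact: (proj2_sig (name_map d (N n))).
  have [V [pV _ [f fP]]] := decide_nat o1 br KG cK cell wor0 M (poW br).
  apply: (undec V pV).
  suff /choice [g gP] : forall a, exists b, y a V b by exists g.
  move=> a; have [n <-] := rhoS a; exists (F n (Some (f n))).
  apply: frc_reg => // V' b pV' V'V yb.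
  have [V1 [o [p1 s1 No]]] := frc_dense (N n) pV'.
  have := frc_fun p1 (MP n _ _ p1 No) (frc_her p1 (subset_trans s1 V'V) (fP n)).
  have [no [V2 [p2 s2 yo]]] := FP n V1 o p1 No.
  case: o no yo {No} => [k _ yo|[]//]; rewrite /d /= => e; subst k.
  exact: (frc_fun p2 (frc_her p2 (subset_trans s2 s1) yb) yo).
have [Ac|nAc] := pselect (le_card A cont); last first.
  have str : strong ra by apply: strong_intro => //; exact: regular_init.
  apply: (tree_liminf br woa (b0 := b0) segdec undec (e := fun a _ => a) str) => V a pV.
  exists V, a; split; [exact: pV|exact: subset_refl|].
  by move=> k _ _ [->|ak] _ _ _ _; [exact: wo_irr|exact: wo_asym].
have Aunc : bounding ra nat.
  case: (card_dich nat woa) => // -[a na]; apply: (bounding_le _ na (reg a)); exact: (inhabits a0).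
pose r := with_top r0.
have wor : wo r := wo_top wor0.
have TK : le_card (option K0) K0 := option_le inf.
have code a : exists (N : name W (option K0)) (F : option K0 -> A -> B), forall V b, po W V -> N V b ->
      b <> None /\ exists V', [/\ po W V', V' `<=` V & forall z, leK ra z a -> y z V' (F b z)].
  apply: (choose_code cell (fun=> b0) (Q := fun V f => forall z, leK ra z a -> y z V (f z))); last exact: segdec.
  by move=> V V' f p s H z za; apply: (frc_her p s); apply: H.
have [N NP] := choice code; have [F FP] := choice NP.
have ex : exists t, exists V F, po W V /\ coded ra y r F V t.
  exists None, W, F; split; first exact: poW.
  move=> V a pV _; have [V1 [b [p1 s1 Nb]]] := frc_dense (N a) pV.
  have [nb [V2 [p2 s2 H]]] := FP a V1 b p1 Nb.
  exists V2, a, b; split=> //; [exact: subset_trans s1|by left|by case: b nb {Nb H}].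
have [t [[V [F' [pV HC]]] tmin]] := wo_min wor ex.
pose y' a := sval (restr (y a) pV).
have yE a V' b : y' a V' b <-> y a V' b by exact: (proj2_sig (restr (y a) pV)).
have below V' : po V V' -> V' `<=` V by case.
apply: (@small_case X V (bad_sub br pV) A ra woa a0 B b0 y' _ _ Ac Aunc K0 (option K0) r KG wor TK F' t).
- move=> a V1 p1; have [V2 [f [p2 s2 H]]] := segdec a V1 (po_le pV p1).
  exists V2, f; split=> //; first exact: (po_in p2 (subset_trans s2 (below _ p1))).
  by move=> z za; apply/yE; apply: H.
- move=> V1 p1 [f Hf]; apply: (undec V1 (po_le pV p1)); exists f => a; apply/yE; exact: Hf.
- move=> V1 k p1 s1; have [V2 [l [b [p2 s2 kl bt H]]]] := HC V1 k (po_le pV p1) s1.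
  exists V2, l, b; split=> //; first exact: (po_in p2 (subset_trans s2 s1)).
  by move=> z zl; apply/yE; apply: H.
- move=> s F2 V1 st p1 HC1.
  have [|e|ts] := tmin s.
  + exists V1, F2; split; first exact: po_le pV p1.
    move=> V2 k p2 s2; have [V3 [l [b [p3 s3 kl bt H]]]] := HC1 V2 k (po_in p2 (subset_trans s2 (below _ p1))) s2.
    exists V3, l, b; split=> //; first exact: po_le pV p3.
    by move=> z zl; apply/yE; apply: H.
  + by subst s; exact: (wo_irr wor st).
  + exact: (wo_asym wor st ts).
Qed.

Theorem no_bad_region (W : set X) : ~ bad_region W.
Proof.
move=> br.
have oG (G : {G : set X | open G}) : open (sval G) by exact: (proj2_sig G).
have nm (G : {G : set X | open G}) : { N : name W bool | forall V b, po W V ->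
    (if b then V `<=` sval G else V `&` sval G = set0) -> N V b }.
  apply: mk_name.
    move=> V pV; have [m|n] := pselect ((V `&` sval G) !=set0).
      exists (V `&` sval G), true; split; [exact: po_meet|by move=> p []|by move=> p []].
    exists V, false; split; [exact: pV|exact: subset_refl|].
    by apply: contrapT => /eqP/set0P.
  move=> V V' [] [] _ _ //= h h' [p [p1 p2]].
    by have : set0 p by rewrite -h'; split=> //; apply: h.
  by have : set0 p by rewrite -h; split=> //; apply: h'.
pose x G := sval (nm G).
have xP G V b : po W V -> (if b then V `<=` sval G else V `&` sval G = set0) -> x G V b.
  exact: (proj2_sig (nm G)).
have [r wor] := wo_exists {G : set X | open G}.
have [|W' [D [x' [pW' _ _ sd ud]]]] := undecided_tree br false (x := x) wor.
  exists W; split; first exact: poW.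
  (* The name attached to [V1] itself is undecided in [V]: [V1] forces one value and the disjoint
     [V2] the other. *)
  move=> V pV _ [f fP]; have [V1 [V2 [p1 p2 s1 s2 d]]] := po_split br pV.
  have o1' : open V1 by case: p1.
  have e1 : x (exist _ V1 o1') V1 true by apply: xP => //=.
  have e2 : x (exist _ V1 o1') V2 false by apply: xP => //=; rewrite setIC.
  have i1 : V1 `<=` V := subset_trans (@subset_closure _ V1) s1.
  have i2 : V2 `<=` V := subset_trans (@subset_closure _ V2) s2.
  have := frc_fun p1 e1 (frc_her p1 i1 (fP _)).
  by have := frc_fun p2 e2 (frc_her p2 i2 (fP _)) => <-.
have br' := bad_sub br pW'.
pose rk (y z : {y | D y}) := r (sval y) (sval z).
have wok : wo rk by apply: (wo_pull wor) => y z; apply: sig_inj.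
have [A [ra [c [woa cm cc reg]]]] := cofinal_regular wok.
pose N := tree_names false sd.
have cle a b : leK ra a b -> leK rk (c a) (c b) by case=> [->|/cm]; [left|right].
have cutE k f : cut rk false k f = cut rk false k (cut rk false k f).
  by apply: funext => z; rewrite /cut; case: pselect.
apply: (@no_undecided_regular W' br' A ra woa _ (fun=> false) (fun a => sval N (c a)) reg).
- move=> a V pV; have [V' [f [p s H]]] := sd (c a) V pV.
  exists V', (fun z => cut rk false (c z) f); split=> // z za.
  apply/(proj2_sig N); split; last exact: cutE.
  move=> w wz; rewrite /cut; case: pselect => // h; apply: H; exact: (leK_trans wok wz (cle _ _ za)).
- move=> V pV [f Hf]; apply: (ud V pV).
  suff /choice [g gP] : forall k, exists b, x' k V b by exists g.
  move=> k; have [a ka] := cc k; exists (f a k).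
  by have /(proj2_sig N) [H _] := Hf a; apply: H.
Qed.

End NoBad.

(** * From regions to the space *)

Lemma resolvable_of_dense_colorable (X : topologicalType) :
  (forall V : set X, po setT V -> exists V', [/\ po setT V', V' `<=` V & colorable V']) ->
  resolvable continuum X.
Proof.
move=> H; have [S [SQ Sd Sm]] := max_antichain H.
have [col colP] : exists col : X -> cont, forall V k, S V -> forall G, open G ->
    (G `&` V) !=set0 -> exists p, (G `&` V) p /\ col p = k.
  have H0 (V : set X) : exists c : X -> cont, S V -> forall G, open G -> G !=set0 -> G `<=` V ->
      forall k, exists p, G p /\ c p = k.
    have [SV|nS] := pselect (S V); last by exists (fun=> fun=> true).
    by have [_ [c cP]] := SQ V SV; exists c.
  have [c cP] := choice H0.
  exists (fun p => if pselect (exists V, S V /\ V p) is left h then c (projT1 (cid h)) p else fun=> true).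
  move=> V k SV G oG m.
  have [p [[Gp Vp] e]] := cP V SV (G `&` V) (openI oG (let: conj (And3 o _ _) _ := SQ V SV in o)) m (@subIsetr _ G V) k.
  exists p; split=> //; case: pselect => [h|[]]; last by exists V.
  case: cid => V' /= [SV' V'p]; rewrite -e; congr (c _ p).
  by apply: Sd => //; exists p.
exists (fun k p => col p = k); split=> [k|k l _ _ [p [<- <-]] //].
move=> G nG oG.
have [V [SV m]] : exists V, S V /\ (G `&` V) !=set0 by apply: Sm.
by have [p [[Gp _] e]] := colP V k SV G oG m; exists p.
Qed.

Lemma resolvable_or_bad (X : topologicalType) : crowded X -> feebly_compact X -> pi_regular X ->
  resolvable continuum X \/ exists W : set X, bad_region W.
Proof.
move=> cr fe re; have [h|nb] := pselect (exists W : set X, bad_region W); [by right|left].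
apply: resolvable_of_dense_colorable => V [oV nV _].
apply: contrapT => /forallNP H; apply: nb; exists V; split=> // U oU nU UV cU.
by apply: (H U).
Qed.

Lemma omega1_exists : exists O (ro : O -> O -> Prop), omega1 ro.
Proof.
have [r wor] := wo_exists cont.
have [ex|/forallNP nex] := pselect (exists t, ~ le_card (seg r t) nat); last first.
  exists cont, r; split=> // [|t]; last by apply: contrapT; exact: nex.
  exact: cantor_cont (le_card_refl _).
have [t [nt tmin]] := wo_min wor ex.
exists (seg r t), (fun x y => r (sval x) (sval y)); split=> //.
  by apply: (wo_pull wor) => x y; apply: sig_inj.
move=> [s st]; apply: (@le_card_trans _ (seg r s)).
  exists (fun x => exist (fun y => r y s) (sval (sval x)) (proj2_sig x)).
  by move=> x y [] /sig_inj /sig_inj.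
apply: contrapT => ns; case: (tmin s ns) => [e|ts]; first by subst s; exact: (wo_irr wor st).
exact: (wo_asym wor st ts).
Qed.

(** * Alephs and the cellularity bound *)

Lemma card_le_set T (A : set T) L : A #<= [set: L] -> le_card {x | A x} L.
Proof.
move=> /card_leP [f].
exists (fun x => val (f (SigSub (mem_set (proj2_sig x))))) => x y /val_inj.
by move/(inj (in_setT _) (in_setT _)) => /(congr1 val) e; apply: sig_inj.
Qed.

Lemma card_leE A B : card_leq A B <-> le_card A B.
Proof. by split=> /le_cardP. Qed.

Lemma card_equalE A B : card_equal A B <-> le_card A B /\ le_card B A.
Proof.
split=> [AB|[/le_cardP AB /le_cardP BA]]; last by rewrite /card_equal card_eq_le AB BA.
by move: AB; rewrite /card_equal card_eq_le => /andP [/le_cardP ? /le_cardP ?].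
Qed.

Lemma card_ltE A B : card_lt A B <-> ~ le_card B A.
Proof.
split=> [[/card_leE AB nAB] BA|nBA]; first by apply: nAB; apply/card_equalE.
by case: (le_card_total A B) => // AB; split; [apply/card_leE|move=> /card_equalE []].
Qed.

Section Aleph.
Variables (W : Type) (R : rel W) (F : W -> cardinal).
Hypotheses (wor : wo (strictly_below R))
  (RE : forall x y, R x y <-> x = y \/ strictly_below R x y) (aF : aleph_sequence R F).

Lemma aleph_least w : [/\ le_card nat (F w),
  forall v, strictly_below R v w -> ~ le_card (F w) (F v) &
  forall L, le_card nat L -> (forall v, strictly_below R v w -> ~ le_card L (F v)) -> le_card (F w) L].
Proof.
have [F0 FS Fl] := aF.
move: w; apply: (wo_ind wor) => w IH.
have [fw|/existsNP [v0 /contrapT v0w]] := pselect (is_first R w).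
  have /card_equalE [h1 h2] := F0 w fw; split=> // [v vw|L nL _]; first by case: (fw v).
  exact: le_card_trans h1 nL.
have [[v [vw vmax]]|nn] := pselect (exists v, is_next R v w).
  have [/card_ltE lt lst] := FS v w (conj vw vmax).
  have [inf _ _] := IH v vw.
  have le_w : le_card (F v) (F w) by case: (le_card_total (F v) (F w)).
  split; first exact: le_card_trans inf le_w.
  - move=> u uw h; have /RE [e|uv] := vmax u uw; first by subst u.
    have [_ m _] := IH v vw; apply: (m u uv).
    exact: le_card_trans le_w h.
  - by move=> L nL Lv; apply/card_leE; apply: lst; apply/card_ltE; apply: Lv.
have lw : is_limit R w by split; [move=> /(_ v0)|move=> v h; apply: nn; exists v].
have [ub lst] := Fl w lw.
have {}ub v : strictly_below R v w -> le_card (F v) (F w) by move=> /ub /card_leE.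
split.
- have [inf _ _] := IH v0 v0w; exact: le_card_trans inf (ub v0 v0w).
- move=> v vw h; apply: nn; exists v; split=> // u uw; apply/RE.
  case: (wo_tri wor u v) => [uv|e|vu]; [by right|by left|exfalso].
  have [_ m _] := IH u uw; apply: (m v vu); exact: le_card_trans (ub u uw) h.
- move=> L nL Lv; apply/card_leE; apply: lst => v vw; apply/card_leE.
  by case: (le_card_total L (F v)) => // h; case: (Lv v vw).
Qed.

Lemma aleph_onto t A : le_card nat A -> ~ le_card (F t) A ->
  exists x, strictly_below R x t /\ le_card A (F x) /\ le_card (F x) A.
Proof.
move=> infA At.
have [|x [Ax xmin]] := @wo_min _ _ wor (fun x => le_card A (F x)).
  by exists t; case: (le_card_total A (F t)).
have xA : le_card (F x) A.
  have [_ _ lst] := aleph_least x; apply: lst => // v vx Av.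
  case: (xmin v Av) => [e|xv]; first by subst v; exact: (wo_irr wor vx).
  exact: (wo_asym wor vx xv).
exists x; split=> //; case: (wo_tri wor x t) => // [e|tx]; first by case: At; rewrite -e.
have [_ m _] := aleph_least x; case: (m t tx).
by apply: le_card_trans xA _; case: (le_card_total A (F t)).
Qed.

End Aleph.

(** [j] embeds one order as an initial segment of the other, so the least-cardinal descriptions
    agree by induction. *)
Lemma aleph_unique W (R : rel W) F W' (R' : rel W') F' (j : W' -> W) :
  wo (strictly_below R) -> (forall x y, R x y <-> x = y \/ strictly_below R x y) -> aleph_sequence R F ->
  wo (strictly_below R') -> (forall x y, R' x y <-> x = y \/ strictly_below R' x y) -> aleph_sequence R' F' ->
  (forall x y, strictly_below R' x y -> strictly_below R (j x) (j y)) ->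
  (forall y u, strictly_below R u (j y) -> exists x, strictly_below R' x y /\ u = j x) ->
  forall x, le_card (F' x) (F (j x)) /\ le_card (F (j x)) (F' x).
Proof.
move=> wor RE aF wor' RE' aF' jm ji; apply: (wo_ind wor') => x IH.
have [i1 m1 l1] := aleph_least wor RE aF (j x); have [i2 m2 l2] := aleph_least wor' RE' aF' x.
split.
- apply: l2 => // v vx h; apply: (m1 (j v) (jm v x vx)).
  exact: le_card_trans h (IH v vx).1.
- apply: l1 => // u /ji [v [vx ->]] h; apply: (m2 v vx).
  exact: le_card_trans h (IH v vx).2.
Qed.

Section Succ.
Variables (W : Type) (R : rel W) (woR : well_order R).

Lemma succ_wo : wo (strictly_below (ordinal_succ R)) /\
  forall x y, ordinal_succ R x y <-> x = y \/ strictly_below (ordinal_succ R) x y.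
Proof.
have [wor RE] := wo_of_well_order woR; split; last first.
  move=> [x|[]] [y|[]]; split=> //.
  - by move=> /RE [->|h]; [left|right].
  - by move=> [[->]|[]//]; apply/RE; left.
  - by right.
  - by case=> // -[].
  - by left.
split.
- by move=> [x|[]] [] //= ->.
- move=> [x|[]] [y|[]] [z|[]] h1 h2; try by case: h1; case: h2.
  exact: (wo_tr wor h1 h2).
- move=> P [x Px]; have [ex|na] := pselect (exists a, P (inl a)).
    have [b [Pb bmin]] := wo_min wor ex.
    by exists (inl b); split=> // -[c|[]] Pc; [case: (bmin c Pc) => [->|]; [left|right]|right].
  exists (inr tt); split; first by case: x Px => [a Pa|[]] //; case: na; exists a.
  by move=> [a|[]] Pa; [case: na; exists a|left].
Qed.

End Succ.

Lemma continuum_succ_countable W (R : rel W) (K C : cardinal) : inhabited W ->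
  (forall w, countable [set v | strictly_below R v w]) ->
  is_continuum_succ R K -> le_card cont C -> ~ le_card K C -> countably_many_cardinals C.
Proof.
move=> [w1] cR [V [S [[woS [F' [aF' eF']]] [woR [F [aF eF]]]]]] cC KC.
have [wo1 RE1] := succ_wo woS; have [wo2 RE2] := succ_wo woR.
have {eF'} [F'c cF'] := iffLR (card_equalE _ _) eF'; have {eF} [FK KF] := iffLR (card_equalE _ _) eF.
(* [x0], the first element of the second summand, is the position of the continuum among the alephs
   of the sum. *)
have [|x0 [[w0 ex0] w0min]] := @wo_min _ _ wo2 (fun x => exists w : W, x = inl (inr w)).
  by exists (inl (inr w1)), w1.
pose j (x : V + unit) : V + W + unit := match x with inl v => inl (inl v) | inr _ => x0 end.
have jE : forall x, le_card (F' x) (F (j x)) /\ le_card (F (j x)) (F' x).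
  apply: (aleph_unique wo2 RE2 aF wo1 RE1 aF').
  - by move=> [v|[]] [v'|[]] //; rewrite /j ?ex0 //; case.
  - move=> [y|[]] [[v|w]|[]] //=.
    + by move=> h; exists (inl v).
    + by case.
    + by case.
    + by move=> _; exists (inl v).
    + move=> h; case: (w0min (inl (inr w))) => [|e|h']; first by exists w.
        by rewrite -e in h; case: (wo_irr wo2 h).
      by case: (wo_asym wo2 h h').
    + by rewrite ex0 => -[].
have infC := le_card_trans le_nat_cont cC.
have HC A : le_card cont A -> le_card A C -> exists w, le_card A (F (inl (inr w))) /\ le_card (F (inl (inr w))) A.
  move=> cA AC; have infA := le_card_trans le_nat_cont cA.
  have [|x [xt [Ax xA]]] := aleph_onto wo2 RE2 aF (t := inr tt) infA.
    by move=> h; apply: KC; apply: le_card_trans KF (le_card_trans h AC).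
  case: x xt Ax xA => [[v|w]|[]] xt Ax xA; last by case: (wo_irr wo2 xt).
    exfalso; have [_ m _] := aleph_least wo1 RE1 aF' (inr tt).
    apply: (m (inl v)) => //; apply: (le_card_trans F'c).
    exact: le_card_trans cA (le_card_trans Ax (jE (inl v)).2).
  by exists w.
have [wc [Cw wC]] := HC C cC (le_card_refl _).
have [n nI] := card_le_set (cR wc).
(* [C] sits at position [wc], which gets number 0; the countably many positions below it are shifted
   by one. *)
pose num (w : W) : nat := if pselect (strictly_below R w wc) is left h then (n (exist _ w h)).+1 else 0.
exists (fun m => if pselect (exists w, num w = m /\ (w = wc \/ strictly_below R w wc)) is left h
  then F (inl (inr (projT1 (cid h)))) else C) => A cA AC.
have [w [Aw wA]] := HC A cA AC.
have wwc : w = wc \/ strictly_below R w wc.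
  case: (wo_tri wo2 (inl (inr w)) (inl (inr wc))) => [h|[]|h]; [by right|by left|exfalso].
  have [_ m _] := aleph_least wo2 RE2 aF (inl (inr w)); apply: (m _ h).
  exact: le_card_trans wA (le_card_trans AC Cw).
exists (num w); case: pselect => [h|[]]; last by exists w.
case: cid => w' /= [e w'wc]; suff -> : w' = w by [].
have nr : ~ strictly_below R wc wc by case=> h' /negP.
move: e; rewrite /num; case: pselect => h1; case: pselect => h2 //.
  by move=> [] /nI [].
by move=> _; case: wwc => // ->; case: w'wc.
Qed.

(* The cardinality [K0] is the maximum of the continuum and the cellularity. *)
Lemma cellularity_code (X : topologicalType) W (R : rel W) : inhabited W ->
  (forall w, countable [set v | strictly_below R v w]) ->
  cellularity_lt_continuum_succ X R ->
  exists K0 : Type, [/\ countably_many_cardinals K0, le_card cont K0 & cellular_bound X K0].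
Proof.
move=> iW cR [C [K [[[_ cel] _] sK /card_ltE CK]]].
have cell : cellular_bound X C.
  move=> S So Sd; apply: card_le_set; apply: cel; split=> // U V SU SV m; exact: Sd.
case: (le_card_total cont C) => cC.
  by exists C; split=> //; exact: continuum_succ_countable sK cC CK.
exists cont; split; last 2 first.
- exact: le_card_refl.
- by move=> S So Sd; apply: le_card_trans (cell S So Sd) cC.
- by exists (fun=> cont) => A cA Ac; exists 0.
Qed.

Theorem mainTheorem2 (X : topologicalType)
    (crowdedX : crowded X) (feeblyX : feebly_compact X) (regX : pi_regular X) :
  (cellularity_lt_continuum_succ X leq -> resolvable continuum X) /\
  (~ continuum_hypothesis ->
   forall (W : Type) (R : rel W), is_omega1 R ->
     cellularity_lt_continuum_succ X R -> resolvable continuum X).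
Proof.
(* The orders of type [omega] and omega_1 are treated together: both are nonempty with countable
   initial segments. *)
have main W (R : rel W) : inhabited W -> (forall w, countable [set v | strictly_below R v w]) ->
    cellularity_lt_continuum_succ X R -> resolvable continuum X.
  move=> iW cR hX; case: (resolvable_or_bad crowdedX feeblyX regX) => // -[V br].
  have [K0 [KG cK cell]] := cellularity_code iW cR hX.
  have [O [ro o1]] := omega1_exists.
  by case: (no_bad_region o1 KG cK cell br).
split; first by apply: main => //; exact: (inhabits 0).
move=> _ W R [_ ncW cR]; apply: main => //.
apply: contrapT => nW; apply: ncW; apply/le_cardP.
by exists (fun w => False_rect _ (nW (inhabits w))) => w; case: nW.
Qed.
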